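(* Let $K\ge1$, let $f$ be a probability density on $\mathbb{R}^K$ that is symmetric ($f(-\mathbf{x})=f(\mathbf{x})$), positive and continuously differentiable, and let $\boldsymbol{\delta}\in\mathbb{R}^K$. Assume that for each $n$ the $\mathbb{R}^K$-valued random vectors $\mathbf{X}_1,\dots,\mathbf{X}_n$ (forming a triangular array) are independent, with $\mathbf{X}_1,\dots,\mathbf{X}_{n_1}$ i.i.d. with density $f(\mathbf{x})$ and $\mathbf{X}_{n_1+1},\dots,\mathbf{X}_n$ i.i.d. with density $f(\mathbf{x}-\boldsymbol{\delta}/\sqrt n)$. Let $f_k$ and $F_k$ denote the $k$th marginal density and c.d.f. of $f$, and assume that the $K\times K$ matrix $\Sigma$ with entries $\Sigma_{kk'}=4\operatorname{Cov}_f(F_k(X_{1,k}),F_{k'}(X_{1,k'}))$ is positive definite. Assume also that the Fisher information matrix $I_f=\mathbb{E}_f[\nabla\log f(\mathbf{X}_1)\,\nabla\log f(\mathbf{X}_1)']$ is finite and that the densities $f_k$ are bounded above for all $k$. Then, as $n\to\infty$ with $n_1/n\to t_1\in(0,1)$, $$S_n(n_1)=\mathbf{U}_n(n_1)'\hat\Sigma_n^{-1}\mathbf{U}_n(n_1)\ \stackrel{d}{\longrightarrow}\ \chi^2_K\big(4t_1(1-t_1)\,\boldsymbol{\delta}'A'\Sigma^{-1}A\boldsymbol{\delta}\big),$$ where $A=\mathbb{E}_f[(F(\mathbf{X}_1)-1/2)\,\nabla\log f(\mathbf{X}_1)']$.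
   Context: The prime denotes transposition, $\mathbf 1(\cdot)$ the indicator function, and $\mathbb{E}_f,\operatorname{Cov}_f$ are taken under $\mathbf{X}_1\sim f$. $\chi^2_K(d)$ denotes the non-central chi-squared distribution with $K$ degrees of freedom and non-centrality parameter $d$ (the law of $\|Z\|^2$ with $Z\sim\mathcal N(\mu,\mathrm{Id}_K)$, $\|\mu\|^2=d$). For $\mathbf{x}=(x_1,\dots,x_K)'$, $F(\mathbf{x})=(F_1(x_1),\dots,F_K(x_K))'$, and $F(\mathbf{x})-1/2$ means subtracting $1/2$ from every coordinate. $\mathbf{U}_n(n_1)=(U_{n,1}(n_1),\dots,U_{n,K}(n_1))'$ with $$U_{n,k}(n_1)=\frac{1}{\sqrt{n n_1(n-n_1)}}\sum_{i=1}^{n_1}\sum_{j=n_1+1}^{n}\{\mathbf 1(X_{i,k}\le X_{j,k})-\mathbf 1(X_{j,k}\le X_{i,k})\}.$$ With $\hat F_{n,k}(t)=n^{-1}\sum_{j=1}^n\mathbf 1(X_{j,k}\le t)$, the matrix $\hat\Sigma_n$ is the $K\times K$ matrix with entries $$\hat\Sigma_{n,kk'}=\frac4n\sum_{i=1}^n\{\hat F_{n,k}(X_{i,k})-1/2\}\{\hat F_{n,k'}(X_{i,k'})-1/2\}.$$ The statistic is defined by the displayed formula whenever $\hat\Sigma_n$ is invertible; its value when $\hat\Sigma_n$ is singular may be set arbitrarily. *)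

(* Defs.v *)
From HB Require Import structures.
From mathcomp Require Import all_boot all_order all_algebra.
From mathcomp Require Import all_classical all_reals all_analysis.
From mathcomp Require Import measurable_realfun.

Set Implicit Arguments.
Unset Strict Implicit.
Unset Printing Implicit Defensive.

Import Order.TTheory GRing.Theory Num.Theory.
Import numFieldNormedType.Exports.

Local Open Scope classical_set_scope.
Local Open Scope ring_scope.

(* On real matrices the sigma-algebra generated by the entries is the Borel
   one. *)
Definition measure_mx_display : measure_display -> measure_display.
Proof. exact. Qed.

Definition mx_entries d (T : measurableType d) m n : set (set 'M[T]_(m, n)) :=
  [set A | exists i j (B : set T),
    measurable B /\ A = [set M : 'M[T]_(m, n) | B (M i j)]].

Section measurable_matrix.
Context {d} {T : measurableType d}.
Variables m n : nat.
Let G := <<s @mx_entries d T m n >>.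

Let mx_set0 : G set0. Proof. exact: sigma_algebra0. Qed.

Let mx_setC A : G A -> G (~` A). Proof. exact: sigma_algebraC. Qed.

Let mx_bigcup (F : _^nat) : (forall i, G (F i)) -> G (\bigcup_i (F i)).
Proof. exact: sigma_algebra_bigcup. Qed.

HB.instance Definition _ := @isMeasurable.Build (measure_mx_display d)
  'M[T]_(m, n) G mx_set0 mx_setC mx_bigcup.

Lemma measurable_entry (i : 'I_m) (j : 'I_n) :
  measurable_fun [set: 'M[T]_(m, n)] (fun M => M i j).
Proof.
move=> _ B mB; rewrite setTI; apply: sub_sigma_algebra.
by exists i, j, B.
Qed.

Lemma measurable_fun_mxP d' (T' : measurableType d') (g : T' -> 'M[T]_(m, n)) :
  (forall i j, measurable_fun [set: T'] (fun x => g x i j)) ->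
  measurable_fun [set: T'] g.
Proof.
move=> mg; apply: (@measurability _ _ _ _ _ _ (@mx_entries d T m n)) => //.
move=> _ [_ [i [j [B [mB ->]]]] <-].
by have := mg i j measurableT B mB.
Qed.
End measurable_matrix.

Section product_measure_cV.
Context {R : realType}.

Definition insert_coord n (k : 'I_n) (t : R) (y : 'cV[R]_n.-1) : 'cV[R]_n :=
  \col_i (if unlift k i is Some j then y j ord0 else t).

Lemma measurable_insert_coord n (k : 'I_n) : measurable_fun
  [set: 'cV[R]_n.-1 * measurableTypeR R] (fun p => insert_coord k p.2 p.1).
Proof.
apply: measurable_fun_mxP => i j.
rewrite (_ : (fun _ => _) = fun p : 'cV[R]_n.-1 * measurableTypeR R =>
    if unlift k i is Some l then p.1 l ord0 else p.2); last first.
  by apply/funext => p; rewrite /insert_coord mxE.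
case: (unlift k i) => [l|]; last exact: measurable_snd.
by apply: (measurableT_comp (measurable_entry l ord0)).
Qed.

(* The successor case is the image of (product of the first n' factors) x
   (last factor) under (y, t) |-> (y_0, ..., y_{n'-1}, t), packed as a
   measure. *)
Fixpoint product_cV n :
    ('I_n -> {sigma_finite_measure set (measurableTypeR R) -> \bar R}) ->
    {measure set 'cV[R]_n -> \bar R} :=
  match n return ('I_n -> {sigma_finite_measure set (measurableTypeR R) -> \bar R}) ->
    {measure set 'cV[R]_n -> \bar R} with
  | 0 => fun _ => \d_(0 : 'cV[R]_0)
  | n'.+1 => fun m =>
      measure_function_pushforward__canonical__measure_function_Measure
        (product_cV (fun i : 'I_n' => m (lift ord_max i)) \x m ord_max)%E
        (measurable_insert_coord (ord_max : 'I_n'.+1))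
  end.

Lemma product_cV_box n
    (m : 'I_n -> {sigma_finite_measure set (measurableTypeR R) -> \bar R})
    (B : 'I_n -> set (measurableTypeR R)) : (forall i, measurable (B i)) ->
  product_cV m [set x | forall i, B i (x i ord0)] = (\prod_(i < n) m i (B i))%E.
Proof.
elim: n m B => [|n IH] m B mB /=.
  by rewrite big_ord0 diracE mem_set// => -[].
rewrite big_ord_recr /=.
pose C := [set y : 'cV[R]_n | forall i, B (lift ord_max i) (y i ord0)].
have mC : measurable C.
  rewrite (_ : C = \bigcap_(i in [set: 'I_n])
      ([set: 'cV[R]_n] `&` (fun y => y i ord0) @^-1` B (lift ord_max i))).
    apply: fin_bigcap_measurable => // i _.
    exact: (measurable_entry i ord0) (mB _).
  apply/seteqP; split => y /=; first by move=> Cy i _; split => //; exact: Cy.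
  by move=> Cy i; have [] := Cy i I.
have wl (i : 'I_n) : widen_ord (leqnSn n) i = lift ord_max i.
  by apply/val_inj; rewrite /= /bump leqNgt ltn_ord.
rewrite /pushforward (_ : _ @^-1` _ = C `*` B ord_max).
  rewrite product_measure1E//; congr (_ * _)%E.
  transitivity (\prod_(i < n) m (lift ord_max i) (B (lift ord_max i)))%E.
    exact: (IH (fun i => m (lift ord_max i)) (fun i => B (lift ord_max i))).
  by apply: eq_bigr => i _; rewrite wl.
apply/seteqP; split => -[y t] /=.
  move=> H; split => [i|]; last by have := H ord_max; rewrite mxE unlift_none.
  by have := H (lift ord_max i); rewrite mxE liftK.
move=> [Cy Bt] i; rewrite mxE; case: unliftP => [j ->|->] //.
Qed.

Lemma product_cV_setT n (m : 'I_n -> {sigma_finite_measure set (measurableTypeR R) -> \bar R}) :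
  (forall i, m i [set: measurableTypeR R] = 1%E) -> product_cV m [set: 'cV[R]_n] = 1%E.
Proof.
elim: n m => [|n IH] m m1 /=; first by rewrite diracT.
rewrite /pushforward preimage_setT -setXTT product_measure1E//.
by rewrite IH ?m1 ?mule1.
Qed.

Definition lebesgue_cV n : {measure set 'cV[R]_n -> \bar R} :=
  product_cV (fun=> lebesgue_measure).

Definition normal_cV n (mu : 'cV[R]_n) : set 'cV[R]_n -> \bar R :=
  product_cV (fun i => normal_prob (mu i ord0) 1).

HB.instance Definition _ n (mu : 'cV[R]_n) := Measure.on (normal_cV mu).

Let normal_cV_setT n (mu : 'cV[R]_n) : normal_cV mu [set: _] = 1%E.
Proof. by apply: product_cV_setT => i; exact: (probability_setT (normal_prob (mu i ord0) 1)). Qed.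

HB.instance Definition _ n (mu : 'cV[R]_n) :=
  Measure_isProbability.Build _ _ _ (normal_cV mu) (normal_cV_setT mu).

End product_measure_cV.

Section noncentral_chi2.
Context {R : realType}.

Definition sqnorm n (z : 'cV[R]_n) : R := \sum_(i < n) z i ord0 ^+ 2.

Let measurable_sqnorm n : measurable_fun [set: 'cV[R]_n] (@sqnorm n).
Proof.
by apply: measurable_sum => i; apply: measurable_funX; exact: measurable_entry.
Qed.

HB.instance Definition _ n :=
  isMeasurableFun.Build _ _ _ _ (@sqnorm n) (@measurable_sqnorm n).

Definition chi2_mean n (d : R) : 'cV[R]_n :=
  \col_i (if i == 0 :> nat then Num.sqrt d else 0).

Lemma sqnorm_chi2_mean n d : (0 < n)%N -> 0 <= d -> sqnorm (chi2_mean n d) = d.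
Proof.
case: n => // n _ d0; rewrite /sqnorm big_ord_recl big1 => [|i _].
  by rewrite /chi2_mean mxE /= sqr_sqrtr// addr0.
by rewrite /chi2_mean mxE /= expr0n.
Qed.

(* By rotation invariance the law of |Z|^2, Z ~ N(mu, Id), depends on mu only
   through |mu|^2; mu = (sqrt d, 0, ..., 0) is taken as representative. *)
Definition noncentral_chi2 n (d : R) : probability R R :=
  distribution (normal_cV (chi2_mean n d)) (@sqnorm n).

End noncentral_chi2.

Section probability_notions.
Context {R : realType}.

Definition has_density n (mu : probability 'cV[R]_n R) (f : 'cV[R]_n -> R) :=
  forall B : set 'cV[R]_n, measurable B ->
    mu B = (\int[lebesgue_cV n]_(x in B) (f x)%:E)%E.

Definition independent_family d d' (T : measurableType d)
    (T' : measurableType d') (P : probability T R) n (X : 'I_n -> T -> T') :=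
  forall (J : {set 'I_n}) (B : 'I_n -> set T'),
    (forall i, i \in J -> measurable (B i)) ->
    P (\bigcap_(i in [set` J]) X i @^-1` B i) =
    (\prod_(i in J) P (X i @^-1` B i))%E.

Definition cvg_in_distribution (d : nat -> measure_display)
    (T : forall n, measurableType (d n)) (P : forall n, probability (T n) R)
    (S : forall n, {RV (P n) >-> R}) (nu : probability R R) :=
  forall x : R, {for x, continuous (fun y : R => nu `]-oo, y]%classic)} ->
    cdf (S n) x @[n --> \oo] --> nu `]-oo, x]%classic.

End probability_notions.

Section density.
Context {R : realType} {K : nat}.
Implicit Types (f : 'cV[R]_K -> R) (P : probability 'cV[R]_K R).

Definition gradient f (x : 'cV[R]_K) : 'cV[R]_K :=
  \col_k 'D_(delta_mx k ord0) f x.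

Definition continuously_differentiable f :=
  (forall x, differentiable f x) /\ continuous (gradient f).

Definition score f : 'cV[R]_K -> 'cV[R]_K := gradient (fun x => ln (f x)).

(* The coordinates other than the k-th are integrated out; K.-1 is harmless as
   'I_K is empty for K = 0. *)
Definition marginal_density f (k : 'I_K) (t : R) : \bar R :=
  (\int[lebesgue_cV K.-1]_y (f (insert_coord k t y))%:E)%E.

Definition marginal_cdf P (k : 'I_K) (t : R) : R :=
  fine (P [set x | x k ord0 <= t]).

(* The matrix Sigma. *)
Definition rank_cov P : 'M[R]_K :=
  \matrix_(k, l) (4 * fine (covariance P
    (fun x => marginal_cdf P k (x k ord0))
    (fun x => marginal_cdf P l (x l ord0)))).

(* The matrix A. *)
Definition rank_score_cross P f : 'M[R]_K :=
  \matrix_(k, l) fine 'E_P[(fun x =>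
    (marginal_cdf P k (x k ord0) - 2^-1) * score f x l ord0)%R].

Definition posdef (M : 'M[R]_K) :=
  M^T = M /\ forall v : 'cV[R]_K, v != 0 -> 0 < (v^T *m M *m v) ord0 ord0.

End density.

Section statistic.
Context {R : realType} {K n : nat}.
Implicit Types (x : 'I_n -> 'cV[R]_K).

Definition rank_vector x (n1 : nat) : 'cV[R]_K :=
  \col_k ((Num.sqrt (n%:R * n1%:R * (n%:R - n1%:R)))^-1 *
    \sum_(i < n | (i < n1)%N) \sum_(j < n | (n1 <= j)%N)
      ((x i k ord0 <= x j k ord0)%R%:R - (x j k ord0 <= x i k ord0)%R%:R)).

Definition ecdf x (k : 'I_K) (t : R) : R :=
  n%:R^-1 * \sum_(j < n) (x j k ord0 <= t)%R%:R.

Definition rank_cov_hat x : 'M[R]_K :=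
  \matrix_(k, l) (4 / n%:R * \sum_(i < n)
    ((ecdf x k (x i k ord0) - 2^-1) * (ecdf x l (x i l ord0) - 2^-1))).

Definition change_statistic x (n1 : nat) : R :=
  ((rank_vector x n1)^T *m invmx (rank_cov_hat x) *m rank_vector x n1)
    ord0 ord0.

End statistic.

(* Main.v *)
From HB Require Import structures.
Require Import Defs.
From mathcomp Require Import all_boot all_order all_algebra.
From mathcomp Require Import all_classical all_reals all_analysis.
From mathcomp Require Import measurable_realfun ring lra.

Set Implicit Arguments.
Unset Strict Implicit.
Unset Printing Implicit Defensive.

Import Order.TTheory GRing.Theory Num.Theory.
Import numFieldNormedType.Exports.

Local Open Scope classical_set_scope.
Local Open Scope ring_scope.

(** Subtracting the shift from the second part of the sample leaves vectors
    Y_1, ..., Y_n that are exactly i.i.d. with density f, so everything is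
    computed under this one law. Write s = 1 / sqrt n and xi_k = 2 F_k - 1.

    The numerator. Coordinate k of the rank vector is a two-sample
    U-statistic that compares Y_i with Y_j + s delta. Its Hoeffding
    decomposition is U_k = b_k + sum_i a_i xi_k(Y_i) + remainder, where the
    weights a_i have Euclidean norm 1. The remainder consists of a degenerate
    double sum and of two single sums whose terms are small because F_k is
    Lipschitz (f_k is bounded); in each of them the terms are pairwise
    orthogonal, so the remainder is O(s) in mean ([rank_vector_linear]). The
    deterministic part is b_k = sqrt (n1 n2 / n) theta_k with theta_k the mean
    of 2 F_k(y_k + s delta_k) - 1 under f. Moving the shift onto f and
    integrating its directional derivative along the segment gives
    theta_k = -2 s (A delta)_k + O(s^2) ([rank_drift_expansion]), hence b tends
    to mu = -2 sqrt (t1 (1 - t1)) A delta.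

    The matrix. Given Y_i, the empirical distribution function at X_i is, up
    to O(s), F_k(Y_i) plus an average of independent centred
    terms. The entries of the estimated matrix are therefore within O(s) in
    mean of the averages of xi_k(Y_i) xi_l(Y_i), whose expectation is Sigma_kl
    ([rank_cov_hat_consistent]).

    The limit law. Choose B with B Sigma B' = 1 and B mu on the first axis
    ([whiten_to_axis]); then |B mu|^2 = mu' Sigma^-1 mu is the announced
    non-centrality. The quadratic form is continuous, so the statistic is close
    in probability to |B mu + sum_i a_i B xi(Y_i)|^2. The vectors B xi(Y_i) are
    bounded and centred with identity covariance, and replacing them one by one
    by Gaussian vectors changes the expectation of a smooth function by at most
    a multiple of sum_i |a_i|^3 ([lindeberg]), which tends to 0. Applied to
    smooth cut-offs of z -> |B mu + z|^2 ([radial_cutoff_smooth]) this bounds the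
    distribution function of the statistic above and below by that of the limit
    at nearby points ([statistic_cdf_sandwich]); the width of the cut-off is
    finally sent to 0 at a continuity point ([chi2_limit]).

    Independence enters only through [decouple_others]: the expectation of a
    function of Y_j and of the other variables may be computed by integrating
    Y_j out first. All orthogonality relations follow from it. *)

(** * Bounded measurable functions and their integrals *)

(** All random variables averaged under the sampling law are bounded, so one
    closure property replaces integrability arguments: these functions are
    integrable for every probability and stable under the operations used. *)
Definition bmf d (T : measurableType d) (R : realType) (f : T -> R) :=
  measurable_fun [set: T] f /\ exists C, forall x, `|f x| <= C.

Section bounded_measurable.
Context d (T : measurableType d) (R : realType).
Implicit Types f g : T -> R.

Lemma bmf_meas f : bmf f -> measurable_fun [set: T] f. Proof. by case. Qed.

Lemma bmf_cst (c : R) : bmf (fun _ : T => c).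
Proof. by split; [exact: measurable_cst | exists `|c|]. Qed.

Lemma bmfD f g : bmf f -> bmf g -> bmf (fun x => f x + g x).
Proof.
move=> [mf [C fC]] [mg [D gD]]; split; first exact: measurable_funD.
by exists (C + D) => x; rewrite (le_trans (ler_normD _ _)) ?lerD.
Qed.

Lemma bmfN f : bmf f -> bmf (fun x => - f x).
Proof.
by move=> [mf [C fC]]; split; [exact: measurableT_comp | exists C => x; rewrite normrN].
Qed.

Lemma bmfB f g : bmf f -> bmf g -> bmf (fun x => f x - g x).
Proof. by move=> bf bg; apply: bmfD => //; exact: bmfN. Qed.

Lemma bmfM f g : bmf f -> bmf g -> bmf (fun x => f x * g x).
Proof.
move=> [mf [C fC]] [mg [D gD]]; split; first exact: measurable_funM.
by exists (C * D) => x; rewrite normrM ler_pM.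
Qed.

Lemma bmfX f n : bmf f -> bmf (fun x => f x ^+ n).
Proof.
move=> bf; elim: n => [|n IH]; first by under eq_fun do rewrite expr0; exact: bmf_cst.
by under eq_fun do rewrite exprS; exact: bmfM.
Qed.

Lemma bmf_norm f : bmf f -> bmf (fun x => `|f x|).
Proof.
by move=> [mf [C fC]]; split; [exact: measurableT_comp | exists C => x; rewrite normr_id].
Qed.

Lemma bmf_sum (I : Type) (s : seq I) (p : pred I) (F : I -> T -> R) :
  (forall i, p i -> bmf (F i)) -> bmf (fun x => \sum_(i <- s | p i) F i x).
Proof.
move=> bF; elim: s => [|i s IH].
  by under eq_fun do rewrite big_nil; exact: bmf_cst.
have [pi|/negbTE pi] := boolP (p i).
  by under eq_fun do rewrite big_cons pi; apply: bmfD => //; exact: bF.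
by under eq_fun do rewrite big_cons pi.
Qed.

Lemma bmf_comp d' (S : measurableType d') (h : S -> T) f :
  measurable_fun [set: S] h -> bmf f -> bmf (fun x => f (h x)).
Proof. by move=> mh [mf [C fC]]; split; [exact: measurableT_comp | exists C]. Qed.

Lemma bmf_bool (p : T -> bool) : measurable_fun [set: T] p -> bmf (fun x => (p x)%:R : R).
Proof.
move=> mp; split.
  rewrite (_ : (fun _ => _) = \1_(p @^-1` [set true])).
    by apply: measurable_indic; rewrite -[X in measurable X]setTI; exact: mp.
  apply/funext => x; rewrite indicE; congr (_%:R).
  case: (boolP (p x)) => px; first by rewrite mem_set.
  by rewrite memNset//= => pT; rewrite pT in px.
by exists 1 => x; case: (p x); rewrite ?normr1 ?normr0.
Qed.

Lemma bmf_integrable (P : probability T R) f :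
  bmf f -> P.-integrable [set: T] (EFin \o f).
Proof.
move=> [mf [C fC]]; apply: measurable_bounded_integrable => //.
  by apply: (@le_lt_trans _ _ 1%E); [exact: probability_le1 | exact: ltry].
exists C; split; first exact: num_real.
by move=> M CM x _ /=; rewrite (le_trans (fC x)) ?ltW.
Qed.

End bounded_measurable.

#[global] Hint Resolve bmf_cst : core.

Section expectation.
Context d (T : measurableType d) (R : realType) (P : probability T R).
Implicit Types f g : T -> R.
Let int f := P.-integrable [set: T] (EFin \o f).

Lemma RintD f g : int f -> int g ->
  \int[P]_x (f x + g x) = \int[P]_x f x + \int[P]_x g x.
Proof. exact: RintegralD. Qed.

Lemma RintB f g : int f -> int g ->
  \int[P]_x (f x - g x) = \int[P]_x f x - \int[P]_x g x.
Proof. exact: RintegralB. Qed.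

Lemma RintZ c f : int f -> \int[P]_x (c * f x) = c * \int[P]_x f x.
Proof. exact: RintegralZl. Qed.

Lemma Rint_cst c : \int[P]_x c = c.
Proof.
rewrite Rintegral_cst// [X in _ * X](_ : _ = 1) ?mulr1//.
exact: (congr1 fine (probability_setT P)).
Qed.

Lemma Rint_le f g : int f -> int g -> (forall x, f x <= g x) ->
  \int[P]_x f x <= \int[P]_x g x.
Proof. by move=> *; apply: le_Rintegral. Qed.

Lemma Rint_norm f : int f -> `|\int[P]_x f x| <= \int[P]_x `|f x|.
Proof. by move=> *; apply: le_normr_Rintegral. Qed.

Lemma int_sum (I : Type) (s : seq I) (p : pred I) (F : I -> T -> R) :
  (forall i, p i -> int (F i)) -> int (fun x => \sum_(i <- s | p i) F i x).
Proof.
move=> iF; rewrite /int [X in integrable _ _ X](_ : _ =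
  (fun x => \sum_(i <- s | p i) (F i x)%:E)%E); last by apply/funext => x /=; rewrite sumEFin.
have := @integrable_sum _ _ _ P setT measurableT I s p (fun i x => (F i x)%:E).
by apply => // i pi; exact: iF.
Qed.

Lemma Rint_sum (I : Type) (s : seq I) (p : pred I) (F : I -> T -> R) :
  (forall i, p i -> int (F i)) ->
  \int[P]_x (\sum_(i <- s | p i) F i x) = \sum_(i <- s | p i) \int[P]_x F i x.
Proof.
move=> iF; elim: s => [|i s IH].
  by under eq_Rintegral do rewrite big_nil; rewrite Rint_cst big_nil.
rewrite big_cons; under eq_Rintegral do rewrite big_cons.
case: ifPn => // pi; rewrite RintD ?IH//; first exact: iF.
exact: int_sum.
Qed.

Lemma Rint_bound f c : bmf f -> (forall x, `|f x| <= c) -> `|\int[P]_x f x| <= c.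
Proof.
move=> bf fc; apply: le_trans (Rint_norm _) _; first exact: bmf_integrable.
rewrite -[leRHS]Rint_cst; apply: Rint_le => //; apply: bmf_integrable => //.
exact: bmf_norm.
Qed.

Lemma Rint_law d' (S : measurableType d') (Q : probability S R) (Y : T -> S) (u : S -> R) :
  measurable_fun [set: T] Y -> (forall B, measurable B -> P (Y @^-1` B) = Q B) ->
  measurable_fun [set: S] u -> Q.-integrable [set: S] (EFin \o u) ->
  int (u \o Y) /\ \int[P]_x u (Y x) = \int[Q]_y u y.
Proof.
move=> mY lawY mu iu.
have eqm (A : set S) : measurable A -> A `<=` setT -> pushforward P Y A = Q A.
  by move=> mA _; rewrite -lawY.
have mEu : measurable_fun [set: S] (EFin \o u) by exact/measurable_EFinP.
have iuY : int (u \o Y).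
  apply/integrableP; split; first by apply/measurable_EFinP; exact: measurableT_comp.
  have /integrableP[_] := iu; rewrite -(eq_measure_integral Q eqm).
  by rewrite ge0_integral_pushforward//; apply: measurableT_comp.
split => //; rewrite /Rintegral -(eq_measure_integral Q eqm).
by rewrite integral_pushforward.
Qed.

Lemma cauchy_schwarz1 f : bmf f -> (\int[P]_x `|f x|) ^+ 2 <= \int[P]_x (f x ^+ 2).
Proof.
move=> bf; set m := \int[P]_x `|f x|.
have : 0 <= \int[P]_x ((`|f x| - m) ^+ 2) by apply: Rintegral_ge0 => x _; exact: sqr_ge0.
under eq_Rintegral do rewrite sqrrB -mulrnAr real_normK ?num_real//.
have bn := bmf_norm bf.
rewrite RintD ?RintB ?Rint_cst//; last 4 first.
- by apply: bmf_integrable; exact: bmfX.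
- by apply: bmf_integrable; exact: bmfM.
- by apply: bmf_integrable; apply: bmfB; [exact: bmfX|exact: bmfM].
- exact: bmf_integrable.
under [X in _ - X]eq_Rintegral do rewrite mulrC.
by rewrite RintZ; [rewrite -/m; nra | exact: bmf_integrable].
Qed.

End expectation.

(** * Fubini and independence *)

Section fubini.
Context d1 d2 (T1 : measurableType d1) (T2 : measurableType d2) (R : realType).
Variables (P1 : probability T1 R) (P2 : probability T2 R).
Variables (g : T1 * T2 -> R) (bg : bmf g).

Let ig : (P1 \x P2)%E.-integrable [set: T1 * T2] (EFin \o g).
Proof. by apply: (@bmf_integrable _ _ _ (P1 \x P2)%E). Qed.

Lemma bmf_pair1 x : bmf (fun y => g (x, y)).
Proof. by apply: bmf_comp bg; exact: measurable_pair1. Qed.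

Lemma bmf_pair2 y : bmf (fun x => g (x, y)).
Proof. by apply: bmf_comp bg; exact: measurable_pair2. Qed.

Lemma bmf_Rint1 : bmf (fun x => \int[P2]_y g (x, y)).
Proof.
have [mg [C gC]] := bg; split.
  rewrite (_ : (fun _ => _) = fine \o fubini_F P2 (EFin \o g))//.
  by apply: measurableT_comp => //; exact: (@measurable_fubini_F _ _ _ _ _ P1).
by exists C => x; apply: Rint_bound => //; exact: bmf_pair1.
Qed.

Lemma Rfubini1 : \int[(P1 \x P2)%E]_z g z = \int[P1]_x \int[P2]_y g (x, y).
Proof.
rewrite [LHS]/Rintegral -fubini1//; congr fine; apply: eq_integral => x _.
rewrite /fubini_F fineK//; apply: integrable_fin_num => //.
by apply: bmf_integrable; exact: bmf_pair1.
Qed.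

Lemma Rfubini2 : \int[(P1 \x P2)%E]_z g z = \int[P2]_y \int[P1]_x g (x, y).
Proof.
rewrite [LHS]/Rintegral -fubini2//; congr fine; apply: eq_integral => x _.
rewrite /fubini_G fineK//; apply: integrable_fin_num => //.
by apply: bmf_integrable; exact: bmf_pair2.
Qed.

End fubini.

Section independent_pair.
Context d d1 d2 (T : measurableType d) (S1 : measurableType d1) (S2 : measurableType d2).
Context (R : realType) (P : probability T R).
Variables (A : T -> S1) (B : T -> S2).
Hypotheses (mA : measurable_fun [set: T] A) (mB : measurable_fun [set: T] B).
Hypothesis AB : forall C D, measurable C -> measurable D ->
  P (A @^-1` C `&` B @^-1` D) = (P (A @^-1` C) * P (B @^-1` D))%E.
Variables (Q : probability S2 R) (lawB : forall D, measurable D -> P (B @^-1` D) = Q D).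

Let A_mfun := isMeasurableFun.Build _ _ _ _ A mA.
Let A_pack : {mfun T >-> S1} := HB.pack A A_mfun.

(** The pair has the product of the two laws, because the two measures agree
    on rectangles; Fubini then gives both orders of integration. *)
Lemma decouple (g : S1 * S2 -> R) : bmf g ->
  \int[P]_w g (A w, B w) = \int[P]_w \int[Q]_y g (A w, y) /\
  \int[P]_w g (A w, B w) = \int[Q]_y \int[P]_w g (A w, y).
Proof.
move=> bg.
have mAB : measurable_fun [set: T] (fun w => (A w, B w)) by exact: measurable_fun_pair.
have law D : measurable D ->
    P ((fun w => (A w, B w)) @^-1` D) = (distribution P A_pack \x Q)%E D.
  move=> mD; rewrite -[LHS]/(pushforward P (fun w => (A w, B w)) D).
  apply/esym; apply: (@product_measure_unique _ _ _ _ _ (distribution P A_pack) Q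
    (measure_function_pushforward__canonical__measure_function_Measure P mAB)) => //.
  move=> C E mC mE; transitivity (P (A @^-1` C) * P (B @^-1` E))%E; first exact: AB.
  by rewrite lawB.
have lawA D : measurable D -> P (A @^-1` D) = distribution P A_pack D by [].
have [_ ->] := Rint_law mAB law (bmf_meas bg) (bmf_integrable _ bg).
rewrite {1}Rfubini1// Rfubini2//; split.
  have b1 := bmf_Rint1 (distribution P A_pack) Q bg.
  by have [_ ->] := Rint_law mA lawA (bmf_meas b1) (bmf_integrable _ b1).
apply: eq_Rintegral => y _; have b2 := bmf_pair2 bg y.
by have [_ ->] := Rint_law mA lawA (bmf_meas b2) (bmf_integrable _ b2).
Qed.

End independent_pair.

(** * Measures on column vectors *)

Definition box (T : Type) n (B : 'I_n -> set T) : set 'cV[T]_n :=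
  [set x | forall i, B i (x i ord0)].

Section boxes.
Context d (T : measurableType d) (R : realType) (n : nat).
Implicit Types B : 'I_n -> set T.

Lemma measurable_box B : (forall i, measurable (B i)) -> measurable (box B).
Proof.
move=> mB; rewrite (_ : box B = \bigcap_(i in [set: 'I_n])
    ([set: 'cV[T]_n] `&` (fun y => y i ord0) @^-1` B i)).
  apply: fin_bigcap_measurable => // i _.
  exact: (measurable_entry i ord0) (mB _).
apply/seteqP; split => y /=; first by move=> By i _; split => //; exact: By.
by move=> By i; have [] := By i I.
Qed.

(** Boxes form a generating family that is stable under intersection. *)
Lemma cV_measure_unique (m1 m2 : {measure set 'cV[T]_n -> \bar R}) (g : nat -> 'I_n -> set T) :
  (forall k i, measurable (g k i)) -> \bigcup_k box (g k) = setT ->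
  (forall B, (forall i, measurable (B i)) -> m1 (box B) = m2 (box B)) ->
  (forall k, (m1 (box (g k)) < +oo)%E) ->
  forall A, measurable A -> m1 A = m2 A.
Proof.
move=> mg gT m12 goo.
pose G := [set A : set 'cV[T]_n | exists2 B, (forall i, measurable (B i)) & A = box B].
apply: (measure_unique G (fun k => box (g k))) => //.
- apply/seteqP; split.
    apply: smallest_sub; first exact: smallest_sigma_algebra.
    move=> A [i [j [B [mB ->]]]]; apply: sub_sigma_algebra.
    exists (fun k => if k == i then B else setT) => [k|]; first by case: ifP.
    rewrite (ord1 j); apply/seteqP; split => x /= Bx => [k|].
      by case: eqP => // ->.
    by have := Bx i; rewrite eqxx.
  apply: smallest_sub; first exact: sigma_algebra_measurable.
  by move=> _ [B mB ->]; exact: measurable_box.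
- move=> _ _ [B mB ->] [C mC ->]; exists (fun i => B i `&` C i).
    by move=> i; exact: measurableI.
  apply/seteqP; split => x /=; first by move=> [Bx Cx] i; split.
  by move=> BC; split => i; have [] := BC i.
- by move=> k; exists (g k).
- by move=> _ [B mB ->]; exact: m12.
Qed.

Lemma cV_finite_measure_unique (m1 m2 : {measure set 'cV[T]_n -> \bar R}) :
  (forall B, (forall i, measurable (B i)) -> m1 (box B) = m2 (box B)) ->
  (m1 setT < +oo)%E -> forall A, measurable A -> m1 A = m2 A.
Proof.
move=> m12 m1T.
have bT : box (fun _ : 'I_n => [set: T]) = setT by apply/seteqP; split.
apply: (@cV_measure_unique _ _ (fun _ _ => setT)) => // [|k]; last by rewrite bT.
by rewrite bT; apply/seteqP; split => // x _; exists 0%N.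
Qed.

End boxes.

(** * Independent families *)

Section independent_boxes.
Context d d' (T : measurableType d) (S : measurableType d') (R : realType).
Variables (P : probability T R) (n : nat) (Y : 'I_n -> T -> S) (x0 : S).
Hypothesis mY : forall i, measurable_fun [set: T] (Y i).
Hypothesis indY : forall B : 'I_n -> set S, (forall i, measurable (B i)) ->
  P [set w | forall i, B i (Y i w)] = (\prod_(i < n) P (Y i @^-1` B i))%E.

(** The j-th entry is frozen at an arbitrary value, which makes [others j] a
    function of the remaining variables alone without changing its type. *)
Definition others (j : 'I_n) (w : T) : 'cV[S]_n :=
  \col_i (if i == j then x0 else Y i w).

Lemma measurable_others j : measurable_fun [set: T] (others j).
Proof.
apply: measurable_fun_mxP => i k; rewrite (_ : (fun _ => _) = if i == j then cst x0 else Y i).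
  by case: ifP => // _; exact: measurable_cst.
by apply/funext => w; rewrite mxE; case: ifP.
Qed.

(** For a fixed [D], both sides are finite measures of [C], hence are determined
    by their values on boxes, where the product rule applies. *)
Lemma others_indep j (C : set 'cV[S]_n) (D : set S) : measurable C -> measurable D ->
  P (others j @^-1` C `&` Y j @^-1` D) = (P (others j @^-1` C) * P (Y j @^-1` D))%E.
Proof.
move=> mC mD.
have mYD : measurable (Y j @^-1` D) by rewrite -[X in measurable X]setTI; exact: mY.
have mo := measurable_others j.
have PYD : P (Y j @^-1` D) \is a fin_num by exact: fin_num_measure.
have c0 : 0 <= fine (P (Y j @^-1` D)) by rewrite fine_ge0.
pose m1 := measure_function_pushforward__canonical__measure_function_Measure (mrestr P mYD) mo.
pose m2 := mscale (NngNum c0)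
  (measure_function_pushforward__canonical__measure_function_Measure P mo).
suff : m1 C = m2 C.
  by rewrite /m1 /m2 /= /pushforward /mrestr /mscale/= fineK// muleC => ->.
apply: (@cV_finite_measure_unique _ _ _ _ m1 m2) => //; last first.
  rewrite /m1/= /pushforward /mrestr; apply: (@le_lt_trans _ _ 1%E); last exact: ltry.
  apply: probability_le1; apply: measurableI => //.
  by rewrite -[X in measurable X]setTI; exact: (measurable_others j).
move=> B mB.
have key E : measurable E -> P (others j @^-1` (box B) `&` Y j @^-1` E) =
    (if `[< B j x0 >] then P (Y j @^-1` E) * \prod_(i < n | i != j) P (Y i @^-1` B i) else 0)%E.
  move=> mE; case: asboolP => Bj; last first.
    rewrite (_ : _ `&` _ = set0) ?measure0//; apply/seteqP; split => // w [] /= + _.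
    by move/(_ j); rewrite mxE eqxx.
  rewrite (_ : _ `&` _ = [set w | forall i, (if i == j then E else B i) (Y i w)]).
    rewrite (indY (B := fun i => if i == j then E else B i)); last by move=> i; case: ifP.
    rewrite (bigD1 j)//= eqxx; congr (_ * _)%E.
    by apply: eq_bigr => i /negbTE ->.
  apply/seteqP; split => w /=.
    by move=> [ow Ew] i; have := ow i; rewrite mxE; case: eqP => // ->.
  move=> H; split; last by have := H j; rewrite eqxx.
  by move=> i; have := H i; rewrite mxE; case: eqP => // ->.
have : P (others j @^-1` (box B) `&` Y j @^-1` D) =
    ((fine (P (Y j @^-1` D)))%:E * P (others j @^-1` (box B)))%E.
  rewrite fineK// -[in RHS](setIT (others j @^-1` box B)) -(preimage_setT (Y j)).
  rewrite !key// preimage_setT; case: asboolP => _; last by rewrite mule0.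
  by rewrite (probability_setT P) mul1e.
by [].
Qed.

(** Given the other variables, [Y j] still has law [Q]. *)
Lemma decouple_others (Q : probability S R) j (g : 'cV[S]_n * S -> R) :
  (forall D, measurable D -> P (Y j @^-1` D) = Q D) -> bmf g ->
  \int[P]_w g (others j w, Y j w) = \int[P]_w \int[Q]_y g (others j w, y) /\
  \int[P]_w g (others j w, Y j w) = \int[Q]_y \int[P]_w g (others j w, y).
Proof.
move=> lawY; apply: decouple => //; first exact: measurable_others.
by move=> C D; exact: others_indep.
Qed.

End independent_boxes.

(** * Orthogonal sums *)

(** The cross terms of the expanded square have mean zero. *)
Lemma orthogonal_sum_le d (T : measurableType d) (R : realType) (P : probability T R)
    (I : finType) (p : pred I) (Z : I -> T -> R) (c : I -> R) :
  (forall i, p i -> bmf (Z i)) -> (forall i w, p i -> `|Z i w| <= c i) ->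
  (forall i j, p i -> p j -> i != j -> \int[P]_w (Z i w * Z j w) = 0) ->
  \int[P]_w ((\sum_(i | p i) Z i w) ^+ 2) <= \sum_(i | p i) c i ^+ 2.
Proof.
move=> bZ Zc ZZ.
have bZZ i j : p i -> p j -> bmf (fun w => Z i w * Z j w).
  by move=> pi pj; apply: bmfM; exact: bZ.
under eq_Rintegral do rewrite expr2 mulr_suml.
rewrite Rint_sum; last first.
  move=> i pi; apply: bmf_integrable; under eq_fun do rewrite mulr_sumr.
  by apply: bmf_sum => j pj; exact: bZZ.
apply: ler_sum => i pi.
under eq_Rintegral do rewrite mulr_sumr.
rewrite Rint_sum; last by move=> j pj; apply: bmf_integrable; exact: bZZ.
rewrite (bigD1 i)//= big1 ?addr0; last by move=> j /andP[pj ji]; rewrite ZZ// eq_sym.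
apply: le_trans (ler_norm _) _; apply: Rint_bound => [|w]; first exact: bZZ.
by rewrite normrM expr2 ler_pM// Zc.
Qed.

(** Used to turn the second-moment bounds below into bounds in mean. *)
Lemma mean_abs_le d (T : measurableType d) (R : realType) (P : probability T R) (f : T -> R) c :
  0 <= c -> bmf f -> \int[P]_w (f w ^+ 2) <= c ^+ 2 -> \int[P]_w `|f w| <= c.
Proof.
move=> c0 bf fc; rewrite -ler_sqr ?nnegrE//; last by apply: Rintegral_ge0.
exact: le_trans (cauchy_schwarz1 P bf) fc.
Qed.

(** * Lebesgue measure on column vectors *)

Section continuous_measurable.
Context (R : realType) (K : nat).

(** An open set is the countable union of the boxes with rational end points
    that it contains. *)
Lemma open_measurable_cV (U : set 'cV[R]_K) : open U -> measurable U.
Proof.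
move=> oU.
pose bx (pq : 'cV[rat]_K * 'cV[rat]_K) : set 'cV[R]_K :=
  box (fun i => `]ratr (pq.1 i ord0), ratr (pq.2 i ord0)[%classic : set R).
pose F pq := if `[< bx pq `<=` U >] then bx pq else set0.
rewrite (_ : U = \bigcup_pq F pq).
  apply: countable_bigcupT_measurable => // pq; rewrite /F; case: asboolP => // _.
  by apply: measurable_box => i; exact: measurable_itv.
apply/seteqP; split => [x Ux|x [pq _]]; last by rewrite /F; case: asboolP => // + ?; apply.
have /nbhs_ballP[e /= e0 xeU] : nbhs x U by exact: open_nbhs_nbhs.
have Hp i : {p : rat | x i ord0 - e < ratr p < x i ord0}.
  apply: cid; have /rat_in_itvoo[q qx] : x i ord0 - e < x i ord0 by rewrite ltrBlDr ltrDl.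
  by exists q; move: qx; rewrite in_itv.
have Hq i : {p : rat | x i ord0 < ratr p < x i ord0 + e}.
  apply: cid; have /rat_in_itvoo[q qx] : x i ord0 < x i ord0 + e by rewrite ltrDl.
  by exists q; move: qx; rewrite in_itv.
pose pq := (\col_i sval (Hp i), \col_i sval (Hq i)).
have bxU : bx pq `<=` U.
  move=> y bxy; apply: xeU; split => // i j; rewrite (ord1 j) /ball /= ltr_distlC.
  have := bxy i; rewrite /= in_itv /= !mxE.
  move: (svalP (Hp i)) (svalP (Hq i)) => /andP[a b] /andP[c d] /andP[f g].
  by rewrite (lt_trans a f) (lt_trans g d).
exists pq => //; rewrite /F asboolT// => i; rewrite /= in_itv /= !mxE.
by move: (svalP (Hp i)) (svalP (Hq i)) => /andP[_ ->] /andP[-> _].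
Qed.

Lemma continuous_measurable_cV (f : 'cV[R]_K -> R) :
  continuous f -> measurable_fun [set: 'cV[R]_K] f.
Proof.
move=> cf; apply: (measurability (@RGenOpens.G R)) => //.
  exact: RGenOpens.measurableE.
move=> _ [_ [a [b ->]] <-]; rewrite setTI; apply: open_measurable_cV.
by apply: open_comp => // x _; exact: cf.
Qed.

End continuous_measurable.

Definition cube (R : realType) (k : nat) : set (measurableTypeR R) :=
  `[- (k%:R : R), k%:R]%classic.
Arguments cube : clear implicits.

Section translation.
Context (R : realType).

Lemma measurable_cube k : measurable (cube R k).
Proof. exact: measurable_itv. Qed.

Lemma lebesgue_measure_translate (a : R) (A : set (measurableTypeR R)) : measurable A ->
  lebesgue_measure ((fun x => x + a) @^-1` A) = lebesgue_measure A.
Proof.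
move=> mA; apply/esym.
have ma : measurable_fun [set: measurableTypeR R] (fun x : measurableTypeR R => (x + a : measurableTypeR R)).
  by apply: measurable_funD.
apply: (@lebesgue_measure_unique _
  (measure_function_pushforward__canonical__measure_function_Measure lebesgue_measure ma)) => //.
move=> _ [[b c] _ <-] /=; rewrite /pushforward.
rewrite (_ : _ @^-1` _ = `]b - a, c - a]%classic); last first.
  by apply/seteqP; split => x /=; rewrite !in_itv /= ltrBlDr lerBrDr.
rewrite !lebesgue_measure_itv /= !lte_fin ltrD2r; case: ifP => // _.
by rewrite -!EFinB; congr (_%:E); ring.
Qed.

Lemma measurable_translate_cV n (a : 'cV[R]_n) :
  measurable_fun [set: 'cV[R]_n] (fun x => x + a).
Proof.
apply: measurable_fun_mxP => i j; rewrite (_ : (fun _ => _) = (fun x : 'cV[R]_n => x i j + a i j)).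
  by apply: measurable_funD => //; exact: measurable_entry.
by apply/funext => x; rewrite mxE.
Qed.

Lemma bigcup_box_itv n : \bigcup_k box (fun _ : 'I_n => cube R k) = setT.
Proof.
apply/seteqP; split => // x _.
exists (Num.truncn (\sum_i `|x i ord0|)).+1 => // i.
rewrite /cube /= in_itv /= -ler_norml ltW//.
apply: le_lt_trans (truncnS_gt _).
by rewrite (bigD1 i)//= lerDl sumr_ge0.
Qed.

Lemma lebesgue_cV_box n (B : 'I_n -> set (measurableTypeR R)) :
  (forall i, measurable (B i)) ->
  lebesgue_cV n (box B) = (\prod_(i < n) lebesgue_measure (B i))%E.
Proof. by move=> mB; exact: product_cV_box. Qed.

Lemma lebesgue_cV_boxoo n k :
  (lebesgue_cV n (box (fun _ : 'I_n => cube R k)) < +oo)%E.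
Proof.
rewrite lebesgue_cV_box; last by move=> i; exact: measurable_cube.
suff /andP[] : (0 <= \prod_(i < n) lebesgue_measure
    (cube R k) < +oo)%E by [].
apply: (big_ind (fun x : \bar R => 0 <= x < +oo)%E).
- by rewrite lee01 ltry.
- by move=> x y /andP[x0 xy] /andP[y0 yy]; rewrite mule_ge0//= lte_mul_pinfty// ge0_fin_numE.
- move=> i _; rewrite measure_ge0/= /cube lebesgue_measure_itv/=; case: ifP => _; last exact: ltry.
  by rewrite -EFinB ltry.
Qed.

(** A copy of [lebesgue_cV] that carries a sigma-finite structure, as Fubini's
    theorem requires. *)
Definition lebC n : set 'cV[R]_n -> \bar R := lebesgue_cV n.
Arguments lebC : clear implicits.

HB.instance Definition _ n := Measure.on (lebC n).

Let lebesgue_cV_sigma_finite n : sigma_finite [set: 'cV[R]_n] (lebC n).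
Proof.
exists (fun k => box (fun _ : 'I_n => cube R k)).
  by rewrite bigcup_box_itv.
by move=> k; split; [apply: measurable_box => i; exact: measurable_cube | exact: lebesgue_cV_boxoo].
Qed.

HB.instance Definition _ n :=
  Measure_isSigmaFinite.Build _ _ _ (lebC n) (@lebesgue_cV_sigma_finite n).

Lemma lebesgue_cV_translate n (a : 'cV[R]_n) (A : set 'cV[R]_n) : measurable A ->
  lebesgue_cV n ((fun x => x + a) @^-1` A) = lebesgue_cV n A.
Proof.
move=> mA; apply/esym; pose ma := measurable_translate_cV a.
pose m2 : {measure set 'cV[R]_n -> \bar R} :=
  measure_function_pushforward__canonical__measure_function_Measure (lebesgue_cV n) ma.
apply: (@cV_measure_unique _ _ _ _ (lebesgue_cV n) m2
  (fun k _ => cube R k)).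
- by move=> k i; exact: measurable_cube.
- exact: bigcup_box_itv.
- move=> B mB; rewrite /= /pushforward.
  rewrite (_ : _ @^-1` _ = box (fun i => (fun t => t + a i ord0) @^-1` (B i))); last first.
    by apply/seteqP; split => x H i; have := H i; rewrite /= mxE.
  rewrite !lebesgue_cV_box//; last first.
    move=> i; rewrite -[X in measurable X]setTI.
    by apply: (@measurable_funD _ _ _ _ id (cst _)).
  apply: eq_bigr => i _. apply/esym. apply lebesgue_measure_translate. exact: mB.
- exact: lebesgue_cV_boxoo.
- by [].
Qed.

(** The product measure is built by adding the last coordinate; as boxes
    determine it, any coordinate may be singled out instead. *)
Lemma lebesgue_cV_insert n (k : 'I_n.+1) (A : set 'cV[R]_n.+1) : measurable A ->
  lebesgue_cV n.+1 A =
  (lebesgue_cV n \x lebesgue_measure)%E ((fun p => insert_coord k p.2 p.1) @^-1` A).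
Proof.
move=> mA; pose mk := @measurable_insert_coord R n.+1 k.
pose m2 : {measure set 'cV[R]_n.+1 -> \bar R} :=
  measure_function_pushforward__canonical__measure_function_Measure
     (lebesgue_cV n \x lebesgue_measure)%E mk.
apply: (@cV_measure_unique _ _ _ _ (lebesgue_cV n.+1) m2
  (fun k _ => cube R k)).
- by move=> ? i; exact: measurable_cube.
- exact: bigcup_box_itv.
- move=> B mB; rewrite lebesgue_cV_box//= /pushforward.
  rewrite (_ : _ @^-1` _ = box (fun i => B (lift k i)) `*` B k); last first.
    apply/seteqP; split => -[y t] /=.
      move=> H; split => [i|]; last by have := H k; rewrite mxE unlift_none.
      by have := H (lift k i); rewrite mxE liftK.
    by move=> [Cy Bt] i; rewrite mxE; case: unliftP => [j ->|->].
  have mb : measurable (box (fun i => B (lift k i))) by apply: measurable_box => i; exact: mB.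
  rewrite product_measure1E//.
  rewrite (bigD1_ord k)//= muleC; congr (_ * _)%E.
  by apply/esym; apply: lebesgue_cV_box => i; exact: mB.
- exact: mB.
- exact: lebesgue_cV_boxoo.
- by [].
Qed.

End translation.

(** * Densities *)

Section density_integral.
Context d (T : measurableType d) (R : realType).
Variables (mu nu : {measure set T -> \bar R}) (f : T -> R).
Hypotheses (mf : measurable_fun [set: T] f) (f0 : forall x, 0 <= f x).
Hypothesis nuE : forall B, measurable B -> nu B = (\int[mu]_(x in B) (f x)%:E)%E.
Import HBNNSimple.

(** True for indicators by hypothesis, hence for simple functions by linearity
    and in general by monotone convergence. *)
Lemma ge0_integral_density (g : T -> \bar R) :
  measurable_fun [set: T] g -> (forall x, (0 <= g x)%E) ->
  (\int[nu]_x g x = \int[mu]_x (g x * (f x)%:E))%E.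
Proof.
move=> mg g0.
have mEf : measurable_fun [set: T] (EFin \o f) by exact/measurable_EFinP.
pose h := nnsfun_approx measurableT mg.
transitivity (limn (fun n => \int[nu]_x (h n x)%:E)%E).
  rewrite -monotone_convergence//.
  - apply: eq_integral => x _; apply/esym/cvg_lim => //.
    by apply: cvg_nnsfun_approx => // y _; exact: g0.
  - by move=> n; exact/measurable_EFinP.
  - by move=> n x _; rewrite lee_fin.
  - by move=> x _ m n mn; rewrite lee_fin; exact/lefP/nd_nnsfun_approx.
transitivity (limn (fun n => \int[mu]_x ((h n x)%:E * (f x)%:E))%E); last first.
  rewrite -monotone_convergence//.
  - apply: eq_integral => x _; apply/cvg_lim => //; apply: cvgeZr => //.
    by apply: cvg_nnsfun_approx => // y _; exact: g0.
  - by move=> n; apply: emeasurable_funM => //; exact/measurable_EFinP.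
  - by move=> n x _; rewrite mule_ge0// lee_fin.
  - move=> x _ m n mn; apply: lee_wpmul2r; rewrite ?lee_fin//.
    exact/lefP/nd_nnsfun_approx.
congr (limn _); apply/funext => n.
have mh r : measurable (h n @^-1` [set r]) by exact: measurable_sfunP.
transitivity (\sum_(k \in range (h n)) (k%:E * nu (h n @^-1` [set k])))%E.
  under eq_integral do rewrite fimfunE -fsumEFin//.
  rewrite ge0_integral_fsum//; last 2 first.
  - by move=> y; exact/measurable_EFinP/measurable_funM.
  - by move=> y x _; rewrite nnfun_muleindic_ge0.
  by apply: eq_fsbigr => r _; rewrite integralZl_indic_nnsfun// integral_indic// setIT.
under [RHS]eq_integral => x _.
  rewrite fimfunE -fsumEFin// ge0_mule_fsuml; last first.
    by move=> r; rewrite nnfun_muleindic_ge0.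
  over.
rewrite ge0_integral_fsum//; last 2 first.
- move=> y; apply: emeasurable_funM => //; exact/measurable_EFinP/measurable_funM.
- by move=> y x _; apply: mule_ge0; [exact: nnfun_muleindic_ge0 | rewrite lee_fin].
apply: eq_fsbigr => r /set_mem[x _ <-]; rewrite nuE//.
rewrite [in LHS]integral_mkcond -ge0_integralZl//; last 3 first.
- by apply/(measurable_restrictT _ _).1 => //; exact: measurable_funTS.
- by move=> y _; rewrite erestrict_ge0// => z _; rewrite lee_fin.
- by rewrite lee_fin.
apply: eq_integral => y _; rewrite EFinM -muleA; congr (_ * _)%E.
rewrite restrict_EFin/= patchE indicE; case: (y \in _); by rewrite ?mul1e ?mul0e.
Qed.

Lemma integral_density (g : T -> R) : measurable_fun [set: T] g ->
  (nu.-integrable [set: T] (EFin \o g) <->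
   mu.-integrable [set: T] (fun x => (g x * f x)%:E)) /\
  \int[nu]_x g x = \int[mu]_x (g x * f x).
Proof.
move=> mg.
have mgf : measurable_fun [set: T] (fun x => (g x * f x)%:E).
  by apply/measurable_EFinP; exact: measurable_funM.
have mEg : measurable_fun [set: T] (EFin \o g) by exact/measurable_EFinP.
split.
  have E : (\int[nu]_x `|(EFin \o g) x| = \int[mu]_x `|(g x * f x)%:E|)%E.
    rewrite ge0_integral_density//; last by apply: measurableT_comp.
    by apply: eq_integral => x _; rewrite EFinM abseM/= (ger0_norm (f0 x)).
  by split => /integrableP[_ ii]; apply/integrableP; split => //; rewrite ?E// -E.
congr fine; rewrite integralE [RHS]integralE; congr (_ - _)%E.
  rewrite ge0_integral_density//; last exact: measurable_funepos.
  by apply: eq_integral => x _; rewrite !funeposE/= EFinM maxeMl ?mul0e// lee_fin.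
rewrite ge0_integral_density//; last exact: measurable_funeneg.
apply: eq_integral => x _; rewrite !funenegE/= -[X in maxe _ X](mul0e (f x)%:E) -mulNr EFinM.
by rewrite maxeMl ?mul0e// lee_fin.
Qed.

End density_integral.

Lemma lebesgue_measure_itv_len (R : realType) (b0 b1 : bool) (a b : R) : a <= b ->
  lebesgue_measure ([set` Interval (BSide b0 a) (BSide b1 b)] : set (measurableTypeR R)) =
  (b - a)%:E.
Proof.
move=> ab; rewrite lebesgue_measure_itv/= lte_fin EFinB.
by case: ltgtP ab => // -> _; rewrite -EFinB subrr.
Qed.

Section lebesgue_cV_integrals.
Context (R : realType).

Lemma ge0_integral_lebesgue_cV_insert n (k : 'I_n.+1) (g : 'cV[R]_n.+1 -> \bar R) :
  measurable_fun [set: 'cV[R]_n.+1] g -> (forall x, (0 <= g x)%E) ->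
  (\int[lebesgue_cV n.+1]_x g x =
   \int[lebesgue_measure]_t \int[lebesgue_cV n]_y g (insert_coord k t y))%E.
Proof.
move=> mg g0; pose mk := @measurable_insert_coord R n.+1 k.
pose m2 : {measure set 'cV[R]_n.+1 -> \bar R} :=
  measure_function_pushforward__canonical__measure_function_Measure
     (@lebC R n \x lebesgue_measure)%E mk.
transitivity (\int[m2]_x g x)%E.
  by apply: eq_measure_integral => A mA _; exact: lebesgue_cV_insert.
rewrite ge0_integral_pushforward//.
rewrite (fubini_tonelli2 (g \o (fun p : 'cV[R]_n * measurableTypeR R => insert_coord k p.2 p.1)))//.
  exact: measurableT_comp.
by move=> p; exact: g0.
Qed.

Lemma ge0_integral_lebesgue_cV_translate n (a : 'cV[R]_n) (g : 'cV[R]_n -> \bar R) :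
  measurable_fun [set: 'cV[R]_n] g -> (forall x, (0 <= g x)%E) ->
  (\int[lebesgue_cV n]_x g (x + a)%R = \int[lebesgue_cV n]_x g x)%E.
Proof.
move=> mg g0; pose ma := measurable_translate_cV a.
pose m2 : {measure set 'cV[R]_n -> \bar R} :=
  measure_function_pushforward__canonical__measure_function_Measure (lebesgue_cV n) ma.
transitivity (\int[m2]_x g x)%E.
  by rewrite [RHS]ge0_integral_pushforward// => y _; exact: g0.
by apply: eq_measure_integral => A mA _; exact: lebesgue_cV_translate.
Qed.

Lemma integral_lebesgue_cV_translate n (a : 'cV[R]_n) (g : 'cV[R]_n -> R) :
  measurable_fun [set: 'cV[R]_n] g ->
  ((lebesgue_cV n).-integrable [set: 'cV[R]_n] (EFin \o g) ->
   (lebesgue_cV n).-integrable [set: 'cV[R]_n] (fun x => (g (x + a))%:E)) /\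
  \int[lebesgue_cV n]_x g (x + a) = \int[lebesgue_cV n]_x g x.
Proof.
move=> mg; have mEg : measurable_fun [set: 'cV[R]_n] (EFin \o g) by exact/measurable_EFinP.
have ma := measurable_translate_cV a.
split.
  move=> /integrableP[_ ig]; apply/integrableP; split.
    by apply/measurable_EFinP; exact: measurableT_comp.
  rewrite (ge0_integral_lebesgue_cV_translate a (g := fun x => `|(g x)%:E|%E))//.
  exact: measurableT_comp.
congr fine; rewrite integralE [RHS]integralE; congr (_ - _)%E.
  rewrite -(ge0_integral_lebesgue_cV_translate a (g := (EFin \o g)^\+%E))//.
    by apply: eq_integral => x _; rewrite !funeposE.
  exact: measurable_funepos.
rewrite -(ge0_integral_lebesgue_cV_translate a (g := (EFin \o g)^\-%E))//.
  by apply: eq_integral => x _; rewrite !funenegE.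
exact: measurable_funeneg.
Qed.

End lebesgue_cV_integrals.

Section marginal.
Context (R : realType) (K : nat) (f : 'cV[R]_K -> R) (Pf : probability 'cV[R]_K R).
Hypotheses (Pf_density : has_density Pf f) (mf : measurable_fun [set: 'cV[R]_K] f).
Hypothesis f_ge0 : forall x, 0 <= f x.

Lemma measurable_half k (t : R) : measurable [set x : 'cV[R]_K | x k ord0 <= t].
Proof.
rewrite -[X in measurable X]setTI; apply: measurable_fun_le => //.
exact: measurable_entry.
Qed.

(** The increment of the marginal distribution function over an interval is the
    integral of f over a slab, that is the integral of the marginal density
    over that interval. *)
Lemma marginal_cdf_lipschitz k (M : R) : (forall t, (marginal_density f k t <= M%:E)%E) ->
  forall a b, a <= b ->
    0 <= marginal_cdf Pf k b - marginal_cdf Pf k a <= M * (b - a).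
Proof.
move=> fM a b ab; rewrite /marginal_cdf.
pose H t := [set x : 'cV[R]_K | x k ord0 <= t].
have [msa msb] : measurable (H a) /\ measurable (H b) by split; exact: measurable_half.
pose D := [set x : 'cV[R]_K | a < x k ord0 <= b].
have DE : D = H b `\` H a.
  apply/seteqP; split => x /=; first by move=> /andP[ax xb]; split => //; apply/negP; rewrite -ltNge.
  by move=> [xb /negP]; rewrite -ltNge => ax; rewrite /D/= ax.
have mD : measurable D by rewrite DE; exact: measurableD.
have UE : H b = H a `|` D.
  apply/seteqP; split => x /=.
    by move=> xb; case: (leP (x k ord0) a) => ax; [left | right; rewrite /D/= ax].
  by move=> [xa|/andP[_ //]]; exact: le_trans ab.
have dj : H a `&` D = set0.
  by apply/seteqP; split => // x [/= + /andP[]]; rewrite /H/= leNgt => /negbTE ->.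
suff : 0 <= fine (Pf (H b)) - fine (Pf (H a)) <= M * (b - a) by [].
rewrite UE measureU//.
rewrite fineD ?fin_num_measure// addrAC subrr add0r fine_ge0//=.
rewrite -lee_fin fineK ?fin_num_measure//.
clear UE dj DE msa msb H; rewrite /D in mD *; clear D; move: f Pf Pf_density mf f_ge0 k fM mD.
clear f Pf Pf_density mf f_ge0; case: K => [|n] f Pf Pf_density mf f_ge0 k fM mD.
  by have := ltn_ord k.
set D := (X in Pf X) in mD *; rewrite Pf_density//.
have mEf : measurable_fun [set: 'cV[R]_n.+1] (EFin \o f) by exact/measurable_EFinP.
have mED : measurable_fun setT ((EFin \o f) \_ D) by apply/(measurable_restrictT _ _).1 => //; exact: measurable_funTS.
have ED0 x : (0 <= ((EFin \o f) \_ D) x)%E by rewrite erestrict_ge0// => y _; rewrite lee_fin.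
rewrite integral_mkcond (ge0_integral_lebesgue_cV_insert k)//.
have E t : (\int[lebesgue_cV n]_y ((EFin \o f) \_ D) (insert_coord k t y) =
  (\1_(`]a, b]%classic) t)%:E * marginal_density f k t)%E.
  have tD y : (insert_coord k t y \in D) = (t \in `]a, b]).
    by rewrite in_itv/=; apply/idP/idP => [/set_mem|H]; rewrite /D/= ?inE /= mxE unlift_none.
  rewrite indicE mem_setE; case: (boolP (t \in `]a, b])) => tab; last first.
    rewrite mul0e integral0_eq// => y _; rewrite patchE ifF//.
    by rewrite tD; exact: negbTE.
  by rewrite mul1e; apply: eq_integral => y _; rewrite patchE tD tab.
under eq_integral do rewrite E.
have M0 : 0 <= M.
  rewrite -lee_fin; apply: le_trans (fM 0); apply: integral_ge0 => y _.
  by rewrite lee_fin.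
apply: (@le_trans _ _ (\int[lebesgue_measure]_t ((\1_(`]a, b]%classic) t)%:E * M%:E))%E).
  apply: ge0_le_integral => //.
  - by move=> t _; rewrite mule_ge0// integral_ge0// => y _; rewrite lee_fin.
  - under eq_fun do rewrite -E.
    have mk := @measurable_insert_coord R n.+1 k.
    apply: (measurable_fun_fubini_tonelli_G (m1 := @lebC R n)
     (((EFin \o f) \_ D) \o (fun p : 'cV[R]_n * measurableTypeR R => insert_coord k p.2 p.1))).
      exact: measurableT_comp.
    by move=> p; exact: ED0.
  - by apply: emeasurable_funM => //; apply/measurable_EFinP; exact: measurable_indic.
  - by move=> t _; rewrite lee_wpmul2l// lee_fin.
rewrite ge0_integralZr//; last by apply/measurable_EFinP; exact: measurable_indic.
rewrite integral_indic// setIT [X in (X * _)%E](_ : _ = (b - a)%:E).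
  by rewrite -EFinM mulrC.
exact: lebesgue_measure_itv_len.
Qed.

End marginal.

(** * First-order expansion of a shifted expectation *)

Section directional_derivative.
Context (R : realType) (K : nat).
Implicit Types (f : 'cV[R]_K -> R) (x v : 'cV[R]_K).

Lemma is_derive_line f v x (u : R) : derivable f (u *: v + x) v ->
  is_derive u 1 (fun u : R => f (u *: v + x)) ('D_v f (u *: v + x)).
Proof.
have E : (fun h : R => h^-1 *: (((fun u : R => f (u *: v + x)) \o shift u) (h *: 1) -
    f (u *: v + x))) =
  (fun h : R => h^-1 *: ((f \o shift (u *: v + x)) (h *: v) - f (u *: v + x))).
  apply/funext => h /=; congr (_ *: (f _ - _)).
  by rewrite [h *: 1]mulr1 scalerDl addrA.
move=> df; apply: DeriveDef; first by rewrite /derivable E.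
by rewrite /derive E.
Qed.

Lemma gradient_dir f v x : differentiable f x ->
  'D_v f x = \sum_l v l ord0 * gradient f x l ord0.
Proof.
move=> df; rewrite deriveE//.
have {1}-> : v = \sum_l v l ord0 *: delta_mx l ord0.
  rewrite [LHS]matrix_sum_delta; apply: eq_bigr => l _.
  by rewrite big_ord1.
rewrite linear_sum; apply: eq_bigr => l _; rewrite linearZ /=.
by rewrite /gradient mxE deriveE.
Qed.

Lemma score_gradient f x l : differentiable f x -> 0 < f x ->
  score f x l ord0 = gradient f x l ord0 / f x.
Proof.
move=> df fx; rewrite /score /gradient !mxE; set v := delta_mx l ord0.
have dfv : derivable f (0 *: v + x) v by rewrite scale0r add0r; exact: diff_derivable.
have d1 := is_derive_line dfv.
have lx : 0 < f (0 *: v + x) by rewrite scale0r add0r.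
have d2 : is_derive (0 : R) 1 (fun u : R => ln (f (u *: v + x)))
    ((f (0 *: v + x))^-1 * 'D_v f (0 *: v + x)).
  by have := @is_derive1_comp R (@ln R) _ 0 _ _ (is_derive1_ln lx) d1.
have dl : derivable (fun x => ln (f x)) x v.
  by apply/derivable1P; case: d2.
have dlv : derivable (fun x => ln (f x)) (0 *: v + x) v by rewrite scale0r add0r.
have d3 := is_derive_line dlv.
have := derive_val (is_derive := d3); rewrite (derive_val (is_derive := d2)).
by rewrite scale0r add0r mulrC => ->.
Qed.

End directional_derivative.

Section shifted_expectation.
Context (R : realType) (K : nat) (f : 'cV[R]_K -> R) (Pf : probability 'cV[R]_K R).
Hypotheses (Pf_density : has_density Pf f) (mf : measurable_fun [set: 'cV[R]_K] f).
Hypothesis f_ge0 : forall x, 0 <= f x.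
Variable v : 'cV[R]_K.
Hypothesis df : forall x, differentiable f x.
Let g (x : 'cV[R]_K) : R := 'D_v f x.
Hypothesis cg : continuous g.
Hypothesis ig : (lebesgue_cV K).-integrable [set: 'cV[R]_K] (EFin \o g).
Variables (w : 'cV[R]_K -> R) (C L s : R).
Hypotheses (mw : measurable_fun [set: 'cV[R]_K] w) (wC : forall x, `|w x| <= C).
Hypotheses (s0 : 0 < s) (wL : forall (x : 'cV[R]_K) (u : R), 0 <= u <= s -> `|w (x - u *: v) - w x| <= L * u).

Local Notation lam := (@lebC R K).
Local Notation leb := (@lebesgue_measure R).
Let N := \int[lam]_x `|g x|.

Let mg : measurable_fun [set: 'cV[R]_K] g.
Proof. exact: continuous_measurable_cV. Qed.

Let C0 : 0 <= C. Proof. exact: le_trans (wC 0). Qed.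

Let ibg (h : 'cV[R]_K -> R) : measurable_fun [set: 'cV[R]_K] h ->
  (exists c, forall x, `|h x| <= c) -> lam.-integrable [set: 'cV[R]_K] (fun x => (h x * g x)%:E).
Proof.
move=> mh [c hc]; rewrite (_ : (fun _ => _) = (EFin \o h) \* (EFin \o g))%E.
  apply: integrableMr => //; exists c; split; first exact: num_real.
  by move=> M cM x _; exact: le_trans (hc x) (ltW cM).
by apply/funext => x /=; rewrite EFinM.
Qed.

Let N_EFin : (\int[lam]_x `|g x|%:E = N%:E)%E.
Proof.
rewrite /N fineK//; apply: integrable_fin_num => //.
by have := integrable_abse ig; apply: eq_integrable.
Qed.

Let bg (h : 'cV[R]_K -> R) c : measurable_fun [set: 'cV[R]_K] h -> 0 <= c ->
  (forall x, `|h x| <= c) -> `|\int[lam]_x (h x * g x)| <= c * N.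
Proof.
move=> mh c0 hc.
have iN : lam.-integrable [set: 'cV[R]_K] (EFin \o (fun x => `|g x|)).
  by have := integrable_abse ig; apply: eq_integrable.
have ihg := ibg mh (ex_intro _ c hc).
apply: le_trans (le_normr_Rintegral measurableT ihg) _.
rewrite /N -RintegralZl//; apply: le_Rintegral => //.
- by have := integrable_abse ihg; apply: eq_integrable.
- by have := integrableZl measurableT c iN; apply: eq_integrable.
- by move=> x _; rewrite normrM ler_wpM2r.
Qed.

Let I0 : measurableTypeR R -> R := \1_(`[0, s]%classic).

Let mI0 : measurable_fun [set: measurableTypeR R] I0.
Proof. by apply: measurable_indic; exact: measurable_itv. Qed.

Let G (p : 'cV[R]_K * measurableTypeR R) : R :=
  I0 p.2 * (w p.1 * g (p.2 *: v + p.1)).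

Let mG : measurable_fun [set: 'cV[R]_K * measurableTypeR R] G.
Proof.
apply: measurable_funM.
  exact: (measurableT_comp mI0 measurable_snd).
apply: measurable_funM.
  exact: (measurableT_comp mw measurable_fst).
apply: (measurableT_comp mg); apply: measurable_fun_mxP => i j.
rewrite (_ : (fun _ => _) = fun p : 'cV[R]_K * measurableTypeR R => p.2 * v i j + p.1 i j).
  apply: measurable_funD.
    by apply: measurable_funM => //; exact: measurable_snd.
  exact: (measurableT_comp (measurable_entry i j) measurable_fst).
by apply/funext => p; rewrite !mxE.
Qed.

(** The value at [u] of the derivative of the shifted expectation: the shift
    sits on [w] and the derivative on the density. *)
Let J (u : R) : R := \int[lam]_x (w (x - u *: v) * g x).

Let mwt (u : R) : measurable_fun [set: 'cV[R]_K] (fun x => w (x - u *: v)).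
Proof. by apply: measurableT_comp => //; exact: measurable_translate_cV. Qed.

Let JE (u : R) : lam.-integrable [set: 'cV[R]_K] (fun x => (w x * g (u *: v + x))%:E) /\
  \int[lam]_x (w x * g (u *: v + x)) = J u.
Proof.
pose h (x : 'cV[R]_K) : R := w (x - u *: v) * g x.
have mh : measurable_fun setT h by exact: measurable_funM.
have E (x : 'cV[R]_K) : h (x + u *: v) = w x * g (u *: v + x) by rewrite /h addrK [x + _]addrC.
have [i e] := integral_lebesgue_cV_translate (u *: v) mh.
split; last by rewrite /J -[RHS]e; apply: eq_Rintegral => x _; rewrite E.
have := i (ibg (mwt u) (ex_intro _ C (fun x => wC _))).
by under eq_fun do rewrite E.
Qed.

Let GE (u : R) : lam.-integrable [set: 'cV[R]_K] (fun x => (G (x, u))%:E) /\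
  \int[lam]_x G (x, u) = I0 u * J u.
Proof.
have [i e] := JE u; rewrite /G/= -e; split; last exact: (RintegralZl (I0 u) measurableT i).
have := integrableZl measurableT (I0 u) i.
by apply: eq_integrable => // x _; rewrite EFinM.
Qed.

Let N0 : 0 <= N. Proof. by apply: Rintegral_ge0. Qed.

Let iG : (lam \x leb)%E.-integrable [set: 'cV[R]_K * measurableTypeR R] (EFin \o G).
Proof.
apply/integrable21ltyP; first exact/measurable_EFinP.
apply: (@le_lt_trans _ _ (\int[leb]_u ((I0 u)%:E * (C * N)%:E))%E); last first.
  rewrite ge0_integralZr//.
  - rewrite integral_indic// setIT [X in (X * _)%E](_ : _ = (s - 0)%:E).
      by rewrite -EFinM ltry.
    by apply: lebesgue_measure_itv_len; exact: ltW.
  - by apply/measurable_EFinP; exact: mI0.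
  - by move=> u _; rewrite lee_fin /I0 indicE; case: (_ \in _).
  - by rewrite lee_fin mulr_ge0.
apply: ge0_le_integral => //.
- by move=> u _; apply: integral_ge0.
- apply: (measurable_fun_fubini_tonelli_G (m1 := lam) (abse \o (EFin \o G))) => //.
  by apply: measurableT_comp => //; exact/measurable_EFinP.
- by move=> p; exact: abse_ge0.
- by apply: emeasurable_funM => //; apply/measurable_EFinP; exact: mI0.
move=> u _.
have -> : (\int[lam]_x `|(EFin \o G) (x, u)| = (I0 u)%:E * \int[lam]_x `|w x * g (u *: v + x)|%:E)%E.
  rewrite -ge0_integralZl//; last 2 first.
  - by apply/measurable_EFinP; apply: measurableT_comp => //; apply/measurable_EFinP; case: (JE u) => /integrableP[].
  - by rewrite lee_fin /I0 indicE; case: (_ \in _).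
  apply: eq_integral => x _ /=; rewrite /G/= normrM EFinM; congr (_%:E * _)%E.
  by rewrite ger0_norm// /I0 indicE; case: (_ \in _).
apply: lee_wpmul2l; first by rewrite lee_fin /I0 indicE; case: (_ \in _).
have mgu : measurable_fun [set: 'cV[R]_K] (fun x => g (x + u *: v)).
  by apply: measurableT_comp => //; exact: measurable_translate_cV.
apply: (@le_trans _ _ (\int[lam]_x (C%:E * `|g (x + u *: v)|%:E))%E).
  apply: ge0_le_integral => //.
  - by apply/measurable_EFinP; apply: measurableT_comp => //; apply/measurable_EFinP; case: (JE u) => /integrableP[].
  - by apply: emeasurable_funM => //; apply/measurable_EFinP; exact: measurableT_comp.
  - by move=> x _; rewrite -EFinM lee_fin normrM addrC ler_wpM2r.
rewrite ge0_integralZl//; last by apply/measurable_EFinP; exact: measurableT_comp.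
rewrite EFinM; apply: lee_wpmul2l => //.
rewrite (ge0_integral_lebesgue_cV_translate (u *: v) (g := fun x => `|g x|%:E))//.
  by rewrite [leLHS]N_EFin.
by apply/measurable_EFinP; exact: measurableT_comp.
Qed.

(** The increment of f along a segment is the integral of its directional derivative. *)
Let FTC (x : 'cV[R]_K) : (\int[leb]_u (G (x, u))%:E = (w x * (f (s *: v + x) - f x))%:E)%E.
Proof.
pose phi (u : R) : R := f (u *: v + x).
have dphi (u : R) : is_derive u 1 phi (g (u *: v + x)).
  by apply: is_derive_line; exact: diff_derivable.
have cline : continuous (fun u : R => u *: v + x).
  move=> u; apply: cvgD; last exact: cvg_cst.
  by apply: cvgZr_tmp; exact: cvg_id.
have cphi : continuous phi.
  move=> u; apply: (@continuous_comp _ _ _ (fun u : R => u *: v + x) f); first exact: cline.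
  exact: differentiable_continuous.
have := @continuous_FTC2 R (fun u => g (u *: v + x)) phi 0 s s0.
rewrite /phi scale0r add0r -EFinB => H.
rewrite EFinM -{}H; last 3 first.
- apply: continuous_subspaceT => u.
  by apply: (@continuous_comp _ _ _ (fun u : R => u *: v + x) g); [exact: cline|exact: cg].
- split; first by move=> u _; case: (dphi u).
    by apply: cvg_at_right_filter; exact: cphi.
  by apply: cvg_at_left_filter; exact: cphi.
- by move=> u _; rewrite derive1E; case: (dphi u).
have cgl : {within `[0, s], continuous (fun u : R => g (u *: v + x))}.
  apply: continuous_subspaceT => u.
  by apply: (@continuous_comp _ _ _ (fun u : R => u *: v + x) g); [exact: cline|exact: cg].
rewrite -integralZl//; last first.
  by apply: continuous_compact_integrable => //; exact: segment_compact.
rewrite [RHS]integral_mkcond; apply: eq_integral => u _.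
rewrite /G/= patchE /I0 indicE; case: ifP => us; last by rewrite mul0r.
by rewrite mul1r EFinM.
Qed.

Let ibf (h : 'cV[R]_K -> R) : measurable_fun [set: 'cV[R]_K] h ->
  (exists c, forall x, `|h x| <= c) ->
  lam.-integrable [set: 'cV[R]_K] (fun x => (h x * f x)%:E) /\
  \int[Pf]_x h x = \int[lam]_x (h x * f x).
Proof.
move=> mh hc; have [i e] := integral_density mf f_ge0 Pf_density mh.
by split => //; apply/i/bmf_integrable.
Qed.

Let J0E : J 0 = \int[lam]_x (w x * g x).
Proof. by apply: eq_Rintegral => x _; rewrite scale0r subr0. Qed.

Let wfE : \int[lam]_x (w x * (f (s *: v + x) - f x)) =
  \int[Pf]_x w (x - s *: v) - \int[Pf]_x w x.
Proof.
have [i1 e1] := ibf mw (ex_intro _ C wC).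
have [i2 e2] := ibf (mwt s) (ex_intro _ C (fun x => wC _)).
pose h (x : 'cV[R]_K) : R := w (x - s *: v) * f x.
have mh : measurable_fun setT h by exact: measurable_funM.
have E (x : 'cV[R]_K) : h (x + s *: v) = w x * f (s *: v + x) by rewrite /h addrK [x + _]addrC.
have [i3 e3] := integral_lebesgue_cV_translate (s *: v) mh.
rewrite e1 e2 -[X in X - _]e3 -RintegralB//; last exact: i3.
by apply: eq_Rintegral => x _; rewrite E mulrBr.
Qed.

Let GJ u : fubini_G lam (EFin \o G) u = (I0 u * J u)%:E.
Proof.
have [i e] := GE u; rewrite /fubini_G -e fineK//.
exact: integrable_fin_num.
Qed.

Let iIJ : leb.-integrable [set: measurableTypeR R] (fun u => (I0 u * J u)%:E).
Proof.
have iI : leb.-integrable [set: measurableTypeR R] (EFin \o I0).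
  by apply: integrable_indic_itv.
have := integrableZl measurableT (C * N) iI; apply: le_integrable => //.
  by rewrite (_ : (fun _ => _) = fubini_G lam (EFin \o G));
    [exact: (measurable_fubini_G iG) | apply/funext => u; rewrite GJ].
move=> u _; rewrite -EFinM !abse_EFin lee_fin !normrM mulrC ler_wpM2r//.
rewrite (ger0_norm C0) (ger0_norm N0).
by apply: bg => // x; exact: wC.
Qed.

Let wfJ : \int[lam]_x (w x * (f (s *: v + x) - f x)) = \int[leb]_u (I0 u * J u).
Proof.
congr fine; transitivity (\int[lam]_x \int[leb]_u (G (x, u))%:E)%E.
  by apply: eq_integral => x _; rewrite FTC.
rewrite (Fubini iG); apply: eq_integral => u _; exact: GJ.
Qed.

(** A translation moves the shift from [w] to f. The increment of f is then the
    integral of 'D_v f along the segment, and Fubini makes the difference of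
    expectations equal to the integral of [J] over [0, s]. Because [w] is
    Lipschitz, [J u] differs from [J 0] by at most L u N. *)
Lemma shift_expectation :
  `|\int[Pf]_x w (x - s *: v) - \int[Pf]_x w x - s * \int[lam]_x (w x * g x)| <= L * s ^+ 2 * N.
Proof.
have L0 : 0 <= L.
  have := wL 0 (u := s); rewrite lexx (ltW s0) => /(_ isT) H.
  by rewrite -(pmulr_lge0 _ s0); exact: le_trans (normr_ge0 _) H.
have iI : leb.-integrable [set: measurableTypeR R] (EFin \o I0).
  by apply: integrable_indic_itv.
have II : \int[leb]_u I0 u = s.
  rewrite /Rintegral integral_indic// setIT.
  rewrite [X in fine X](_ : _ = (s - 0)%:E); first by rewrite subr0.
  by apply: lebesgue_measure_itv_len; exact: ltW.
have iIc c : leb.-integrable [set: measurableTypeR R] (fun u => (I0 u * c)%:E).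
  have := integrableZl measurableT c iI; apply: eq_integrable => // u _.
  by rewrite /= -EFinM mulrC.
have IIc c : \int[leb]_u (I0 u * c) = s * c by rewrite RintegralZr// II.
rewrite -wfE wfJ -J0E -IIc -RintegralB//; last exact: iIc.
have iB : leb.-integrable [set: measurableTypeR R] (EFin \o (fun u => I0 u * J u - I0 u * J 0)).
  have := integrableB measurableT iIJ (iIc (J 0)); apply: eq_integrable => // u _.
apply: le_trans (le_normr_Rintegral measurableT iB) _.
have -> : L * s ^+ 2 * N = s * (L * s * N) by ring.
rewrite -IIc; apply: le_Rintegral => //.
- by have := integrable_abse iB; apply: eq_integrable.
- exact: iIc.
move=> u _; rewrite -mulrBr normrM /I0 indicE; case: (boolP (u \in _)) => us; last by rewrite normr0 !mul0r.
rewrite normr1 !mul1r; have {us} : 0 <= u <= s by have := set_mem us; rewrite /= in_itv.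
move=> us; have [u0 u_s] := andP us.
rewrite J0E /J -RintegralB//; last 2 first.
- by apply: ibg => //; exists C.
- by apply: ibg => //; exists C.
under eq_Rintegral do rewrite -mulrBl.
apply: bg; first by apply: measurable_funB.
  by rewrite mulr_ge0// ltW.
by move=> x; apply: le_trans (wL _ us) _; rewrite ler_wpM2l.
Qed.

End shifted_expectation.

(** * One-dimensional Gaussian laws *)

Section gaussian1.
Context (R : realType).
Local Notation leb := (@lebesgue_measure R).
Local Notation N a := (normal_prob (0 : R) a).

Lemma normal_pdf0E (m a x : R) : a != 0 ->
  normal_pdf m a x = normal_peak a * expR (- (x - m) ^+ 2 / (a ^+ 2 *+ 2)).
Proof. by move=> a0; rewrite normal_pdfE. Qed.

Lemma normal_integral (a : R) (g : R -> R) : measurable_fun [set: measurableTypeR R] g ->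
  ((N a).-integrable [set: measurableTypeR R] (EFin \o g) <->
   leb.-integrable [set: measurableTypeR R] (fun x => (g x * normal_pdf 0 a x)%:E)) /\
  \int[N a]_x g x = \int[leb]_x (g x * normal_pdf 0 a x).
Proof.
move=> mg; apply: (@integral_density _ (measurableTypeR R) R leb (N a)) => //.
  exact: measurable_normal_pdf.
exact: normal_pdf_ge0.
Qed.

Section moments.
Variable a : R.
Hypothesis a0 : 0 < a.
Let p : R -> R := normal_pdf 0 a.
Let an0 : a != 0. Proof. by rewrite gt_eqF. Qed.
Let c := normal_peak a.
Let q := (a ^+ 2 *+ 2)^-1.

Let pE : p = fun x => c * expR (- q * x ^+ 2).
Proof.
apply/funext => x; rewrite /p normal_pdf0E// subr0 /c; congr (_ * expR _).
by rewrite mulNr mulNr mulrC.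
Qed.

Let is_derive_pow k (x : R) : is_derive x (1 : R) (fun x : R => x ^+ k.+1) (k.+1%:R * x ^+ k).
Proof.
have := is_deriveX k.+1 (is_derive_id x (1 : R)).
rewrite (_ : id ^+ k.+1 = fun x : R => x ^+ k.+1); last by apply/funext => y; rewrite exprfctE.
by move=> H; apply: is_derive_eq H _; rewrite /= /GRing.scale/= mulr1.
Qed.

Let is_derive_scale (f : R -> R) (k x df : R) : is_derive x (1 : R) f df ->
  is_derive x (1 : R) (fun x => k * f x) (k * df).
Proof. exact: is_deriveZ. Qed.

Let is_derive_p (x : R) : is_derive x (1 : R) p (- x / a ^+ 2 * p x).
Proof.
have dX := is_derive_scale (- q) (is_derive_pow 1 x).
have dE := @is_derive1_comp R expR (fun x : R => - q * x ^+ 2) x _ _ (is_derive_expR _) dX.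
have H := is_derive_scale c dE; rewrite pE; apply: is_derive_eq H _.
rewrite /q -(mulr_natr (a ^+ 2)); field; rewrite ?an0 ?pnatr_eq0//.
Qed.

Let cp : continuous p. Proof. exact: continuous_normal_pdf. Qed.

Let mpow k : measurable_fun [set: measurableTypeR R] (fun x : R => x ^+ k * p x).
Proof.
apply: measurable_funM; last exact: measurable_normal_pdf.
exact: measurable_funX.
Qed.

Let cpow k : continuous (fun x : R => x ^+ k * p x).
Proof. by move=> x; apply: cvgM; [exact: exprn_continuous | exact: cp]. Qed.

Let sym n : set (measurableTypeR R) := `[(- n.+1%:R : R), n.+1%:R]%classic.
Let I n k : R := \int[leb]_(x in sym n) (x ^+ k * p x).

Let Iint n k : leb.-integrable (sym n) (fun x => (x ^+ k * p x)%:E).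
Proof.
apply: continuous_compact_integrable; first exact: segment_compact.
by apply: continuous_subspaceT => x; exact: cpow.
Qed.

Let pN (x : R) : p (- x) = p x. Proof. by rewrite pE sqrrN. Qed.

(** Integration by parts: x p(x) is -a^2 times the derivative of the density p. *)
Let Irec n k : ~~ odd k ->
  I n k.+2 + 2 * a ^+ 2 * n.+1%:R ^+ k.+1 * p n.+1%:R = k.+1%:R * a ^+ 2 * I n k.
Proof.
move=> ek; have ltN : - n.+1%:R < n.+1%:R :> R by rewrite gtrN.
pose F (x : R) := - a ^+ 2 * (x ^+ k.+1 * p x).
pose f (x : R) := x ^+ k.+2 * p x - k.+1%:R * a ^+ 2 * (x ^+ k * p x).
have dF (x : R) : is_derive x (1 : R) F (f x).
  have H1 := @is_deriveM _ _ (fun x : R => x ^+ k.+1) p x (1 : R) _ _ (is_derive_pow k x) (is_derive_p x).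
  have H := @is_derive_scale _ (- a ^+ 2) _ _ H1; apply: is_derive_eq H _.
  by rewrite /GRing.scale/= /f !exprS; field.
have cf : continuous f.
  move=> x; apply: cvgB; first exact: cpow.
  by apply: cvgM; [exact: cvg_cst | exact: cpow].
have cF (x : R) : {for x, continuous F}.
  by apply/differentiable_continuous/derivable1_diffP; case: (dF x).
have H := @continuous_FTC2 R f F _ _ ltN.
have E : \int[leb]_(x in sym n) (f x) = I n k.+2 - k.+1%:R * a ^+ 2 * I n k.
  have ik := Iint n k; have mS : measurable (sym n) by exact: measurable_itv.
  rewrite /f RintegralB//; [|exact: Iint|].
    by rewrite RintegralZl.
  have := integrableZl mS (k.+1%:R * a ^+ 2) ik; apply: eq_integrable => // x _.
have {H} : \int[leb]_(x in sym n) (f x) = F n.+1%:R - F (- n.+1%:R).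
  rewrite /Rintegral H//.
  - by apply: continuous_subspaceT.
  - split; first by move=> x _; case: (dF x).
      by apply: cvg_at_right_filter; exact: cF.
    by apply: cvg_at_left_filter; exact: cF.
  - by move=> x _; rewrite derive1E; case: (dF x).
rewrite E /F pN exprNn -signr_odd /= (negbTE ek) /= expr1.
by move/(canRL (subrK _)) => ->; ring.
Qed.

Let sym_cover : \bigcup_n sym n = setT.
Proof.
apply/seteqP; split => // x _; exists (Num.truncn `|x|) => //.
rewrite /sym /= in_itv /= -ler_norml ltW//; exact: truncnS_gt.
Qed.

Let sym_nd : nondecreasing_seq sym.
Proof.
move=> m n mn; rewrite subsetEset => x; rewrite /sym /= !in_itv /= => /andP[h1 h2].
have mnR : m.+1%:R <= n.+1%:R :> R by rewrite ler_nat.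
by apply/andP; split; [apply: le_trans h1; rewrite lerN2 | apply: le_trans mnR].
Qed.

Let pow_ge0 k (x : R) : ~~ odd k -> 0 <= x ^+ k * p x.
Proof.
move=> ek; rewrite mulr_ge0 ?normal_pdf_ge0//.
by rewrite exprn_even_ge0.
Qed.

Let Icvg k : ~~ odd k ->
  (fun n => (I n k)%:E) @ \oo --> (\int[leb]_x (x ^+ k * p x)%:E)%E.
Proof.
move=> ek; have := @ge0_nondecreasing_set_cvg_integral _ _ _ sym
  (fun x => (x ^+ k * p x)%:E) leb sym_nd.
have -> : (fun n => (I n k)%:E) = (fun n => \int[leb]_(x in sym n) (x ^+ k * p x)%:E)%E.
  apply/funext => n; rewrite /I fineK//; apply: integrable_fin_num => //.
  exact: measurable_itv.
rewrite sym_cover; apply.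
- by move=> n; exact: measurable_itv.
- by move=> n; apply: measurable_funTS; apply/measurable_EFinP; exact: mpow.
- by move=> n x _; rewrite lee_fin; exact: pow_ge0.
Qed.

Let np_cvg : (fun n => 2 * a ^+ 2 * n.+1%:R ^+ 1 * p n.+1%:R) @ \oo --> (0 : R).
Proof.
have a0' := ltW a0; apply: (@squeeze_cvgr _ _ _ _ (cst 0) (fun n => (4 * a ^+ 4 * c) * n.+1%:R^-1)).
- apply: nearW => n; rewrite expr1 mulr_ge0 ?normal_pdf_ge0//= ?mulr_ge0 ?sqr_ge0//=.
  rewrite pE.
  have n0 : 0 < n.+1%:R :> R by [].
  have q0 : 0 < q by rewrite invr_gt0 pmulrn_lgt0// exprn_gt0.
  set x := n.+1%:R in n0 *.
  have y0 : 0 < q * x ^+ 2 by rewrite mulr_gt0// exprn_gt0.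
  have : expR (- q * x ^+ 2) <= (q * x ^+ 2)^-1.
    rewrite mulNr expRN lef_pV2 ?posrE ?expR_gt0//.
    by apply: le_trans (expR_ge1Dx _); rewrite lerDr.
  move=> H; apply: (@le_trans _ _ (2 * a ^+ 2 * x * (c * (q * x ^+ 2)^-1))).
    apply: ler_wpM2l; first by rewrite !mulr_ge0 ?sqr_ge0// ltW.
    by apply: ler_wpM2l => //; exact: normal_peak_ge0.
  rewrite le_eqVlt; apply/orP; left; apply/eqP.
  rewrite /q -(mulr_natr (a ^+ 2)); field.
  by rewrite an0 gt_eqF.
- exact: cvg_cst.
- rewrite -[X in _ --> X](mulr0 (4 * a ^+ 4 * c)); apply: cvgM; first exact: cvg_cst.
  exact: cvg_harmonic.
Qed.

Lemma normal_moment2 : (N a).-integrable [set: measurableTypeR R] (fun x => (x ^+ 2)%:E) /\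
  \int[N a]_x (x ^+ 2) = a ^+ 2.
Proof.
have [i e] := normal_integral a (measurable_funX 2 (@measurable_id _ _ _)).
have C0 : (fun n => (I n 0)%:E) @ \oo --> 1%E.
  have := Icvg (k := 0) isT; under eq_integral do rewrite expr0 mul1r.
  by rewrite integral_normal_pdf.
have C2 : (fun n => (I n 2)%:E) @ \oo --> (a ^+ 2)%:E.
  have E n : I n 2 = a ^+ 2 * I n 0 - 2 * a ^+ 2 * n.+1%:R ^+ 1 * p n.+1%:R.
    by have := @Irec n 0 isT; rewrite mul1r => <-; rewrite addrK.
  under eq_fun do rewrite E.
  apply: cvg_EFin; first by apply: nearW.
  rewrite -[X in _ --> X](subr0 (a ^+ 2)) -[X in _ --> X - _](mulr1 (a ^+ 2)).
  apply: cvgB; last exact: np_cvg.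
  by apply: cvgM; [exact: cvg_cst | by move/fine_cvgP : C0 => []].
have E2 : (\int[leb]_x (x ^+ 2 * p x)%:E = (a ^+ 2)%:E)%E.
  exact: (cvg_unique _ (Icvg (k := 2) isT) C2).
split; last by rewrite e /Rintegral E2.
apply/i/integrableP; split; first by apply/measurable_EFinP; exact: (mpow 2).
under eq_integral => x _ do rewrite abse_EFin (ger0_norm (pow_ge0 x _))//.
by rewrite E2 ltry.
Qed.

Lemma normal_moment4 : (N a).-integrable [set: measurableTypeR R] (fun x => (x ^+ 4)%:E) /\
  \int[N a]_x (x ^+ 4) <= 3 * a ^+ 4.
Proof.
have [i e] := normal_integral a (measurable_funX 4 (@measurable_id _ _ _)).
have C2 : (fun n => (I n 2)%:E) @ \oo --> (a ^+ 2)%:E.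
  have [i2 <-] := normal_moment2.
  have [j e2] := normal_integral a (measurable_funX 2 (@measurable_id _ _ _)).
  have i3 := j.1 i2.
  rewrite e2 fineK; last exact: integrable_fin_num.
  exact: Icvg.
have E4 : (\int[leb]_x (x ^+ 4 * p x)%:E <= (3 * a ^+ 4)%:E)%E.
  have C4 := Icvg (k := 4) isT; have CR : (fun n => (3 * a ^+ 2 * I n 2)%:E) @ \oo --> (3 * a ^+ 4)%:E.
    apply: cvg_EFin; first by apply: nearW.
    have -> : 3 * a ^+ 4 = 3 * a ^+ 2 * a ^+ 2 by ring.
    by apply: cvgM; [exact: cvg_cst | by move/fine_cvgP : C2 => []].
  apply: (lee_cvg_to C4 CR); apply: nearW => n; rewrite lee_fin.
  rewrite -(@Irec n 2 isT) lerDl mulr_ge0 ?normal_pdf_ge0//.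
  by rewrite mulr_ge0 ?exprn_ge0// mulr_ge0// sqr_ge0.
have i4 : leb.-integrable [set: measurableTypeR R] (fun x => (x ^+ 4 * p x)%:E).
  apply/integrableP; split; first by apply/measurable_EFinP; exact: (mpow 4).
  under eq_integral => x _ do rewrite abse_EFin (ger0_norm (pow_ge0 x _))//.
  by apply: le_lt_trans E4 _; rewrite ltry.
split; first exact/i.
rewrite e -lee_fin /Rintegral fineK//; exact: integrable_fin_num.
Qed.

(** The third absolute moment lies between the second and the fourth. *)
Lemma normal_moment3 : (N a).-integrable [set: measurableTypeR R] (fun x => (`|x| ^+ 3)%:E) /\
  \int[N a]_x (`|x| ^+ 3) <= 2 * a ^+ 3.
Proof.
have [i2 e2] := normal_moment2; have [i4 e4] := normal_moment4.
pose g (x : R) := 2^-1 * (a * x ^+ 2) + 2^-1 * (a^-1 * x ^+ 4).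
have j2 : (N a).-integrable [set: measurableTypeR R] (fun x => (2^-1 * (a * x ^+ 2))%:E).
  have := integrableZl measurableT (2^-1 * a) i2; apply: eq_integrable => // x _.
  by rewrite /= mulrA EFinM.
have j4 : (N a).-integrable [set: measurableTypeR R] (fun x => (2^-1 * (a^-1 * x ^+ 4))%:E).
  have := integrableZl measurableT (2^-1 * a^-1) i4; apply: eq_integrable => // x _.
  by rewrite /= mulrA EFinM.
have ig : (N a).-integrable [set: measurableTypeR R] (EFin \o g).
  have := integrableD measurableT j2 j4; exact: eq_integrable.
have le3 (x : R) : `|x| ^+ 3 <= g x.
  rewrite /g -(real_normK (num_real x)) (_ : x ^+ 4 = `|x| ^+ 4); last first.
    by rewrite -[4%N]/(2 * 2)%N !exprM (real_normK (num_real x)).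
  have x0 := normr_ge0 x; set y := `|x| in x0 *.
  rewrite -subr_ge0.
  (* The weights in [g] make the difference a perfect square. *)
  have -> : 2^-1 * (a * y ^+ 2) + 2^-1 * (a^-1 * y ^+ 4) - y ^+ 3 =
    2^-1 * a^-1 * (y * (a - y)) ^+ 2 by field.
  by rewrite mulr_ge0 ?sqr_ge0// mulr_ge0// invr_ge0 ltW.
have i3 : (N a).-integrable [set: measurableTypeR R] (fun x => (`|x| ^+ 3)%:E).
  apply: le_integrable ig => //.
    by apply/measurable_EFinP; apply: measurable_funX; exact: normr_measurable.
  move=> x _; rewrite /= lee_fin ger0_norm ?exprn_ge0//.
  by apply: le_trans (ler_norm _).
split => //; apply: (@le_trans _ _ (\int[N a]_x g x)); first exact: Rint_le.
rewrite RintD// !RintegralZl//; last 2 first.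
- by have := integrableZl measurableT a^-1 i4; apply: eq_integrable => // x _.
- by have := integrableZl measurableT a i2; apply: eq_integrable => // x _.
rewrite e2; have : a^-1 * \int[N a]_x (x ^+ 4) <= a^-1 * (3 * a ^+ 4) by rewrite ler_wpM2l// invr_ge0 ltW.
have -> : a^-1 * (3 * a ^+ 4) = 3 * a ^+ 3 by field.
by rewrite -exprS; lra.
Qed.

End moments.

Lemma normal_prob_opp a (B : set (measurableTypeR R)) : a != 0 -> measurable B ->
  N a ((fun x => - x) @^-1` B) = N a B.
Proof.
move=> a0 mB; rewrite /normal_prob.
have mo : measurable_fun [set: measurableTypeR R] (-%R : measurableTypeR R -> measurableTypeR R) by [].
have mp : measurable_fun [set: measurableTypeR R] (fun x : measurableTypeR R => (normal_pdf 0 a x)%:E).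
  by apply/measurable_EFinP; exact: measurable_normal_pdf.
transitivity (\int[pushforward leb (-%R : _ -> measurableTypeR R)]_(x in B) (normal_pdf 0 a x)%:E)%E.
  rewrite ge0_integral_pushforward//.
  - apply: eq_integral => x _ /=; congr (_%:E).
    by rewrite !normal_pdf0E// !subr0 sqrrN.
  - exact: measurable_funTS.
  - by move=> x _; rewrite lee_fin normal_pdf_ge0.
by apply: eq_measure_integral => A mA _; exact: lebesgue_measureN.
Qed.

Lemma normal_prob_translate m a (B : set (measurableTypeR R)) : a != 0 -> measurable B ->
  N a ((fun x => x + m) @^-1` B) = normal_prob m a B.
Proof.
move=> a0 mB; rewrite /normal_prob.
have mo : measurable_fun [set: measurableTypeR R] (fun x : measurableTypeR R => (x + m : measurableTypeR R)).
  exact: measurable_funD.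
have mp : measurable_fun [set: measurableTypeR R] (fun x : measurableTypeR R => (normal_pdf m a x)%:E).
  by apply/measurable_EFinP; exact: measurable_normal_pdf.
pose sh (x : measurableTypeR R) : measurableTypeR R := x + m.
transitivity (\int[pushforward leb sh]_(x in B) (normal_pdf m a x)%:E)%E.
  rewrite ge0_integral_pushforward//.
  - apply: eq_integral => x _ /=; congr (_%:E).
    by rewrite !normal_pdf0E// subr0 addrK.
  - exact: measurable_funTS.
  - by move=> x _; rewrite lee_fin normal_pdf_ge0.
by apply: eq_measure_integral => A mA _; exact: lebesgue_measure_translate.
Qed.

(** The product of two centred Gaussian densities is completed to a square. *)
Lemma normal_pdf_conv (a b t y : R) : 0 < a -> 0 < b ->
  let c := Num.sqrt (a ^+ 2 + b ^+ 2) in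
  normal_pdf y a t * normal_pdf 0 b y =
  normal_pdf 0 c t * normal_pdf (t * b ^+ 2 / c ^+ 2) (a * b / c) y.
Proof.
move=> a0 b0 c.
have s0 : 0 < a ^+ 2 + b ^+ 2 by rewrite addr_gt0// exprn_gt0.
have c0 : 0 < c by rewrite sqrtr_gt0.
have cE : c ^+ 2 = a ^+ 2 + b ^+ 2 by rewrite sqr_sqrtr// ltW.
have d0 : 0 < a * b / c by rewrite divr_gt0// mulr_gt0.
clearbody c; rewrite !normal_pdf0E ?gt_eqF// mulrACA [RHS]mulrACA -!expRD; congr (_ * expR _).
  rewrite /normal_peak -!invfM; congr (_^-1).
  have P0 (x : R) : 0 <= x ^+ 2 * pi *+ 2 by rewrite mulrn_wge0// mulr_ge0 ?sqr_ge0 ?pi_ge0.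
  rewrite -[LHS]sqrtrM// -[RHS]sqrtrM//; congr Num.sqrt.
  have ab : a * b = c * (a * b / c) by rewrite [RHS]mulrC divfK ?gt_eqF.
  rewrite -!(mulr_natr (_ * pi)); transitivity ((a * b) ^+ 2 * (pi * 2%:R) ^+ 2).
    by rewrite !exprMn; ring.
  by rewrite {1}ab !exprMn; ring.
rewrite !subr0 -!(mulr_natr (_ ^+ 2)) !exprMn exprVn cE.
field.
by rewrite !gt_eqF//= addrC ?s0.
Qed.

Lemma measurable_normal_pdf2 a : a != 0 ->
  measurable_fun [set: measurableTypeR R * measurableTypeR R]
    (fun z : measurableTypeR R * measurableTypeR R => normal_pdf z.2 a z.1).
Proof.
move=> a0; rewrite (_ : (fun _ => _) =
    (fun z : measurableTypeR R * measurableTypeR R => normal_pdf 0 a (z.1 - z.2))).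
  apply: (measurableT_comp (measurable_normal_pdf 0 a)).
  by apply: measurable_funB; [exact: measurable_fst | exact: measurable_snd].
by apply/funext => z; rewrite !normal_pdf0E// subr0.
Qed.

Let G a (B : set (measurableTypeR R)) (z : measurableTypeR R * measurableTypeR R) : \bar R :=
  (normal_pdf z.2 a z.1 * (\1_B z.1))%:E.

Let mG a B : a != 0 -> measurable B -> measurable_fun setT (G a B).
Proof.
move=> a0 mB; apply/measurable_EFinP; apply: measurable_funM.
  exact: measurable_normal_pdf2.
have mI : measurable_fun [set: measurableTypeR R] (\1_B : measurableTypeR R -> R).
  exact: measurable_indic.
exact: (measurableT_comp mI measurable_fst).
Qed.

Let G0 a B z : (0 <= G a B z)%E.
Proof. by rewrite lee_fin mulr_ge0// normal_pdf_ge0. Qed.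

Let GE a B y : normal_prob y a B = fubini_G leb (G a B) y.
Proof.
rewrite /normal_prob integral_mkcond; apply: eq_integral => x _.
by rewrite patchE /G/= indicE; case: (x \in B); rewrite ?mulr1 ?mulr0.
Qed.

Lemma measurable_normal_prob_mean a (B : set (measurableTypeR R)) : a != 0 -> measurable B ->
  measurable_fun [set: measurableTypeR R] (fun y : measurableTypeR R => normal_prob y a B).
Proof.
move=> a0 mB; under eq_fun do rewrite GE.
by apply: (measurable_fun_fubini_tonelli_G (m1 := leb) (G a B)); [exact: mG | exact: G0].
Qed.

Lemma normal_conv a b (B : set (measurableTypeR R)) : 0 < a -> 0 < b -> measurable B ->
  (\int[N b]_y (normal_prob y a B) = N (Num.sqrt (a ^+ 2 + b ^+ 2)) B)%E.
Proof.
move=> a0 b0 mB; set c := Num.sqrt _.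
have an0 : a != 0 by rewrite gt_eqF.
pose H (z : measurableTypeR R * measurableTypeR R) : \bar R :=
  (G a B z * (normal_pdf 0 b z.2)%:E)%E.
have mH : measurable_fun setT H.
  apply: emeasurable_funM; first exact: mG.
  apply/measurable_EFinP.
  exact: (measurableT_comp (measurable_normal_pdf 0 b) measurable_snd).
have H0 z : (0 <= H z)%E by rewrite mule_ge0 ?G0// lee_fin normal_pdf_ge0.
have mN := measurable_normal_prob_mean an0 mB.
have N0 (y : measurableTypeR R) : (0 <= normal_prob y a B)%E by exact: measure_ge0.
have := @ge0_integral_density _ (measurableTypeR R) R leb (N b) (normal_pdf 0 b)
  (measurable_normal_pdf _ _) (normal_pdf_ge0 _ _) (fun _ _ => erefl) _ mN N0.
move=> ->.
transitivity (\int[leb]_y \int[leb]_x H (x, y))%E.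
  apply: eq_integral => y _; rewrite GE /fubini_G -ge0_integralZr//.
  - by apply: (measurableT_comp (mG an0 mB)); exact: measurable_pair2.
  - by rewrite lee_fin normal_pdf_ge0.
rewrite -(fubini_tonelli (m1 := leb) (m2 := leb) H)// /normal_prob [RHS]integral_mkcond.
apply: eq_integral => x _; rewrite patchE /H /G/= indicE.
case: (boolP (x \in B)) => xB; last by rewrite integral0_eq// => y _; rewrite mulr0 mul0e.
under eq_integral => y _ do rewrite mulr1 -EFinM normal_pdf_conv// EFinM.
rewrite ge0_integralZl//.
- by rewrite integral_normal_pdf mule1.
- by apply/measurable_EFinP; exact: measurable_normal_pdf.
- by move=> y _; rewrite lee_fin normal_pdf_ge0.
- by rewrite lee_fin normal_pdf_ge0.
Qed.

End gaussian1.

(** * Gaussian vectors *)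

Lemma eq_opp_eq0 (R : realDomainType) (x : R) : - x = x -> x = 0.
Proof. by move=> /eqP; rewrite -subr_eq0 -opprD oppr_eq0 -mulr2n mulrn_eq0 => /eqP. Qed.

Lemma bmf_prod d (T : measurableType d) (R : realType) (I : Type) (s : seq I) (F : I -> T -> R) :
  (forall i, bmf (F i)) -> bmf (fun x => \prod_(i <- s) F i x).
Proof.
move=> bF; elim: s => [|i s IH].
  by under eq_fun do rewrite big_nil; exact: bmf_cst.
by under eq_fun do rewrite big_cons; exact: bmfM.
Qed.

Section gauss.
Context (R : realType).
Local Notation N a := (normal_prob (0 : R) a).

Definition gauss n (a : R) : set 'cV[R]_n -> \bar R :=
  product_cV (fun _ : 'I_n => normal_prob 0 a).
Arguments gauss : clear implicits.

HB.instance Definition _ n a := Measure.on (gauss n a).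

Let gauss_setT n a : gauss n a [set: _] = 1%E.
Proof. by apply: product_cV_setT => i; exact: (probability_setT (normal_prob (0 : R) a)). Qed.

HB.instance Definition _ n a :=
  Measure_isProbability.Build _ _ _ (gauss n a) (gauss_setT n a).

Lemma gauss_box n a (B : 'I_n -> set (measurableTypeR R)) : (forall i, measurable (B i)) ->
  gauss n a (box B) = (\prod_(i < n) N a (B i))%E.
Proof. by move=> mB; exact: product_cV_box. Qed.

Lemma gauss_coord n a i (B : set (measurableTypeR R)) : measurable B ->
  gauss n a ((fun z : 'cV[R]_n => z i ord0) @^-1` B) = N a B.
Proof.
move=> mB; pose C j := if j == i then B else setT.
have mC j : measurable (C j) by rewrite /C; case: ifP.
transitivity (gauss n a (box C)).
  congr (gauss _ _ _); apply/seteqP; split => z /=.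
    by move=> zB j; rewrite /C; case: eqP => // ->.
  by move=> /(_ i); rewrite /C eqxx.
rewrite gauss_box// (bigD1 i)//= {1}/C eqxx big1 ?mule1// => j ji.
by rewrite /C (negbTE ji); exact: (probability_setT (normal_prob (0 : R) a)).
Qed.

Definition reflect n (i : 'I_n) (z : 'cV[R]_n) : 'cV[R]_n :=
  \col_j (if j == i then - z j ord0 else z j ord0).

Lemma measurable_reflect n (i : 'I_n) : measurable_fun [set: 'cV[R]_n] (reflect i).
Proof.
apply: measurable_fun_mxP => j k.
rewrite (_ : (fun _ => _) = if j == i then (fun z : 'cV[R]_n => - z j ord0) else (fun z => z j ord0)).
  case: ifP => _; last exact: measurable_entry.
  by apply: measurableT_comp => //; exact: measurable_entry.
by apply/funext => z; rewrite mxE; case: ifP.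
Qed.

(** Changing the sign of one coordinate preserves the law; this is why all
    moments that are odd in some coordinate vanish. *)
Lemma gauss_reflect n a i (A : set 'cV[R]_n) : a != 0 -> measurable A ->
  gauss n a (reflect i @^-1` A) = gauss n a A.
Proof.
move=> a0 mA; apply/esym.
pose m2 : {measure set 'cV[R]_n -> \bar R} :=
  measure_function_pushforward__canonical__measure_function_Measure (gauss n a) (measurable_reflect i).
apply: (@cV_finite_measure_unique _ _ _ _ (gauss n a) m2) => //; last first.
  by rewrite [ltLHS](_ : _ = 1%E) ?ltry//; exact: gauss_setT.
move=> B mB.
pose C j := if j == i then (fun x : R => - x) @^-1` (B j) else B j.
have mC j : measurable (C j).
  rewrite /C; case: ifP => // _; rewrite -[X in measurable X]setTI.
  have mo : measurable_fun [set: measurableTypeR R] (-%R : measurableTypeR R -> measurableTypeR R) by [].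
  by apply: mo => //; exact: mB.
rewrite /= /pushforward (_ : _ @^-1` _ = box C).
  rewrite !gauss_box//; apply: eq_bigr => j _; rewrite /C; case: ifP => // _.
  by apply/esym; apply: normal_prob_opp => //; exact: mB.
by apply/seteqP; split => z H j; have := H j; rewrite /C /reflect mxE; case: ifP.
Qed.

Lemma gauss_translate n (m : 'cV[R]_n) (A : set 'cV[R]_n) : measurable A ->
  gauss n 1 ((fun z => z + m) @^-1` A) = normal_cV m A.
Proof.
move=> mA; apply/esym.
pose m2 : {measure set 'cV[R]_n -> \bar R} :=
  measure_function_pushforward__canonical__measure_function_Measure (gauss n 1) (measurable_translate_cV m).
apply: (@cV_finite_measure_unique _ _ _ _ (normal_cV m) m2) => //; last first.
  by rewrite [ltLHS](_ : _ = 1%E) ?ltry//; exact: (probability_setT (normal_cV m)).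
move=> B mB.
rewrite /= /pushforward (_ : _ @^-1` _ = box (fun i => (fun t => t + m i ord0) @^-1` (B i))); last first.
  by apply/seteqP; split => x H i; have := H i; rewrite /= mxE.
rewrite gauss_box; last first.
  move=> i; rewrite -[X in measurable X]setTI.
  by apply: (@measurable_funD _ _ _ _ id (cst _)) => //; exact: mB.
rewrite [LHS](@product_cV_box _ _ _ B); last exact: mB.
apply: eq_bigr => i _; apply/esym; apply: normal_prob_translate; last exact: mB.
by rewrite oner_eq0.
Qed.

Section moments.
Variables (n : nat) (a : R).
Hypothesis a0 : 0 < a.
Let an0 : a != 0. Proof. by rewrite gt_eqF. Qed.
Local Notation G := (gauss n a).
Let me i : measurable_fun [set: 'cV[R]_n] (fun z : 'cV[R]_n => z i ord0 : measurableTypeR R).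
Proof. exact: measurable_entry. Qed.

Let coord i (g : R -> R) : measurable_fun [set: measurableTypeR R] g ->
  (N a).-integrable [set: measurableTypeR R] (EFin \o g) ->
  G.-integrable [set: 'cV[R]_n] (fun z => (g (z i ord0))%:E) /\
  \int[G]_z g (z i ord0) = \int[N a]_x g x.
Proof.
move=> mg ig; exact: (Rint_law (me i) (gauss_coord a i) mg ig).
Qed.

Lemma gauss_int_sqr i : G.-integrable [set: 'cV[R]_n] (fun z => (z i ord0 ^+ 2)%:E).
Proof.
have [i2 e2] := normal_moment2 a0.
by have [] := coord i (measurable_funX 2 (@measurable_id _ _ _)) i2.
Qed.

Lemma gauss_mulE i j : G.-integrable [set: 'cV[R]_n] (fun z => (z i ord0 * z j ord0)%:E) /\
  \int[G]_z (z i ord0 * z j ord0) = a ^+ 2 * (i == j)%:R.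
Proof.
have iij : G.-integrable [set: 'cV[R]_n] (fun z => (z i ord0 * z j ord0)%:E).
  have := integrableD measurableT (gauss_int_sqr i) (gauss_int_sqr j).
  apply: le_integrable => //.
    by apply/measurable_EFinP; apply: measurable_funM; exact: me.
  move=> z _; rewrite /= lee_fin [leRHS]ger0_norm ?addr_ge0 ?sqr_ge0// ler_norml.
  apply/andP; split; rewrite -subr_ge0.
    rewrite opprK (_ : _ + _ = ((z i ord0 + z j ord0) ^+ 2 + (z i ord0 ^+ 2 + z j ord0 ^+ 2)) / 2); last by field.
    by rewrite divr_ge0 ?addr_ge0 ?sqr_ge0.
  rewrite (_ : _ - _ = ((z i ord0 - z j ord0) ^+ 2 + (z i ord0 ^+ 2 + z j ord0 ^+ 2)) / 2); last by field.
  by rewrite divr_ge0 ?addr_ge0 ?sqr_ge0.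
split => //; case: (eqVneq i j) => [<-|ij].
  rewrite mulr1; have [i2 <-] := normal_moment2 a0.
  by have [_ <-] := coord i (measurable_funX 2 (@measurable_id _ _ _)) i2.
rewrite mulr0; have mp : measurable_fun [set: 'cV[R]_n] (fun z : 'cV[R]_n => z i ord0 * z j ord0).
  by apply: measurable_funM; exact: me.
have := (Rint_law (measurable_reflect i) (fun A => gauss_reflect i an0 (A := A)) mp iij).2.
rewrite (_ : \int[_]_x _ = - \int[G]_z (z i ord0 * z j ord0)); first exact: eq_opp_eq0.
rewrite -mulN1r -RintegralZl//; apply: eq_Rintegral => z _.
by rewrite /reflect !mxE eqxx eq_sym (negbTE ij) mulN1r mulNr.
Qed.

Lemma gauss_coordE i : G.-integrable [set: 'cV[R]_n] (fun z => (z i ord0)%:E) /\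
  \int[G]_z (z i ord0) = 0.
Proof.
have ii : G.-integrable [set: 'cV[R]_n] (fun z => (z i ord0)%:E).
  have := integrableD measurableT (bmf_integrable G (bmf_cst _ 1)) (gauss_int_sqr i).
  apply: le_integrable => //; first by apply/measurable_EFinP; exact: me.
  move=> z _; rewrite /= lee_fin [leRHS]ger0_norm ?addr_ge0 ?sqr_ge0// ler_norml.
  by apply/andP; split; nra.
split => //.
have := (Rint_law (measurable_reflect i) (fun A => gauss_reflect i an0 (A := A)) (me i) ii).2.
rewrite (_ : \int[_]_x _ = - \int[G]_z (z i ord0)); first exact: eq_opp_eq0.
rewrite -mulN1r -RintegralZl//; apply: eq_Rintegral => z _.
by rewrite /reflect !mxE eqxx mulN1r.
Qed.

Lemma gauss_cubeE i : G.-integrable [set: 'cV[R]_n] (fun z => (`|z i ord0| ^+ 3)%:E) /\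
  \int[G]_z (`|z i ord0| ^+ 3) <= 2 * a ^+ 3.
Proof.
have [i3 e3] := normal_moment3 a0.
have m3 : measurable_fun [set: measurableTypeR R] (fun x : R => `|x| ^+ 3).
  by apply: measurable_funX; exact: normr_measurable.
by have [ii ->] := coord i m3 i3.
Qed.

End moments.

(** Fubini, one coordinate at a time. *)
Lemma gauss_prod_integral n a (u : 'I_n -> R -> R) : (forall i, bmf (u i : measurableTypeR R -> R)) ->
  \int[gauss n a]_z (\prod_(i < n) u i (z i ord0)) = \prod_(i < n) \int[N a]_x u i x.
Proof.
elim: n u => [|n IH] u bu.
  by under eq_Rintegral do rewrite big_ord0; rewrite Rint_cst big_ord0.
have mk := @measurable_insert_coord R n.+1 ord_max.
have law A : measurable A -> (gauss n a \x N a)%E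
    ((fun p : 'cV[R]_n * measurableTypeR R => insert_coord (ord_max : 'I_n.+1) p.2 p.1) @^-1` A) =
    gauss n.+1 a A by [].
have bv : bmf (fun z : 'cV[R]_n => \prod_(i < n) u (lift ord_max i) (z i ord0)).
  apply: bmf_prod => i; apply: (bmf_comp (measurable_entry i ord0)); exact: bu.
have b1 : bmf (fun p : 'cV[R]_n * measurableTypeR R =>
    \prod_(i < n) u (lift ord_max i) (p.1 i ord0) * u ord_max p.2).
  apply: bmfM; first exact: (bmf_comp measurable_fst bv).
  exact: (bmf_comp measurable_snd (bu _)).
have bz : bmf (fun z : 'cV[R]_n.+1 => \prod_(i < n.+1) u i (z i ord0)).
  by apply: bmf_prod => i; apply: (bmf_comp (measurable_entry i ord0)); exact: bu.
have [_ <-] := @Rint_law _ _ R (gauss n a \x N a)%E _ _ (gauss n.+1 a) _ _ mk law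
  (bmf_meas bz) (bmf_integrable _ bz).
have wl (i : 'I_n) : widen_ord (leqnSn n) i = lift ord_max i.
  by apply/val_inj; rewrite /= /bump leqNgt ltn_ord.
transitivity (\int[(gauss n a \x N a)%E]_p
    (\prod_(i < n) u (lift ord_max i) (p.1 i ord0) * u ord_max p.2)).
  apply: eq_Rintegral => p _; rewrite big_ord_recr /= mxE unlift_none; congr (_ * _).
  by apply: eq_bigr => i _; rewrite wl mxE liftK.
rewrite Rfubini1// big_ord_recr /=.
under [X in _ = X * _]eq_bigr do rewrite wl.
rewrite -IH; last by move=> i; exact: bu.
rewrite -RintegralZr//; last exact: bmf_integrable.
by apply: eq_Rintegral => z _; rewrite RintZ//; apply: bmf_integrable; exact: bu.
Qed.

(** Convolution on vectors reduces to the coordinates: integrating a box over a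
    shifted Gaussian gives a product of functions of one coordinate each. *)
Lemma gauss_conv n a b (A : set 'cV[R]_n) : 0 < a -> 0 < b -> measurable A ->
  (gauss n b \x gauss n a)%E [set p | A (p.1 + p.2)] = gauss n (Num.sqrt (a ^+ 2 + b ^+ 2)) A.
Proof.
move=> a0 b0 mA.
have madd : measurable_fun [set: 'cV[R]_n * 'cV[R]_n] (fun p => p.1 + p.2).
  apply: measurable_fun_mxP => i j.
  rewrite (_ : (fun _ => _) = fun p : 'cV[R]_n * 'cV[R]_n => p.1 i j + p.2 i j).
    apply: measurable_funD.
      exact: (measurableT_comp (measurable_entry i j) measurable_fst).
    exact: (measurableT_comp (measurable_entry i j) measurable_snd).
  by apply/funext => p; rewrite mxE.
pose m1 : {measure set 'cV[R]_n -> \bar R} :=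
  measure_function_pushforward__canonical__measure_function_Measure (gauss n b \x gauss n a)%E madd.
set c := Num.sqrt _.
apply: (@cV_finite_measure_unique _ _ _ _ m1 (gauss n c)) => //; last first.
  rewrite /m1/= /pushforward preimage_setT [ltLHS](_ : _ = 1%E) ?ltry//.
  exact: (probability_setT (gauss n b \x gauss n a)%E).
move=> B mB; transitivity (\prod_(i < n) N c (B i))%E; last by apply/esym; apply: gauss_box => i; exact: mB.
transitivity (\int[gauss n b]_y (\prod_(i < n) fine (normal_prob (y i ord0) a (B i)))%:E)%E.
  rewrite /m1/= /pushforward /product_measure1; apply: eq_integral => y _.
  have -> : (gauss n a \o xsection ((fun p : 'cV[R]_n * 'cV[R]_n => p.1 + p.2) @^-1` box B)) y =
      gauss n a (box (fun i => (fun t => t + y i ord0) @^-1` B i)).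
    rewrite /=; congr (gauss _ _ _); apply/seteqP; split => z.
      by move=> /xsectionP /= H i; have := H i; rewrite mxE addrC.
    by move=> H; apply/xsectionP => i; have := H i; rewrite /= mxE addrC.
  rewrite gauss_box; last first.
    move=> i; rewrite -[X in measurable X]setTI.
    by apply: (@measurable_funD _ _ _ _ id (cst _)) => //; exact: mB.
  rewrite -prodEFin; apply: eq_bigr => i _.
  rewrite fineK; last by apply: fin_num_measure; exact: mB.
  by apply: normal_prob_translate; [rewrite gt_eqF | exact: mB].
have bu i : bmf ((fun y : R => fine (normal_prob y a (B i))) : measurableTypeR R -> R).
  split.
    rewrite (_ : (fun _ => _) = fine \o (fun y : R => normal_prob y a (B i)))//.
    apply: measurableT_comp => //.
    by apply: measurable_normal_prob_mean; [rewrite gt_eqF | exact: mB].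
  exists 1 => y; rewrite ger0_norm ?fine_ge0// -lee_fin fineK.
    by apply: probability_le1; exact: mB.
  by apply: fin_num_measure; exact: mB.
have bp : bmf (fun y : 'cV[R]_n => \prod_(i < n) fine (normal_prob (y i ord0) a (B i))).
  by apply: bmf_prod => i; exact: (bmf_comp (measurable_entry i ord0) (bu i)).
rewrite -[LHS]fineK; last exact: (integrable_fin_num measurableT (bmf_integrable (gauss n b) bp)).
rewrite [fine _](_ : _ = \prod_(i < n) \int[N b]_x fine (normal_prob x a (B i))); last exact: (gauss_prod_integral b bu).
rewrite -prodEFin; apply: eq_bigr => i _.
rewrite -normal_conv//; last exact: mB.
rewrite /Rintegral fineK; last exact: (integrable_fin_num measurableT (bmf_integrable (N b) (bu i))).
apply: eq_integral => y _; rewrite fineK//.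
by apply: fin_num_measure; exact: mB.
Qed.

End gauss.
Arguments gauss {R} n a.

(** * Lindeberg replacement *)

Section smooth.
Context (R : realType) (K : nat).
Implicit Types (phi : 'cV[R]_K -> R) (D : 'cV[R]_K -> 'cV[R]_K) (H : 'cV[R]_K -> 'M[R]_K).

Definition quadr (D : 'cV[R]_K) (H : 'M[R]_K) (y : 'cV[R]_K) : R :=
  \sum_k D k ord0 * y k ord0 + 2^-1 * \sum_k \sum_l H k l * (y k ord0 * y l ord0).

Definition cube_norm (y : 'cV[R]_K) : R := \sum_k `|y k ord0| ^+ 3.

(** A second-order expansion with a cubic remainder, in which [D] and [H] need
    not be the derivatives of [phi]. Only the expansion matters for the
    replacement argument, and in this form it passes to averages without
    differentiating under the integral. *)
Definition taylor2 (C : R) phi D H :=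
  [/\ bmf phi, forall k, bmf (fun x => D x k ord0), forall k l, bmf (fun x => H x k l) &
    forall x y, `|phi (x + y) - phi x - quadr (D x) (H x) y| <= C * cube_norm y].

Definition smooth C phi := exists D H, taylor2 C phi D H.

Definition gauss_avg (a : R) phi x := \int[gauss K a]_z phi (x + z).

Lemma measurable_add_cV :
  measurable_fun [set: 'cV[R]_K * 'cV[R]_K] (fun p => p.1 + p.2).
Proof.
apply: measurable_fun_mxP => i j.
rewrite (_ : (fun _ => _) = fun p : 'cV[R]_K * 'cV[R]_K => p.1 i j + p.2 i j).
  apply: measurable_funD.
    exact: (measurableT_comp (measurable_entry i j) measurable_fst).
  exact: (measurableT_comp (measurable_entry i j) measurable_snd).
by apply/funext => p; rewrite mxE.
Qed.

Lemma measurable_addl_cV (x : 'cV[R]_K) : measurable_fun [set: 'cV[R]_K] (fun z => x + z).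
Proof. by under eq_fun do rewrite addrC; exact: measurable_translate_cV. Qed.

Lemma bmf_gauss_avg a phi : bmf phi -> bmf (gauss_avg a phi).
Proof. by move=> bp; exact: (bmf_Rint1 (gauss K a) (gauss K a) (bmf_comp measurable_add_cV bp)). Qed.

Let bsh phi (x : 'cV[R]_K) : bmf phi -> bmf (fun z : 'cV[R]_K => phi (x + z)).
Proof. exact: (bmf_comp (measurable_addl_cV x)). Qed.

(** The sum of two independent centred Gaussian vectors is Gaussian. *)
Lemma gauss_avg_semigroup a b phi x : 0 < a -> 0 < b -> bmf phi ->
  gauss_avg b (gauss_avg a phi) x = gauss_avg (Num.sqrt (a ^+ 2 + b ^+ 2)) phi x.
Proof.
move=> a0 b0 bp; rewrite /gauss_avg.
have bs := bsh x bp.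
have [_ <-] := @Rint_law _ _ R (gauss K b \x gauss K a)%E _ _ (gauss K (Num.sqrt (a ^+ 2 + b ^+ 2)))
  _ _ measurable_add_cV (fun A mA => gauss_conv a0 b0 mA) (bmf_meas bs) (bmf_integrable _ bs).
rewrite Rfubini1; last exact: (bmf_comp measurable_add_cV bs).
by apply: eq_Rintegral => y _; apply: eq_Rintegral => z _ /=; rewrite addrA.
Qed.

Lemma bmf_quadr d (T : measurableType d) (D : T -> 'cV[R]_K) (H : T -> 'M[R]_K) (y : T -> 'cV[R]_K) :
  (forall k, bmf (fun x => D x k ord0)) -> (forall k l, bmf (fun x => H x k l)) ->
  (forall k, bmf (fun x => y x k ord0)) -> bmf (fun x => quadr (D x) (H x) (y x)).
Proof.
move=> bD bH bY; apply: bmfD; first by apply: bmf_sum => k _; exact: bmfM.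
apply: bmfM => //; apply: bmf_sum => k _; apply: bmf_sum => l _; apply: bmfM => //.
exact: bmfM.
Qed.

(** The expansion at [x + z] is averaged over [z], coefficient by coefficient. *)
Lemma smooth_gauss_avg C phi a : smooth C phi -> smooth C (gauss_avg a phi).
Proof.
move=> [D [H [bp bD bH tp]]].
pose D' x : 'cV[R]_K := \col_k gauss_avg a (fun x => D x k ord0) x.
pose H' x : 'M[R]_K := \matrix_(k, l) gauss_avg a (fun x => H x k l) x.
exists D', H'; split.
- exact: bmf_gauss_avg.
- by move=> k; under eq_fun do rewrite mxE; apply: bmf_gauss_avg; exact: bD.
- by move=> k l; under eq_fun do rewrite mxE; apply: bmf_gauss_avg; exact: bH.
move=> x y.
have bDs k := bsh x (bD k); have bHs k l := bsh x (bH k l).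
have bq : bmf (fun z => quadr (D (x + z)) (H (x + z)) y) by exact: bmf_quadr.
have qE : quadr (D' x) (H' x) y = \int[gauss K a]_z quadr (D (x + z)) (H (x + z)) y.
  rewrite /quadr RintD; last 2 first.
  - by apply: bmf_integrable; apply: bmf_sum => k _; exact: bmfM.
  - apply: bmf_integrable; apply: bmfM => //; apply: bmf_sum => k _; apply: bmf_sum => l _.
    exact: bmfM.
  congr (_ + _).
    rewrite Rint_sum; last by move=> k _; apply: bmf_integrable; exact: bmfM.
    by apply: eq_bigr => k _; rewrite mxE -RintegralZr//; exact: bmf_integrable.
  rewrite RintZ; last first.
    apply: bmf_integrable; apply: bmf_sum => k _; apply: bmf_sum => l _; exact: bmfM.
  congr (_ * _); rewrite Rint_sum; last first.
    by move=> k _; apply: bmf_integrable; apply: bmf_sum => l _; exact: bmfM.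
  apply: eq_bigr => k _; rewrite Rint_sum; last by move=> l _; apply: bmf_integrable; exact: bmfM.
  by apply: eq_bigr => l _; rewrite mxE -RintegralZr//; exact: bmf_integrable.
have b1 := bsh (x + y) bp; have b2 := bsh x bp.
rewrite qE /gauss_avg -RintB; [|exact: bmf_integrable..].
rewrite -RintB; [|by apply: bmf_integrable; exact: bmfB|exact: bmf_integrable].
apply: Rint_bound; first by apply: bmfB => //; exact: bmfB.
by move=> z; rewrite (addrAC x y z); exact: tp.
Qed.

Lemma cube_norm_ge0 y : 0 <= cube_norm y.
Proof. by apply: sumr_ge0 => k _; rewrite exprn_ge0. Qed.

(** The Gaussian increment has mean zero and covariance a^2 times the identity,
    so it produces the same second-order terms as the summand that it replaces in
    [lindeberg_expansion]. *)
Lemma gauss_avg_expansion C phi D H a x : 0 < a -> 0 <= C -> taylor2 C phi D H ->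
  `|gauss_avg a phi x - phi x - 2^-1 * (a ^+ 2 * \sum_k H x k k)| <= C * (K%:R * (2 * a ^+ 3)).
Proof.
move=> a0 C0 [bp bD bH tp].
have bs := bsh x bp.
have iq : (gauss K a).-integrable setT (EFin \o (quadr (D x) (H x))) /\
    \int[gauss K a]_z quadr (D x) (H x) z = 2^-1 * (a ^+ 2 * \sum_k H x k k).
  have i1 k : (gauss K a).-integrable setT (EFin \o (fun z : 'cV[R]_K => D x k ord0 * z k ord0)).
    have := integrableZl measurableT (D x k ord0) (gauss_coordE a0 k).1.
    by apply: eq_integrable.
  have i2 k l : (gauss K a).-integrable setT (EFin \o (fun z : 'cV[R]_K => H x k l * (z k ord0 * z l ord0))).
    have := integrableZl measurableT (H x k l) (gauss_mulE a0 k l).1.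
    by apply: eq_integrable.
  have i3 := @int_sum _ _ _ (gauss K a) _ (index_enum 'I_K) xpredT _ (fun k _ => i1 k).
  have i4 k := @int_sum _ _ _ (gauss K a) _ (index_enum 'I_K) xpredT _ (fun l _ => i2 k l).
  have i5 := @int_sum _ _ _ (gauss K a) _ (index_enum 'I_K) xpredT _ (fun k _ => i4 k).
  have i6 : (gauss K a).-integrable setT
      (EFin \o (fun z : 'cV[R]_K => 2^-1 * \sum_k \sum_l H x k l * (z k ord0 * z l ord0))).
    by have := integrableZl measurableT 2^-1 i5; apply: eq_integrable.
  split; first by have := integrableD measurableT i3 i6; apply: eq_integrable.
  rewrite /quadr RintD// Rint_sum// big1 ?add0r; last first.
    by move=> k _; rewrite RintZ ?(gauss_coordE a0 k).2 ?mulr0//; exact: (gauss_coordE a0 k).1.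
  rewrite RintZ//; congr (_ * _); rewrite Rint_sum// mulr_sumr; apply: eq_bigr => k _.
  rewrite Rint_sum// (bigD1 k)//= big1 ?addr0 => [|l lk].
    rewrite RintZ; last exact: (gauss_mulE a0 k k).1.
    by rewrite (gauss_mulE a0 k k).2 eqxx mulr1 mulrC.
  rewrite RintZ; last exact: (gauss_mulE a0 k l).1.
  by rewrite (gauss_mulE a0 k l).2 eq_sym (negbTE lk) !mulr0.
have ic : (gauss K a).-integrable setT (EFin \o cube_norm) /\
    \int[gauss K a]_z cube_norm z <= K%:R * (2 * a ^+ 3).
  have ik k := (gauss_cubeE a0 (n := K) k).1.
  split; first exact: (@int_sum _ _ _ (gauss K a) _ (index_enum 'I_K) xpredT _ (fun k _ => ik k)).
  rewrite /cube_norm Rint_sum; last by move=> k _; exact: ik.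
  apply: (@le_trans _ _ (\sum_(k < K) 2 * a ^+ 3)).
    by apply: ler_sum => k _; exact: (gauss_cubeE a0 k).2.
  by rewrite sumr_const card_ord [leRHS]mulr_natl.
have [iq1 <-] := iq; have [ic1 ic2] := ic.
rewrite /gauss_avg -[X in _ - X - _](Rint_cst (gauss K a)).
have isx : (gauss K a).-integrable setT (EFin \o (fun z => phi (x + z) - phi x)).
  by apply: bmf_integrable; exact: bmfB.
rewrite -RintB//; [|exact: bmf_integrable|exact: bmf_integrable].
have it : (gauss K a).-integrable setT (EFin \o (fun z => phi (x + z) - phi x - quadr (D x) (H x) z)).
  by have := integrableB measurableT isx iq1; apply: eq_integrable.
rewrite -RintB//; apply: le_trans (Rint_norm it) _.
apply: le_trans (ler_wpM2l C0 ic2); rewrite -RintZ//; apply: Rint_le => //.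
- by have := integrable_abse it; apply: eq_integrable.
- by have := integrableZl measurableT C ic1; apply: eq_integrable.
Qed.

End smooth.

Section lindeberg.
Context d d' (T : measurableType d) (S : measurableType d') (R : realType).
Variables (P : probability T R) (n K : nat) (Y : 'I_n -> T -> S) (x0 : S) (Q : probability S R).
Hypothesis mY : forall i, measurable_fun [set: T] (Y i).
Hypothesis indY : forall B : 'I_n -> set S, (forall i, measurable (B i)) ->
  P [set w | forall i, B i (Y i w)] = (\prod_(i < n) P (Y i @^-1` B i))%E.
Hypothesis lawY : forall i D, measurable D -> P (Y i @^-1` D) = Q D.
Variables (zeta : S -> 'cV[R]_K) (M : R).
Hypothesis mz : forall k, measurable_fun [set: S] (fun y => zeta y k ord0).
Hypothesis zM : forall y k, `|zeta y k ord0| <= M.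
Hypothesis z1 : forall k, \int[Q]_y zeta y k ord0 = 0.
Hypothesis z2 : forall k l, \int[Q]_y (zeta y k ord0 * zeta y l ord0) = (k == l)%:R.
Variable a : 'I_n -> R.
Hypothesis an0 : forall i, a i != 0.

Lemma expectation_others_mul j (u : 'cV[S]_n -> R) (v : S -> R) : bmf u -> bmf v ->
  \int[P]_w (u (others Y x0 j w) * v (Y j w)) =
  \int[P]_w u (others Y x0 j w) * \int[Q]_y v y.
Proof.
move=> bu bv; have bg : bmf (fun p : 'cV[S]_n * S => u p.1 * v p.2).
  by apply: bmfM; [exact: (bmf_comp measurable_fst bu) | exact: (bmf_comp measurable_snd bv)].
have [-> _] := decouple_others x0 mY indY (lawY j) bg.
have bo : bmf (fun w => u (others Y x0 j w)) by exact: (bmf_comp (measurable_others x0 mY j) bu).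
rewrite -RintegralZr//; last exact: bmf_integrable.
by apply: eq_Rintegral => w _ /=; rewrite (RintZ _ (bmf_integrable Q bv)).
Qed.

Definition partial_sum (m : nat) (w : T) : 'cV[R]_K := \sum_(i < n | (i < m)%N) a i *: zeta (Y i w).

Let pso (m : nat) (o : 'cV[S]_n) : 'cV[R]_K := \sum_(i < n | (i < m)%N) a i *: zeta (o i ord0).

Let partial_sum_others m (j : 'I_n) w : m = j :> nat -> partial_sum m w = pso m (others Y x0 j w).
Proof.
move=> mj; apply: eq_bigr => i im; rewrite mxE ifF//.
by apply/negbTE; rewrite -val_eqE /= neq_ltn -mj im.
Qed.

Let bzeta k : bmf (fun y => zeta y k ord0). Proof. by split; [exact: mz | exists M]. Qed.

Lemma bmf_partial_sum m k : bmf (fun w => partial_sum m w k ord0).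
Proof.
under eq_fun do rewrite summxE; apply: bmf_sum => i _.
under eq_fun do rewrite mxE; apply: bmfM => //.
exact: (bmf_comp (mY i) (bzeta k)).
Qed.

Lemma measurable_partial_sum m : measurable_fun [set: T] (partial_sum m).
Proof. by apply: measurable_fun_mxP => k l; rewrite (ord1 l); exact: bmf_meas (bmf_partial_sum m k). Qed.

Let bpso (phi : 'cV[R]_K -> R) m : bmf phi -> bmf (fun o : 'cV[S]_n => phi (pso m o)).
Proof.
apply: bmf_comp; apply: measurable_fun_mxP => k l; rewrite (ord1 l).
apply: bmf_meas; under eq_fun do rewrite summxE; apply: bmf_sum => i _.
under eq_fun do rewrite mxE; apply: bmfM => //.
exact: (bmf_comp (measurable_entry i ord0) (bzeta k)).
Qed.

(** The new summand is independent of the previous partial sum: given that sum,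
    the first-order term has mean zero and the second-order one only sees the
    trace of [H]. *)
Lemma lindeberg_expansion C phi D H (j : 'I_n) : 0 <= C -> taylor2 C phi D H ->
  `|\int[P]_w phi (partial_sum j.+1 w) - \int[P]_w phi (partial_sum j w)
    - 2^-1 * (a j ^+ 2 * \int[P]_w (\sum_k H (partial_sum j w) k k))|
  <= C * (K%:R * (`|a j| ^+ 3 * M ^+ 3)).
Proof.
move=> C0 [bp bD bH tp].
pose W w := partial_sum j w; pose o w := others Y x0 j w.
have WE w : W w = pso j (o w) by exact: partial_sum_others.
have mW := measurable_partial_sum j.
have SE w : partial_sum j.+1 w = W w + a j *: zeta (Y j w).
  rewrite /W /partial_sum (bigD1 j) ?ltnSn//= addrC; congr (_ + _).
  by apply: eq_bigl => i; rewrite ltnS ltn_neqAle andbC.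
have bWp : bmf (fun w => phi (W w)) by exact: (bmf_comp mW bp).
have bSp : bmf (fun w => phi (partial_sum j.+1 w)) by exact: (bmf_comp (measurable_partial_sum j.+1) bp).
have bz k : bmf (fun w => zeta (Y j w) k ord0) by exact: (bmf_comp (mY j) (bzeta k)).
have baz k : bmf (fun w => (a j *: zeta (Y j w)) k ord0).
  by under eq_fun do rewrite mxE; exact: bmfM.
have bDW k : bmf (fun w => D (W w) k ord0) by exact: (bmf_comp mW (bD k)).
have bHW k l : bmf (fun w => H (W w) k l) by exact: (bmf_comp mW (bH k l)).
have bq : bmf (fun w => quadr (D (W w)) (H (W w)) (a j *: zeta (Y j w))) by exact: bmf_quadr.
have E1 k : \int[P]_w (D (W w) k ord0 * (a j *: zeta (Y j w)) k ord0) = 0.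
  under eq_Rintegral => w _ do rewrite mxE WE.
  rewrite (expectation_others_mul j (u := fun o => D (pso j o) k ord0) (v := fun y => a j * zeta y k ord0)).
  - by rewrite RintZ ?z1 ?mulr0//; exact: bmf_integrable.
  - exact: (bpso j (bD k)).
  - exact: bmfM.
have E2 k l : \int[P]_w (H (W w) k l * ((a j *: zeta (Y j w)) k ord0 * (a j *: zeta (Y j w)) l ord0)) =
    a j ^+ 2 * (k == l)%:R * \int[P]_w (H (W w) k l).
  under eq_Rintegral => w _ do rewrite !mxE mulrACA WE.
  rewrite (expectation_others_mul j (u := fun o => H (pso j o) k l)
    (v := fun y => a j * a j * (zeta y k ord0 * zeta y l ord0))).
  - rewrite RintZ ?z2; last by apply: bmf_integrable; exact: bmfM.
    by rewrite mulrC; congr (_ * _); apply: eq_Rintegral => w _; rewrite WE.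
  - exact: (bpso j (bH k l)).
  - by apply: bmfM => //; exact: bmfM.
have bDaz k : bmf (fun w => D (W w) k ord0 * (a j *: zeta (Y j w)) k ord0) by exact: bmfM.
have bHaz k l : bmf (fun w => H (W w) k l * ((a j *: zeta (Y j w)) k ord0 * (a j *: zeta (Y j w)) l ord0)).
  by apply: bmfM => //; exact: bmfM.
have bHs k : bmf (fun w => \sum_l H (W w) k l * ((a j *: zeta (Y j w)) k ord0 * (a j *: zeta (Y j w)) l ord0)).
  by apply: bmf_sum => l _.
have qE : \int[P]_w quadr (D (W w)) (H (W w)) (a j *: zeta (Y j w)) =
    2^-1 * (a j ^+ 2 * \int[P]_w (\sum_k H (W w) k k)).
  rewrite /quadr RintD; last 2 first.
  - by apply: bmf_integrable; apply: bmf_sum.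
  - by apply: bmf_integrable; apply: bmfM => //; apply: bmf_sum.
  rewrite [X in X + _]Rint_sum; last by move=> k _; exact: bmf_integrable.
  rewrite [X in X + _]big1 ?add0r; last by move=> k _; exact: E1.
  rewrite RintZ; last by apply: bmf_integrable; apply: bmf_sum.
  congr (_ * _); rewrite !Rint_sum; [|by move=> k _; exact: bmf_integrable..].
  rewrite mulr_sumr; apply: eq_bigr => k _.
  rewrite Rint_sum; last by move=> l _; exact: bmf_integrable.
  rewrite (bigD1 k)//= big1 ?addr0 => [|l lk]; first by rewrite E2 eqxx mulr1.
  by rewrite E2 eq_sym (negbTE lk) mulr0 mul0r.
rewrite -[X in _ - 2^-1 * (_ * X)]/(\int[P]_w (\sum_k H (W w) k k)) -qE.
rewrite -RintB; [|exact: bmf_integrable..].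
rewrite -RintB; [|by apply: bmf_integrable; exact: bmfB|exact: bmf_integrable].
apply: Rint_bound; first by apply: bmfB => //; exact: bmfB.
move=> w; rewrite SE; apply: le_trans (tp _ _) _; rewrite ler_wpM2l//.
apply: (@le_trans _ _ (\sum_(k < K) `|a j| ^+ 3 * M ^+ 3)).
  apply: ler_sum => k _; rewrite mxE normrM exprMn ler_wpM2l ?exprn_ge0//.
  by apply: lerXn2r; rewrite ?nnegrE//; exact: le_trans (zM (Y j w) k).
by rewrite sumr_const card_ord mulr_natl.
Qed.

Lemma lindeberg_step C phi (j : 'I_n) : 0 <= C -> smooth C phi ->
  `|\int[P]_w phi (partial_sum j.+1 w) - \int[P]_w gauss_avg `|a j| phi (partial_sum j w)|
  <= C * (K%:R * ((M ^+ 3 + 2) * `|a j| ^+ 3)).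
Proof.
move=> C0 [D [H tp]]; have [bp bD bH _] := tp.
have a0 : 0 < `|a j| by rewrite normr_gt0.
have mW := measurable_partial_sum j.
have bWp : bmf (fun w => phi (partial_sum j w)) by exact: (bmf_comp mW bp).
have bGp : bmf (fun w => gauss_avg `|a j| phi (partial_sum j w)).
  exact: (bmf_comp mW (bmf_gauss_avg _ bp)).
have bHW : bmf (fun w => \sum_k H (partial_sum j w) k k).
  by apply: bmf_sum => k _; exact: (bmf_comp mW (bH k k)).
have e1 := lindeberg_expansion j C0 tp.
have e2 : `|\int[P]_w gauss_avg `|a j| phi (partial_sum j w) - \int[P]_w phi (partial_sum j w)
    - 2^-1 * (a j ^+ 2 * \int[P]_w (\sum_k H (partial_sum j w) k k))|
    <= C * (K%:R * (2 * `|a j| ^+ 3)).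
  rewrite -RintZ; last exact: bmf_integrable.
  rewrite -RintZ; last by apply: bmf_integrable; exact: bmfM.
  rewrite -RintB; [|exact: bmf_integrable..].
  rewrite -RintB; [|by apply: bmf_integrable; exact: bmfB
    |by apply: bmf_integrable; apply: bmfM => //; exact: bmfM].
  apply: Rint_bound.
    by apply: bmfB; [exact: bmfB | apply: bmfM => //; exact: bmfM].
  move=> w; have := gauss_avg_expansion (partial_sum j w) a0 C0 tp.
  by rewrite real_normK ?num_real.
have := ler_normB (\int[P]_w phi (partial_sum j.+1 w) - \int[P]_w phi (partial_sum j w)
    - 2^-1 * (a j ^+ 2 * \int[P]_w (\sum_k H (partial_sum j w) k k)))
  (\int[P]_w gauss_avg `|a j| phi (partial_sum j w) - \int[P]_w phi (partial_sum j w)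
    - 2^-1 * (a j ^+ 2 * \int[P]_w (\sum_k H (partial_sum j w) k k))).
rewrite [X in `|X| <= _ -> _](_ : _ = \int[P]_w phi (partial_sum j.+1 w) - \int[P]_w gauss_avg `|a j| phi (partial_sum j w)); last by ring.
move=> /le_trans; apply; apply: le_trans (lerD e1 e2) _.
by rewrite le_eqVlt; apply/orP; left; apply/eqP; ring.
Qed.

(** Replacing the summands one at a time, from the last to the first: the
    Gaussian averages accumulated on the right merge into one. *)
Lemma lindeberg C m phi : 0 <= C -> (m < n)%N -> smooth C phi ->
  `|\int[P]_w phi (partial_sum m.+1 w) -
    gauss_avg (Num.sqrt (\sum_(i < n | (i < m.+1)%N) a i ^+ 2)) phi 0|
  <= C * (K%:R * ((M ^+ 3 + 2) * \sum_(i < n | (i < m.+1)%N) `|a i| ^+ 3)).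
Proof.
move=> C0; elim: m phi => [|m IH] phi mn sp.
  have big0 (F : 'I_n -> R) : \sum_(i < n | (i < 1)%N) F i = F (Ordinal mn).
    rewrite (bigD1 (Ordinal mn))//= big1 ?addr0// => i /andP[].
    by rewrite -val_eqE /= ltnS leqn0 => /eqP ->.
  have := lindeberg_step (Ordinal mn) C0 sp; rewrite !big0 sqrtr_sqr.
  rewrite [X in _ - X](_ : _ = gauss_avg `|a (Ordinal mn)| phi 0)//.
  transitivity (\int[P]_w gauss_avg `|a (Ordinal mn)| phi 0); last exact: Rint_cst.
  apply: eq_Rintegral => w _; congr (gauss_avg _ _ _).
  by rewrite /partial_sum big_pred0.
set j := Ordinal mn.
have step : `|\int[P]_w phi (partial_sum m.+2 w) -
    \int[P]_w gauss_avg `|a j| phi (partial_sum m.+1 w)| <=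
    C * (K%:R * ((M ^+ 3 + 2) * `|a j| ^+ 3)) := lindeberg_step j C0 sp.
have bigS (F : 'I_n -> R) : \sum_(i < n | (i < m.+2)%N) F i = F j + \sum_(i < n | (i < m.+1)%N) F i.
  rewrite (bigD1 j)//=; congr (_ + _); apply: eq_bigl => i.
  by rewrite ltnS (ltn_neqAle i m.+1) andbC.
have /(IH _ (ltnW mn)) := smooth_gauss_avg `|a j| sp.
have [D [H [bp _ _ _]]] := sp.
have s0 : 0 < \sum_(i < n | (i < m.+1)%N) a i ^+ 2.
  have n0 : (0 < n)%N by exact: leq_ltn_trans (leq0n j) (ltn_ord j).
  rewrite (bigD1 (Ordinal n0))//= ltr_pwDl ?exprn_even_gt0 ?an0//.
  by apply: sumr_ge0 => i _; rewrite sqr_ge0.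
rewrite gauss_avg_semigroup//; [|by rewrite normr_gt0|by rewrite sqrtr_gt0].
rewrite real_normK ?num_real// sqr_sqrtr ?(ltW s0)// -bigS => e2.
rewrite [X in _ <= C * (_ * (_ * X))]bigS; apply: le_trans (ler_distD (\int[P]_w gauss_avg `|a j| phi (partial_sum m.+1 w)) _ _) _.
by rewrite [leRHS](_ : _ = C * (K%:R * ((M ^+ 3 + 2) * `|a j| ^+ 3)) + C * (K%:R * ((M ^+ 3 + 2) *
  \sum_(i < n | (i < m.+1)%N) `|a i| ^+ 3))); [exact: lerD | ring].
Qed.

End lindeberg.

(** * A smooth cut-off of the squared norm *)

Section spline.
Context (R : realType).
Implicit Types t s : R.

Definition pos t : R := Num.max t 0.

Lemma pos_ge t : 0 <= t -> pos t = t. Proof. exact: max_l. Qed.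
Lemma pos_le t : t <= 0 -> pos t = 0. Proof. exact: max_r. Qed.

Lemma pos_ge0 t : 0 <= pos t. Proof. by rewrite le_max lexx orbT. Qed.

(** The third-order remainder of the truncated cube is bounded on both sides of
    the knot, although its third derivative jumps there. *)
Lemma pos_cube_taylor t s :
  `|pos (t + s) ^+ 3 - pos t ^+ 3 - 3 * pos t ^+ 2 * s - 3 * pos t * s ^+ 2| <= `|s| ^+ 3.
Proof.
have key (u v : R) : 0 <= u -> u <= v -> `|u ^+ 3 - v ^+ 3| <= v ^+ 3.
  move=> u0 uv; have v0 := le_trans u0 uv.
  have : u ^+ 3 <= v ^+ 3 by apply: lerXn2r; rewrite ?nnegrE.
  have : 0 <= u ^+ 3 by rewrite exprn_ge0.
  by rewrite ler_norml => h1 h2; apply/andP; split; lra.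
case: (leP 0 t) => t0; case: (leP 0 (t + s)) => ts.
- rewrite !pos_ge// (_ : _ - _ = s ^+ 3) ?normrX//; ring.
- rewrite (pos_ge t0) (pos_le (ltW ts)) expr0n /=.
  have s0 : s <= 0 by lra.
  rewrite (ler0_norm s0); have := key (- (t + s)) (- s); rewrite (_ : _ - _ =
    0 - t ^+ 3 - 3 * t ^+ 2 * s - 3 * t * s ^+ 2); first by apply; lra.
  by ring.
- rewrite (pos_ge ts) (pos_le (ltW t0)) !(expr0n, mulr0, mul0r, subr0)/=.
  have s0 : 0 <= s by lra.
  rewrite (ger0_norm s0) ger0_norm ?exprn_ge0//.
  by apply: lerXn2r; rewrite ?nnegrE//; lra.
- rewrite (pos_le (ltW ts)) (pos_le (ltW t0)) !(expr0n, mulr0, mul0r, subr0)/=.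
  by rewrite normr0 exprn_ge0.
Qed.

Variables a e : R.
Hypothesis e0 : 0 < e.

Definition diff3 (F : R -> R) t : R :=
  F (t - a) - 3 * F (t - (a + e)) + 3 * F (t - (a + 2 * e)) - F (t - (a + 3 * e)).

Let c := (6 * e ^+ 3)^-1.

Let c0 : 0 <= c. Proof. by rewrite invr_ge0 mulr_ge0// exprn_ge0// ltW. Qed.

(** One minus the distribution function of a quadratic B-spline: a piecewise
    cubic function that decreases from 1 at [a] to 0 at [a + 3 * e], with
    explicit first and second derivatives [cutoff'] and [cutoff'']. *)
Definition cutoff t : R := 1 - c * diff3 (fun u => pos u ^+ 3) t.
Definition cutoff' t : R := - (c * diff3 (fun u => 3 * pos u ^+ 2) t).
Definition cutoff'' t : R := - (c * diff3 (fun u => 6 * pos u) t).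

Lemma cutoff_taylor t s :
  `|cutoff (t + s) - cutoff t - cutoff' t * s - 2^-1 * (cutoff'' t * s ^+ 2)| <= 8 * c * `|s| ^+ 3.
Proof.
pose r u := pos (u + s) ^+ 3 - pos u ^+ 3 - 3 * pos u ^+ 2 * s - 3 * pos u * s ^+ 2.
have rs u : `|r u| <= `|s| ^+ 3 by exact: pos_cube_taylor.
rewrite (_ : _ - _ = - (c * diff3 r t)); last first.
  rewrite /cutoff /cutoff' /cutoff'' /diff3 /r.
  by rewrite ![t + s - _]addrAC; field.
rewrite normrN normrM (ger0_norm c0) (_ : 8 * c * _ = c * (8 * `|s| ^+ 3)); last by ring.
rewrite ler_wpM2l//.
rewrite /diff3; move: (rs (t - a)) (rs (t - (a + e))) (rs (t - (a + 2 * e))) (rs (t - (a + 3 * e))).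
move: (r (t - a)) (r (t - (a + e))) (r (t - (a + 2 * e))) (r (t - (a + 3 * e))) => r1 r2 r3 r4.
move: (`|s| ^+ 3) => S.
rewrite !ler_norml => /andP[? ?] /andP[? ?] /andP[? ?] /andP[? ?].
by apply/andP; split; lra.
Qed.

Lemma cutoff_left t : t <= a -> cutoff t = 1.
Proof.
move=> ta; have e0' := ltW e0; rewrite /cutoff /diff3 !pos_le; [|lra..].
by rewrite !expr0n /= !mulr0 !(subr0, addr0) mulr0 subr0.
Qed.

Let cE : c * (6 * e ^+ 3) = 1.
Proof. by rewrite mulVf// gt_eqF// mulr_gt0// exprn_gt0. Qed.

Lemma cutoff_right t : a + 3 * e <= t -> [/\ cutoff t = 0, cutoff' t = 0 & cutoff'' t = 0].
Proof.
move=> ta; have e0' := ltW e0; rewrite /cutoff /cutoff' /cutoff'' /diff3 !pos_ge; [|lra..].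
split.
- by rewrite (_ : _ + _ - _ = 6 * e ^+ 3) ?cE ?subrr//; ring.
- by rewrite (_ : _ + _ - _ = 0) ?mulr0 ?oppr0//; ring.
- by rewrite (_ : _ + _ - _ = 0) ?mulr0 ?oppr0//; ring.
Qed.

Lemma cutoff_itv t : 0 <= cutoff t <= 1.
Proof.
have e0' := ltW e0.
suff : 0 <= diff3 (fun u => pos u ^+ 3) t <= 6 * e ^+ 3.
  move=> /andP[h1 h2]; rewrite /cutoff.
  have := ler_wpM2l c0 h2; rewrite cE => h3.
  have h4 : 0 <= c * diff3 (fun u => pos u ^+ 3) t by rewrite mulr_ge0.
  by apply/andP; split; lra.
case: (leP t a) => ta.
  rewrite /diff3 !pos_le; [|lra..].
  by rewrite !expr0n /= !mulr0 !(subr0, addr0) lexx mulr_ge0// exprn_ge0.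
case: (leP t (a + e)) => te.
  rewrite /diff3 (pos_ge (t := t - a)) ?pos_le; [|lra..].
  rewrite !expr0n /= !mulr0 !(subr0, addr0) exprn_ge0 ?subr_ge0 ?(ltW ta)//=.
  have : (t - a) ^+ 3 <= e ^+ 3 by apply: lerXn2r; rewrite ?nnegrE; lra.
  have : 0 <= e ^+ 3 by rewrite exprn_ge0.
  by lra.
case: (leP t (a + 2 * e)) => t2e.
  rewrite /diff3 (pos_ge (t := t - a)) ?(pos_ge (t := t - (a + e))) ?pos_le; [|lra..].
  rewrite !expr0n /= !mulr0 !(subr0, addr0).
  have v0 : 0 <= t - (a + e) by lra.
  have ve : t - (a + e) <= e by lra.
  rewrite (_ : t - a = t - (a + e) + e); last by ring.
  move: (t - (a + e)) v0 ve => v v0 ve.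
  rewrite (_ : _ - _ = 2 * (v ^+ 2 * (e - v)) + v ^+ 2 * e + 3 * v * e ^+ 2 + e ^+ 3); last by ring.
  have h1 : 0 <= v ^+ 2 * (e - v) by rewrite mulr_ge0 ?sqr_ge0// subr_ge0.
  have h2 : 0 <= v ^+ 2 * e by rewrite mulr_ge0 ?sqr_ge0.
  have h3 : 0 <= v * e ^+ 2 by rewrite mulr_ge0 ?sqr_ge0.
  have h4 : 0 <= e ^+ 3 by rewrite exprn_ge0.
  apply/andP; split; first by lra.
  have -> : 6 * e ^+ 3 = 2 * (v ^+ 2 * (e - v)) + v ^+ 2 * e + 3 * v * e ^+ 2 + e ^+ 3 +
     (e ^+ 3 + 3 * ((e - v) * e ^+ 2) + e * (e - v) ^+ 2 + 2 * ((e - v) ^+ 2 * v)) by ring.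
  have w0 : 0 <= (e - v) * e ^+ 2 by rewrite mulr_ge0 ?sqr_ge0// subr_ge0.
  by rewrite lerDl !addr_ge0// mulr_ge0 ?sqr_ge0// mulr_ge0// sqr_ge0.
case: (leP t (a + 3 * e)) => t3e.
  rewrite /diff3 (pos_ge (t := t - a)) ?(pos_ge (t := t - (a + e))) ?(pos_ge (t := t - (a + 2 * e))) ?pos_le; [|lra..].
  rewrite !expr0n /= !(subr0, addr0).
  have v0 : 0 <= a + 3 * e - t by lra.
  have ve : a + 3 * e - t <= e by lra.
  have -> : t - a = 3 * e - (a + 3 * e - t) by ring.
  have -> : t - (a + e) = 2 * e - (a + 3 * e - t) by ring.
  have -> : t - (a + 2 * e) = e - (a + 3 * e - t) by ring.
  move: (a + 3 * e - t) v0 ve => v v0 ve.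
  rewrite (_ : (3 * e - v) ^+ 3 - 3 * (2 * e - v) ^+ 3 + 3 * (e - v) ^+ 3 = 6 * e ^+ 3 - v ^+ 3); last by ring.
  have h1 : v ^+ 3 <= e ^+ 3 by apply: lerXn2r; rewrite ?nnegrE.
  have h2 : 0 <= v ^+ 3 by rewrite exprn_ge0.
  have h3 : 0 <= e ^+ 3 by rewrite exprn_ge0.
  by apply/andP; split; lra.
have [+ _ _] := cutoff_right (ltW t3e).
rewrite /cutoff => /eqP; rewrite subr_eq0 eq_sym => /eqP h.
have -> : diff3 (fun u => pos u ^+ 3) t = 6 * e ^+ 3.
  apply: (mulfI (x := c)); last by rewrite h cE.
  by apply/eqP => c00; move: cE; rewrite c00 mul0r => /eqP; rewrite eq_sym oner_eq0.
by rewrite lexx andbT mulr_ge0// exprn_ge0.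
Qed.

Lemma cutoff_deriv_bound : exists2 B, 0 <= B & forall t, `|cutoff' t| <= B /\ `|cutoff'' t| <= B.
Proof.
have e0' := ltW e0.
(* The coefficients 1, 3, 3, 1 of the third difference add up to 8; on the
   relevant range 3 u^2 is at most 27 e^2 and 6 u at most 18 e. *)
have F0 : 0 <= 216 * e ^+ 2 + 144 * e by rewrite addr_ge0 ?mulr_ge0 ?exprn_ge0.
exists (c * (216 * e ^+ 2 + 144 * e)); first by rewrite mulr_ge0.
move=> t; case: (leP (a + 3 * e) t) => [/cutoff_right[_ -> ->]|ta].
  by rewrite normr0 mulr_ge0.
rewrite /cutoff' /cutoff'' !normrN !normrM (ger0_norm c0).
have p3 u : u <= 3 * e -> 0 <= pos u <= 3 * e.
  by move=> ue; rewrite pos_ge0 ge_max ue/= mulr_ge0.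
have q3 u : u <= 3 * e -> 0 <= pos u ^+ 2 <= 9 * e ^+ 2.
  move=> /p3/andP[h1 h2]; rewrite sqr_ge0/= (_ : 9 * e ^+ 2 = (3 * e) ^+ 2); last by ring.
  by apply: lerXn2r; rewrite ?nnegrE// mulr_ge0.
have [u1 u2 u3 u4] : [/\ t - a <= 3 * e, t - (a + e) <= 3 * e, t - (a + 2 * e) <= 3 * e &
   t - (a + 3 * e) <= 3 * e] by split; lra.
have e2 : 0 <= e ^+ 2 by rewrite exprn_ge0.
split; rewrite ler_wpM2l// /diff3.
  move: (q3 _ u1) (q3 _ u2) (q3 _ u3) (q3 _ u4).
  move: (pos _ ^+ 2) (pos _ ^+ 2) (pos _ ^+ 2) (pos _ ^+ 2) (e ^+ 2) e2 => x1 x2 x3 x4 E E0.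
  move=> /andP[? ?] /andP[? ?] /andP[? ?] /andP[? ?]; rewrite ler_norml.
  by apply/andP; split; lra.
move: (p3 _ u1) (p3 _ u2) (p3 _ u3) (p3 _ u4).
move: (pos _) (pos _) (pos _) (pos _) (e ^+ 2) e2 => x1 x2 x3 x4 E E0.
move=> /andP[? ?] /andP[? ?] /andP[? ?] /andP[? ?]; rewrite ler_norml.
by apply/andP; split; lra.
Qed.

Lemma measurable_cutoffs : [/\ measurable_fun [set: measurableTypeR R] cutoff,
  measurable_fun [set: measurableTypeR R] cutoff' &
  measurable_fun [set: measurableTypeR R] cutoff''].
Proof.
have mpos u : measurable_fun [set: measurableTypeR R] (fun t : R => pos (t - u)).
  by apply: measurable_maxr; [exact: measurable_funB | exact: measurable_cst].
have md (F : R -> R) : measurable_fun [set: measurableTypeR R] F ->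
  measurable_fun [set: measurableTypeR R] (diff3 (fun u => F (pos u))).
  move=> mF; have mFu u : measurable_fun [set: measurableTypeR R] (fun t : R => F (pos (t - u))).
    exact: measurableT_comp.
  apply: measurable_funB => //; apply: measurable_funD; last exact: measurable_funM.
  by apply: measurable_funB => //; exact: measurable_funM.
split.
- apply: measurable_funB => //; apply: measurable_funM => //.
  by apply: (md (fun u => u ^+ 3)); exact: measurable_funX.
- apply: measurableT_comp => //; apply: measurable_funM => //.
  by apply: (md (fun u => 3 * u ^+ 2)); apply: measurable_funM => //; exact: measurable_funX.
- apply: measurableT_comp => //; apply: measurable_funM => //.
  by apply: (md (fun u => 6 * u)); exact: measurable_funM.
Qed.

End spline.

Section test_function.
Context (R : realType) (K : nat).
Variables (m : 'cV[R]_K) (a e : R).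
Hypotheses (e0 : 0 < e) (K0 : (0 < K)%N).

Let b (x : 'cV[R]_K) k : R := m k ord0 + x k ord0.
Let q x := \sum_k b x k ^+ 2.

Definition radial_cutoff x : R := cutoff a e (sqnorm (m + x)).

Let qE x : sqnorm (m + x) = q x.
Proof. by apply: eq_bigr => k _; rewrite mxE. Qed.

Let D x : 'cV[R]_K := \col_k (2 * cutoff' a e (q x) * b x k).
Let H x : 'M[R]_K := \matrix_(k, l) (4 * cutoff'' a e (q x) * (b x k * b x l)
  + 2 * cutoff' a e (q x) * (k == l)%:R).

Let T := a + 3 * e.
Let beta := 1 + `|T|.
Let beta0 : 0 <= beta. Proof. by rewrite addr_ge0. Qed.

Let b_le x k : q x < T -> `|b x k| <= beta.
Proof.
move=> qT; have bq : b x k ^+ 2 <= q x.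
  by rewrite /q (bigD1 k)//= lerDl sumr_ge0// => i _; rewrite sqr_ge0.
rewrite -(@ler_pXn2r _ 2)// ?nnegrE// real_normK ?num_real//.
apply: le_trans bq _; apply: le_trans (ltW qT) _; apply: le_trans (ler_norm _) _.
rewrite /beta; have := normr_ge0 T; move: `|T| => x0 x00; nra.
Qed.

Let mb k : measurable_fun [set: 'cV[R]_K] (fun x => b x k).
Proof. by apply: measurable_funD => //; exact: measurable_entry. Qed.

Let mq : measurable_fun [set: 'cV[R]_K] q.
Proof. by apply: measurable_sum => k; exact: measurable_funX. Qed.

Let quadrE (x y : 'cV[R]_K) : let u := \sum_k b x k * y k ord0 in let w := \sum_k y k ord0 ^+ 2 in
  quadr (D x) (H x) y = cutoff' a e (q x) * (2 * u + w) + 2 * cutoff'' a e (q x) * u ^+ 2.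
Proof.
move=> u w; rewrite /quadr.
have -> : \sum_k D x k ord0 * y k ord0 = 2 * cutoff' a e (q x) * u.
  by rewrite mulr_sumr; apply: eq_bigr => k _; rewrite mxE mulrA.
have -> : \sum_k \sum_l H x k l * (y k ord0 * y l ord0) =
    4 * cutoff'' a e (q x) * u ^+ 2 + 2 * cutoff' a e (q x) * w.
  have -> : u ^+ 2 = \sum_k \sum_l (b x k * b x l) * (y k ord0 * y l ord0).
    rewrite expr2 mulr_suml; apply: eq_bigr => k _; rewrite mulr_sumr.
    by apply: eq_bigr => l _; ring.
  have -> : w = \sum_k \sum_l (k == l)%:R * (y k ord0 * y l ord0).
    apply: eq_bigr => k _; rewrite (bigD1 k)//= eqxx mul1r big1 ?addr0// => l lk.
    by rewrite eq_sym (negbTE lk) mul0r.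
  rewrite !mulr_sumr -big_split; apply: eq_bigr => k _ /=.
  rewrite !mulr_sumr -big_split; apply: eq_bigr => l _ /=.
  by rewrite mxE; ring.
by field.
Qed.

Let qD (x y : 'cV[R]_K) : q (x + y) = q x + (2 * \sum_k b x k * y k ord0 + \sum_k y k ord0 ^+ 2).
Proof.
rewrite /q mulr_sumr -!big_split; apply: eq_bigr => k _ /=.
by rewrite /b mxE; ring.
Qed.

Let max_coord (y : 'cV[R]_K) : exists mu, [/\ 0 <= mu, forall k, `|y k ord0| <= mu & mu ^+ 3 <= cube_norm y].
Proof.
have [k _ kmax] := @Order.TotalTheory.arg_maxP _ _ _ (Ordinal K0) xpredT (fun k => `|y k ord0|) isT.
exists `|y k ord0|; split => // [l|]; first exact: kmax.
by rewrite /cube_norm (bigD1 k)//= lerDl sumr_ge0// => l _; rewrite exprn_ge0.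
Qed.

Let kR : R := K%:R.

Let sum_bound (F G : 'I_K -> R) (f g : R) : (forall k, `|F k| <= f) -> (forall k, `|G k| <= g) ->
  `|\sum_k F k * G k| <= kR * (f * g).
Proof.
move=> Ff Gg; apply: le_trans (ler_norm_sum _ _ _) _.
apply: (@le_trans _ _ (\sum_(k < K) f * g)).
  by apply: ler_sum => k _; rewrite normrM ler_pM.
by rewrite sumr_const card_ord -mulr_natl.
Qed.

(** Beyond the level [a + 3 * e] the cut-off and its derivatives vanish, so the
    growth of the squared norm and of its gradient is only seen on a bounded
    set. For increments larger than 1 the cubic term dominates trivially; for
    smaller ones the expansion of the cut-off is composed with the exact
    quadratic expansion of the squared norm. *)
Lemma radial_cutoff_smooth : exists2 C, 0 <= C & smooth C radial_cutoff.
Proof.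
have [B B0 BP] := cutoff_deriv_bound a e0.
have [mc mc' mc''] := measurable_cutoffs a e.
pose c := (6 * e ^+ 3)^-1.
have c0 : 0 <= c by rewrite invr_ge0 mulr_ge0// exprn_ge0// ltW.
have k0 : 0 <= kR by rewrite ler0n.
pose ka := 2 * kR * beta + kR.
have ka0 : 0 <= ka by rewrite addr_ge0// !mulr_ge0.
pose C := 8 * c * ka ^+ 3 + B * kR * (4 * kR * beta + kR) + 1 + B * ka + 2 * B * (kR * beta) ^+ 2.
have C0 : 0 <= C by rewrite /C !addr_ge0// ?mulr_ge0// ?exprn_ge0// ?addr_ge0// ?mulr_ge0// ?exprn_ge0//.
exists C => //; exists D, H; split.
- split.
    rewrite (_ : radial_cutoff = cutoff a e \o q); first exact: measurableT_comp.
    by apply/funext => x; rewrite /radial_cutoff qE.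
  exists 1 => x; have /andP[h1 h2] := cutoff_itv a e0 (sqnorm (m + x)).
  by rewrite /radial_cutoff ger0_norm.
- move=> k; split.
    under eq_fun do rewrite mxE; apply: measurable_funM => //; apply: measurable_funM => //.
    exact: measurableT_comp.
  exists (2 * B * beta) => x; rewrite mxE !normrM ger0_norm//.
  have [[bB _] bb] := (BP (q x), @b_le x k).
  case: (ltP (q x) T) => qT; first by rewrite ler_pM ?bb// ?mulr_ge0// ler_wpM2l.
  by have [_ -> _] := cutoff_right e0 qT; rewrite normr0 mulr0 mul0r !mulr_ge0.
- move=> k l; split.
    under eq_fun do rewrite mxE; apply: measurable_funD.
      apply: measurable_funM; last exact: measurable_funM.
      by apply: measurable_funM => //; exact: measurableT_comp.
    by apply: measurable_funM => //; apply: measurable_funM => //; exact: measurableT_comp.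
  exists (4 * B * (beta * beta) + 2 * B) => x; rewrite mxE.
  have [b1 b2] := BP (q x); have [bb1 bb2] := (@b_le x k, @b_le x l).
  case: (ltP (q x) T) => qT; last first.
    have [_ -> ->] := cutoff_right e0 qT; rewrite !(mulr0, mul0r) addr0 normr0.
    by rewrite addr_ge0 ?mulr_ge0.
  apply: le_trans (ler_normD _ _) _; apply: lerD; rewrite !normrM.
    by rewrite (ger0_norm (_ : 0 <= 4))// ler_pM ?mulr_ge0// ?ler_wpM2l// ler_pM ?bb1 ?bb2.
  rewrite (ger0_norm (_ : 0 <= 2))//; case: eqP => _; rewrite ?normr1 ?normr0 ?mulr1 ?mulr0 ?mulr_ge0//.
  by rewrite ler_wpM2l.
move=> x y; have [mu [mu0 ymu mu3]] := max_coord y.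
apply: le_trans (ler_wpM2l C0 mu3) => {mu3}.
rewrite quadrE /radial_cutoff !qE qD.
set u := \sum_k _ * _; set w := \sum_k _ ^+ 2.
set s := 2 * u + w; set Q := q x.
have w0 : 0 <= w by apply: sumr_ge0 => k _; rewrite sqr_ge0.
have wmu : w <= kR * (mu * mu).
  apply: le_trans (ler_norm _) _; rewrite /w; under eq_bigr do rewrite expr2.
  exact: sum_bound.
have [B1 B2] := BP Q.
have tay := cutoff_taylor a e0 Q s.
have [h0 h1] := (cutoff_itv a e0 Q, cutoff_itv a e0 (Q + s)).
have ts (v : R) : `|v| <= kR * (beta * mu) -> mu <= 1 -> 2 * `|v| + w <= ka * mu.
  move=> vb mu1; rewrite /ka.
  have : kR * (mu * mu) <= kR * (mu * 1) by rewrite !ler_wpM2l.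
  by lra.
have big (X : R) : 0 <= X -> mu <= 1 -> X <= ka * mu -> 8 * c * X ^+ 3 <= C * mu ^+ 3.
  move=> X0 mu1 Xk; have X3 : X ^+ 3 <= ka ^+ 3 * mu ^+ 3.
    by rewrite -exprMn; apply: lerXn2r; rewrite ?nnegrE// mulr_ge0.
  apply: le_trans (ler_wpM2l _ X3) _; first by rewrite mulr_ge0.
  rewrite mulrA ler_wpM2r ?exprn_ge0// /C -!addrA lerDl.
  by rewrite !addr_ge0// ?mulr_ge0// ?exprn_ge0// ?addr_ge0// ?mulr_ge0// ?exprn_ge0//.
case: (ltP Q T) => QT; last first.
  have [hQ hQ' hQ''] := cutoff_right e0 QT.
  rewrite hQ hQ' hQ'' !(mulr0, mul0r, addr0, subr0).
  case: (ltP (Q + s) T) => QsT; last first.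
    by have [-> _ _] := cutoff_right e0 QsT; rewrite normr0 mulr_ge0// exprn_ge0.
  case: (leP mu 1) => mu1; last first.
    have C1 : 1 <= C.
      rewrite [leRHS](_ : _ = 8 * c * ka ^+ 3 + B * kR * (4 * kR * beta + kR) + B * ka +
        2 * B * (kR * beta) ^+ 2 + 1); last by rewrite /C; ring.
      rewrite lerDr.
      by rewrite !addr_ge0// ?mulr_ge0// ?exprn_ge0// ?addr_ge0// ?mulr_ge0// ?exprn_ge0//.
    have mu31 : 1 <= mu ^+ 3 by rewrite exprn_ege1// ltW.
    by rewrite ger0_norm; [nra | lra].
  have qy : q (x + y) < T by rewrite qD.
  pose u' := \sum_k b (x + y) k * y k ord0.
  have u'b : `|u'| <= kR * (beta * mu) by apply: sum_bound => // k; exact: b_le.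
  have sE : s = 2 * u' - w.
    rewrite /s /u' /u /w !mulr_sumr -sumrB -big_split; apply: eq_bigr => k _ /=.
    by rewrite /b mxE; ring.
  have sk : `|s| <= ka * mu.
    apply: le_trans (ts _ u'b mu1); rewrite sE; apply: le_trans (ler_normB _ _) _.
    by rewrite normrM (ger0_norm w0) (ger0_norm (_ : 0 <= 2)).
  move: tay; rewrite hQ hQ' hQ'' !(mulr0, mul0r, addr0, subr0) => /le_trans; apply.
  exact: big.
have ub : `|u| <= kR * (beta * mu) by apply: sum_bound => // k; exact: b_le.
have sb : `|s| <= 2 * `|u| + w.
  by apply: le_trans (ler_normD _ _) _; rewrite normrM (ger0_norm w0) (ger0_norm (_ : 0 <= 2)).
have bm0 : 0 <= kR * (beta * mu) by rewrite !mulr_ge0.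
have u2 : u ^+ 2 <= (kR * (beta * mu)) ^+ 2.
  by rewrite -(real_normK (num_real u)); apply: lerXn2r; rewrite ?nnegrE.
case: (leP mu 1) => mu1.
  have sk := le_trans sb (ts _ ub mu1).
  have wle : w <= kR * mu by apply: le_trans wmu _; rewrite ler_wpM2l// ler_piMr.
  have rem2 : `|2^-1 * (cutoff'' a e Q * (s ^+ 2 - 4 * u ^+ 2))| <= B * kR * (4 * kR * beta + kR) * mu ^+ 3.
    rewrite (_ : s ^+ 2 - 4 * u ^+ 2 = w * (4 * u + w)); last by rewrite /s; ring.
    rewrite !normrM (ger0_norm w0) (ger0_norm (_ : 0 <= 2^-1))//.
    have h4 : `|4 * u + w| <= (4 * kR * beta + kR) * mu.
      apply: le_trans (ler_normD _ _) _; rewrite normrM (ger0_norm w0) (ger0_norm (_ : 0 <= 4))//.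
      by move: ub wle; lra.
    have hw : w * `|4 * u + w| <= kR * (mu * mu) * ((4 * kR * beta + kR) * mu) by apply: ler_pM.
    have hB : `|cutoff'' a e Q| * (w * `|4 * u + w|) <= B * (kR * (mu * mu) * ((4 * kR * beta + kR) * mu)).
      by apply: ler_pM => //; rewrite mulr_ge0.
    have h0' : 0 <= `|cutoff'' a e Q| * (w * `|4 * u + w|) by rewrite !mulr_ge0.
    rewrite (_ : B * kR * _ * _ = B * (kR * (mu * mu) * ((4 * kR * beta + kR) * mu))); last by ring.
    by lra.
  rewrite (_ : _ - _ = (cutoff a e (Q + s) - cutoff a e Q - cutoff' a e Q * s - 2^-1 * (cutoff'' a e Q * s ^+ 2))
    + 2^-1 * (cutoff'' a e Q * (s ^+ 2 - 4 * u ^+ 2))); last by field.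
  apply: le_trans (ler_normD _ _) _; apply: le_trans (lerD tay rem2) _.
  have X3 : `|s| ^+ 3 <= ka ^+ 3 * mu ^+ 3.
    by rewrite -exprMn; apply: lerXn2r; rewrite ?nnegrE// mulr_ge0.
  have m3 : 0 <= mu ^+ 3 by rewrite exprn_ge0.
  have h8 : 8 * c * `|s| ^+ 3 <= 8 * c * (ka ^+ 3 * mu ^+ 3) by rewrite ler_wpM2l// mulr_ge0.
  have r1 : 0 <= B * ka * mu ^+ 3 by rewrite !mulr_ge0.
  have r2 : 0 <= 2 * B * (kR * beta) ^+ 2 * mu ^+ 3 by rewrite !mulr_ge0// exprn_ge0// mulr_ge0.
  rewrite /C; move: h8 r1 r2 m3; rewrite /c; lra.
have mu1' := ltW mu1.
have m31 : 1 <= mu ^+ 3 by rewrite exprn_ege1.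
have m13 : mu <= mu ^+ 3 by rewrite -[leLHS]expr1 ler_weXn2l.
have m23 : mu ^+ 2 <= mu ^+ 3 by rewrite ler_weXn2l.
have hd : `|cutoff a e (Q + s) - cutoff a e Q| <= 1.
  by rewrite ler_norml; apply/andP; move: h0 h1 => /andP[? ?] /andP[? ?]; split; lra.
have p1 : `|cutoff' a e Q * s| <= B * ka * mu ^+ 3.
  rewrite normrM -mulrA; apply: ler_pM => //; apply: le_trans sb _.
  have kb : 0 <= kR * beta by rewrite mulr_ge0.
  have := ler_wpM2l kb m13; have := ler_wpM2l k0 m23.
  by move: ub wmu; rewrite /ka expr2; lra.
have p2 : `|2 * cutoff'' a e Q * u ^+ 2| <= 2 * B * (kR * beta) ^+ 2 * mu ^+ 3.
  rewrite normrM normrM (ger0_norm (_ : 0 <= 2))// (ger0_norm (sqr_ge0 u)) -mulrA -[leRHS]mulrA -mulrA.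
  rewrite ler_wpM2l//; apply: ler_pM => //; first exact: sqr_ge0.
  apply: le_trans u2 _; rewrite mulrA exprMn ler_wpM2l//.
  by rewrite exprn_ge0// mulr_ge0.
rewrite (_ : _ - _ = cutoff a e (Q + s) - cutoff a e Q - cutoff' a e Q * s -
  2 * cutoff'' a e Q * u ^+ 2); last by ring.
apply: le_trans (ler_normB _ _) _; apply: le_trans (lerD (ler_normB _ _) p2) _.
apply: le_trans (lerD (lerD hd p1) (lexx _)) _.
have r1 : 0 <= 8 * c * ka ^+ 3 * mu ^+ 3 by rewrite !mulr_ge0// exprn_ge0.
have r2 : 0 <= B * kR * (4 * kR * beta + kR) * mu ^+ 3.
  by rewrite !mulr_ge0// ?addr_ge0// ?mulr_ge0// exprn_ge0.
by rewrite /C; move: r1 r2 m31; lra.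
Qed.

End test_function.

(** * Whitening and continuity of the quadratic form *)

Section linear_algebra.
Context (R : realType).

Definition qform n (M : 'M[R]_n) (v : 'cV[R]_n) : R := (v^T *m M *m v) ord0 ord0.

Lemma dotE n (u v : 'cV[R]_n) : (u^T *m v) ord0 ord0 = \sum_i u i ord0 * v i ord0.
Proof. by rewrite mxE; apply: eq_bigr => i _; rewrite mxE. Qed.

Lemma sqnormE n (v : 'cV[R]_n) : (v^T *m v) ord0 ord0 = sqnorm v.
Proof. by rewrite dotE; apply: eq_bigr => i _; rewrite expr2. Qed.

Lemma sqnorm_eq0 n (v : 'cV[R]_n) : (sqnorm v == 0) = (v == 0).
Proof.
apply/idP/eqP => [|->]; last by apply/eqP/big1 => i _; rewrite mxE expr0n.
rewrite psumr_eq0 => [/allP h|i _]; last exact: sqr_ge0.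
apply/matrixP => i j; rewrite (ord1 j) mxE; have := h i (mem_index_enum i).
by rewrite sqrf_eq0 => /eqP.
Qed.

Lemma posdef_conj n (S L : 'M[R]_n) : posdef S -> L \in unitmx -> posdef (L *m S *m L^T).
Proof.
move=> [St Sp] Lu; split; first by rewrite !trmx_mul trmxK St mulmxA.
move=> v v0; have := Sp (L^T *m v); rewrite trmx_mul trmxK !mulmxA; apply.
apply: contraNneq v0 => Lv; rewrite -(mulKmx (x := L^T) _ v) ?unitmx_tr//.
by rewrite Lv mulmx0.
Qed.

(** Cholesky factorisation: the first row and column are eliminated by a block matrix. *)
Lemma whiten n (S : 'M[R]_n) : posdef S -> exists B : 'M[R]_n, B *m S *m B^T = 1%:M.
Proof.
elim: n S => [|n IH] S Spd.
  by exists 1%:M; apply/matrixP => -[].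
pose S' : 'M[R]_(1 + n) := S.
have S'pd : posdef S' by [].
pose a := ulsubmx S'; pose b := dlsubmx S'.
have S'E : S' = block_mx a b^T b (drsubmx S').
  rewrite -[LHS]submxK /a /b trmx_dlsub; congr block_mx.
  by case: S'pd => -> _.
pose a0 := S' ord0 ord0.
have aE : a = a0%:M.
  by apply/matrixP => i j; rewrite (ord1 i) (ord1 j) !mxE /= mulr1n; congr (S' _ _); apply/val_inj.
have a_gt0 : 0 < a0.
  have := S'pd.2 (delta_mx ord0 ord0); rewrite trmx_delta -rowE -colE !mxE; apply.
  by apply/eqP => /matrixP/(_ ord0 ord0); rewrite !mxE !eqxx => /eqP; rewrite oner_eq0.
have an0 : a0 != 0 by rewrite gt_eqF.
pose L : 'M[R]_(1 + n) := block_mx 1%:M 0 (- a0^-1 *: b) 1%:M.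
have Lu : L \in unitmx by rewrite unitmxE det_lblock !det1 mulr1 unitr1.
pose C := drsubmx S' - a0^-1 *: (b *m b^T).
have LSL : L *m S' *m L^T = block_mx a 0 0 C.
  rewrite S'E /L tr_block_mx !mulmx_block !trmx1 !trmx0 !mul1mx !mul0mx !mulmx0 !addr0 !mulmx1.
  rewrite aE [(- a0^-1 *: b)^T]linearZ /= mul_scalar_mx mul_mx_scalar scalerA mulrN mulfV// scaleN1r.
  rewrite addNr scalerA mulrN mulfV// scaleN1r addNr mul0mx add0r -scalemxAl scaleNr.
  by rewrite /C [X in block_mx _ _ _ X = _]addrC.
have Cpd : posdef C.
  have [Lt Lp] := posdef_conj S'pd Lu; rewrite LSL in Lt Lp; split.
    by move: Lt; rewrite tr_block_mx => /eq_block_mx[].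
  move=> u u0; have := Lp (col_mx 0 u).
  rewrite tr_col_mx trmx0 mul_row_block mul_row_col !mul0mx !mulmx0 !add0r; apply.
  apply: contraNneq u0 => h; apply/eqP.
  by have /eq_col_mx[] : col_mx (0 : 'cV[R]_1) u = col_mx 0 0 by rewrite h col_mx0.
have [B' B'E] := IH _ Cpd.
pose D : 'M[R]_(1 + n) := block_mx (Num.sqrt a0)^-1%:M 0 0 B'.
exists (D *m L).
rewrite trmx_mul !mulmxA -(mulmxA D L S) -(mulmxA D (L *m S)) LSL.
have DT : D^T = block_mx (Num.sqrt a0)^-1%:M^T 0^T 0^T B'^T by exact: tr_block_mx.
rewrite DT /D !mulmx_block !trmx0 !mul0mx !mulmx0 !addr0 !add0r.
apply: (etrans (@mulmx_block _ 1 n 1 n 1 n _ _ _ _ _ _ _ _)).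
rewrite !mul0mx !mulmx0 !addr0 !add0r B'E aE tr_scalar_mx.
rewrite -!scalar_mxM mulrAC -invfM -expr2 sqr_sqrtr ?(ltW a_gt0)// mulVf//.
by rewrite -scalar_mx_block.
Qed.

(** The reflection exchanging [u] and [p], along [u - p]. *)
Lemma householder n (u p : 'cV[R]_n) : sqnorm u = sqnorm p ->
  exists Q : 'M[R]_n, Q *m Q^T = 1%:M /\ Q *m u = p.
Proof.
move=> up; case: (eqVneq u p) => [<-|neq_up].
  by exists 1%:M; rewrite trmx1 !mul1mx.
pose w := u - p.
have w0 : sqnorm w != 0 by rewrite sqnorm_eq0 subr_eq0.
pose c := 2 / sqnorm w.
exists (1%:M - c *: (w *m w^T)).
have ww (z : 'cV[R]_n) : w *m w^T *m z = (w^T *m z) ord0 ord0 *: w.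
  by rewrite -mulmxA {1}[w^T *m z]mx11_scalar mul_mx_scalar.
have PP : w *m w^T *m (w *m w^T) = sqnorm w *: (w *m w^T).
  by rewrite mulmxA ww sqnormE -scalemxAl.
have wu : 2 * (w^T *m u) ord0 ord0 = sqnorm w.
  have -> : sqnorm w = sqnorm u - 2 * (\sum_i p i ord0 * u i ord0) + sqnorm p.
    rewrite mulr_sumr -sumrB -big_split; apply: eq_bigr => i _ /=.
    by rewrite !mxE; ring.
  rewrite -up dotE (_ : \sum_i w i ord0 * u i ord0 = sqnorm u - \sum_i p i ord0 * u i ord0).
    by ring.
  by rewrite -sumrB; apply: eq_bigr => i _; rewrite !mxE; ring.
have QT : (1%:M - c *: (w *m w^T))^T = 1%:M - c *: (w *m w^T).
  by apply/matrixP => i j; rewrite !mxE eq_sym; congr (_ - c * _); apply: eq_bigr => l _; rewrite !mxE mulrC.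
split.
  rewrite QT mulmxBl mul1mx mulmxBr mulmx1 -scalemxAl -scalemxAr PP !scalerA.
  rewrite (_ : c * c * sqnorm w = c + c); last by rewrite /c; field.
  by rewrite scalerDl opprB addrK subrK.
rewrite mulmxBl mul1mx -scalemxAl ww scalerA (_ : c * _ = 1).
  by rewrite scale1r /w opprB addrC subrK.
by rewrite /c -wu mulrAC mulfV// wu.
Qed.

Lemma whiten_invmx n (S B : 'M[R]_n) : B *m S *m B^T = 1%:M ->
  S \in unitmx /\ invmx S = B^T *m B.
Proof.
move=> BSB; have SBB : S *m (B^T *m B) = 1%:M.
  by rewrite mulmxA; apply: mulmx1C; rewrite mulmxA.
have [Su _] := mulmx1_unit SBB; split => //.
by rewrite -[RHS]mul1mx -(mulVmx Su) -mulmxA SBB mulmx1.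
Qed.

(** One may whiten so that a prescribed vector goes to the first axis; this is
    where the non-centrality parameter appears. *)
Lemma whiten_to_axis n (S : 'M[R]_n) (u : 'cV[R]_n) : (0 < n)%N -> posdef S ->
  exists B : 'M[R]_n, B *m S *m B^T = 1%:M /\
    B *m u = chi2_mean n (qform (invmx S) u).
Proof.
move=> n0 /whiten[B0 B0E].
have E : sqnorm (B0 *m u) = qform (invmx S) u.
  by rewrite (whiten_invmx B0E).2 -sqnormE trmx_mul /qform !mulmxA.
have q0 : 0 <= qform (invmx S) u by rewrite -E; apply: sumr_ge0 => i _; exact: sqr_ge0.
have [Q [QQ Qu]] := householder (etrans E (esym (sqnorm_chi2_mean n0 q0))).
exists (Q *m B0); rewrite -[Q *m B0 *m u]mulmxA Qu; split => //.
by rewrite trmx_mul !mulmxA -(mulmxA Q B0 S) -(mulmxA Q (B0 *m S)) B0E mulmx1.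
Qed.

Lemma continuous_bigsum (T : topologicalType) (I : Type) (s : seq I) (F : I -> T -> R) :
  (forall i, continuous (F i)) -> continuous (fun x => \sum_(i <- s) F i x).
Proof.
move=> cF; elim: s => [|i s IH] x.
  by under eq_fun do rewrite big_nil; exact: cvg_cst.
by under eq_fun do rewrite big_cons; apply: cvgD; [exact: cF | exact: IH].
Qed.

Lemma continuous_bigprod (T : topologicalType) (I : Type) (s : seq I) (F : I -> T -> R) :
  (forall i, continuous (F i)) -> continuous (fun x => \prod_(i <- s) F i x).
Proof.
move=> cF; elim: s => [|i s IH] x.
  by under eq_fun do rewrite big_nil; exact: cvg_cst.
by under eq_fun do rewrite big_cons; apply: cvgM; [exact: cF | exact: IH].
Qed.

Lemma continuous_det (T : topologicalType) n (G : T -> 'M[R]_n) :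
  (forall i j, continuous (fun x => G x i j)) -> continuous (fun x => \det (G x)).
Proof.
move=> cG; apply: continuous_bigsum => s x.
by apply: cvgM; [exact: cvg_cst | apply: continuous_bigprod => i; exact: cG].
Qed.

(** The inverse is the adjugate divided by the determinant, hence depends
    continuously on the entries. *)
Lemma invmx_near n (S : 'M[R]_n) (e : R) : S \in unitmx -> 0 < e ->
  exists2 eta, 0 < eta & forall M : 'M[R]_n, (forall i j, `|M i j - S i j| <= eta) ->
    M \in unitmx /\ forall i j, `|invmx M i j - invmx S i j| <= e.
Proof.
move=> Su e0.
have cent i j : continuous (fun M : 'M[R]_n => M i j) by exact: coord_continuous.
have cdet : continuous (fun M : 'M[R]_n => \det M) by apply: continuous_det.
have dS : \det S != 0 by rewrite -unitfE -unitmxE.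
have cadj i j : continuous (fun M : 'M[R]_n => (\adj M) i j).
  rewrite (_ : (fun _ => _) = fun M : 'M[R]_n => (-1) ^+ (j + i) * \det (row' j (col' i M))).
    have cd : continuous (fun M : 'M[R]_n => \det (row' j (col' i M))).
      by apply: continuous_det => k l; under eq_fun do rewrite !mxE; exact: cent.
    by move=> M; exact: (cvgM (cvg_cst _) (cd M)).
  by apply/funext => M; rewrite mxE.
have cinv i j : (\det M)^-1 * (\adj M) i j @[M --> S] --> (\det S)^-1 * (\adj S) i j.
  exact: (cvgM (cvgV dS (cdet S)) (cadj i j S)).
have nunit : \forall M \near S, \det M != 0.
  have := cdet S; move=> /cvgr_neq0; apply => //.
have ninv1 i j : \forall M \near S,
    `|(\det M)^-1 * (\adj M) i j - (\det S)^-1 * (\adj S) i j| <= e.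
  have := cinv i j; move=> /cvgrPdist_le/(_ _ e0); apply: filterS => M.
  by rewrite distrC.
have fS : Filter (nbhs S) by exact: nbhs_filter.
have ninv := filter_forall fS (fun i => filter_forall fS (ninv1 i)).
have nbth := @filterI _ _ fS _ _ nunit ninv.
have [r /= r0 rP] := (nbhs_ballP S _).1 nbth.
exists (r / 2); first by rewrite divr_gt0.
move=> M MS; have [] := rP M.
  split => // i j; rewrite /ball /= distrC; apply: le_lt_trans (MS i j) _.
  by rewrite ltr_pdivrMr// ltr_pMr// ltr1n.
move=> dM inv; have Mu : M \in unitmx by rewrite unitmxE unitfE.
have invE (N : 'M[R]_n) k l : N \in unitmx -> invmx N k l = (\det N)^-1 * (\adj N) k l.
  by move=> Nu; rewrite /invmx Nu mxE.
by split => // i j; rewrite !invE//; exact: inv.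
Qed.

(** The quadratic form is a polynomial in the entries of the inverse and of the
    vector, so it is uniformly continuous as long as the vector stays bounded. *)
Lemma qform_inv_near n (S : 'M[R]_n) (C e : R) : S \in unitmx -> 0 <= C -> 0 < e ->
  exists2 eta, 0 < eta & forall (M : 'M[R]_n) (u v : 'cV[R]_n),
    (forall i j, `|M i j - S i j| <= eta) -> (forall i, `|v i ord0| <= C) ->
    (forall i, `|u i ord0 - v i ord0| <= eta) ->
    M \in unitmx /\ `|qform (invmx M) u - qform (invmx S) v| <= e.
Proof.
move=> Su C0 e0.
pose N0 : R := \sum_i \sum_j `|invmx S i j|.
have N00 : 0 <= N0 by apply: sumr_ge0 => i _; apply: sumr_ge0.
have Nle i j : `|invmx S i j| <= N0.
  by rewrite /N0 (bigD1 i)//= (bigD1 j)//= -addrA lerDl addr_ge0// sumr_ge0// => k _; exact: sumr_ge0.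
pose A : R := (C + 1) ^+ 2 + N0 * (2 * C + 1).
have A0 : 0 < A + 1 by rewrite ltr_wpDl// /A addr_ge0 ?sqr_ge0// mulr_ge0// addr_ge0// mulr_ge0.
pose k : R := n%:R ^+ 2 + 1.
have k0 : 0 < k by rewrite ltr_wpDl// sqr_ge0.
pose e1 := Num.min 1 (e / (k * (A + 1))).
have e10 : 0 < e1 by rewrite lt_min ltr01 divr_gt0// mulr_gt0.
have [eta1 eta10 etaP] := invmx_near Su e10.
exists (Num.min eta1 e1); first by rewrite lt_min eta10.
move=> M u v MS vC uv.
have [Mu invP] : M \in unitmx /\ forall i j, `|invmx M i j - invmx S i j| <= e1.
  by apply: etaP => i j; apply: le_trans (MS i j) _; rewrite ge_min lexx.
have uv1 i : `|u i ord0 - v i ord0| <= e1 by apply: le_trans (uv i) _; rewrite ge_min lexx orbT.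
have e11 : e1 <= 1 by rewrite ge_min lexx.
split => //.
have qE (N : 'M[R]_n) (z : 'cV[R]_n) : qform N z = \sum_i \sum_j z i ord0 * N i j * z j ord0.
  rewrite /qform mxE exchange_big; apply: eq_bigr => j _ /=; rewrite mxE mulr_suml.
  by apply: eq_bigr => i _; rewrite mxE.
have uC i : `|u i ord0| <= C + 1.
  rewrite -(subrK (v i ord0) (u i ord0)) addrC; apply: le_trans (ler_normD _ _) _.
  by apply: lerD => //; exact: le_trans (uv1 i) e11.
have term i j : `|u i ord0 * invmx M i j * u j ord0 - v i ord0 * invmx S i j * v j ord0| <= A * e1.
  rewrite (_ : _ - _ = u i ord0 * (invmx M i j - invmx S i j) * u j ord0 +
     invmx S i j * ((u i ord0 - v i ord0) * u j ord0 + v i ord0 * (u j ord0 - v j ord0))); last by ring.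
  apply: le_trans (ler_normD _ _) _; rewrite /A [leRHS]mulrDl; apply: lerD.
    by rewrite !normrM mulrAC expr2; apply: ler_pM => //; apply: ler_pM.
  rewrite normrM -mulrA; apply: ler_pM => //.
  apply: le_trans (ler_normD _ _) _; rewrite !normrM.
  have h1 : `|u i ord0 - v i ord0| * `|u j ord0| <= e1 * (C + 1) by apply: ler_pM.
  have h2 : `|v i ord0| * `|u j ord0 - v j ord0| <= C * e1 by apply: ler_pM.
  by lra.
rewrite !qE -sumrB; apply: le_trans (ler_norm_sum _ _ _) _.
apply: (@le_trans _ _ (\sum_(i < n) \sum_(j < n) A * e1)).
  apply: ler_sum => i _; rewrite -sumrB; apply: le_trans (ler_norm_sum _ _ _) _.
  by apply: ler_sum => j _; exact: term.
rewrite (_ : \sum_(i < n) _ = n%:R ^+ 2 * (A * e1)); last first.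
  by rewrite !sumr_const !card_ord -[in LHS]mulrnA -[in LHS]mulr_natl natrM.
have Ae : A * e1 <= (A + 1) * e1 by rewrite ler_wpM2r ?lerDl// ltW.
have kA : k * ((A + 1) * e1) <= e.
  have : e1 <= e / (k * (A + 1)) by rewrite ge_min lexx orbT.
  by rewrite ler_pdivlMr ?mulr_gt0// => h; rewrite mulrA mulrC.
apply: le_trans kA; have n20 : 0 <= n%:R ^+ 2 :> R by rewrite sqr_ge0.
apply: le_trans (ler_wpM2l n20 Ae) _; rewrite ler_wpM2r ?mulr_ge0 ?(ltW A0) ?(ltW e10)//.
by rewrite lerDl.
Qed.

End linear_algebra.

(** * Distribution functions of nearly Gaussian quadratic forms *)

Lemma Rint_bool d (T : measurableType d) (R : realType) (P : probability T R) (p : T -> bool) :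
  measurable_fun [set: T] p -> \int[P]_x (p x)%:R = fine (P [set x | p x]).
Proof.
move=> mp; have mA : measurable [set x | p x] by rewrite -[X in measurable X]setTI; exact: mp.
rewrite /Rintegral -(setIT [set x | p x]) -integral_indic//; congr fine.
apply: eq_integral => x _; rewrite indicE; congr (_%:R%:E).
case: (boolP (p x)) => px; first by rewrite mem_set.
by rewrite memNset//= => px'; rewrite px' in px.
Qed.

Lemma measurable_sqnorm_shift (R : realType) K (m : 'cV[R]_K) :
  measurable_fun [set: 'cV[R]_K] (fun z => sqnorm (m + z)).
Proof.
have ms : measurable_fun [set: 'cV[R]_K] (@sqnorm R K) by exact: measurable_funP.
exact: (measurableT_comp ms (measurable_addl_cV m)).
Qed.

(** The distribution function of the limit law, with the mean carried by the
    argument instead of the Gaussian measure: see [noncentral_chi2E]. *)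
Definition radial_cdf (R : realType) K (m : 'cV[R]_K) (t : R) : R :=
  fine (gauss K 1 [set z | sqnorm (m + z) <= t]).

Lemma noncentral_chi2E (R : realType) K (d t : R) :
  noncentral_chi2 K d `]-oo, t]%classic = (radial_cdf (chi2_mean K d) t)%:E.
Proof.
set m := chi2_mean K d.
have mA : measurable [set x : 'cV[R]_K | sqnorm x <= t].
  rewrite -[X in measurable X]setTI.
  apply: (@measurable_fun_le _ _ _ setT (@sqnorm R K) (cst t)) => //.
transitivity (normal_cV m [set x : 'cV[R]_K | sqnorm x <= t]).
  congr (normal_cV m _); apply/seteqP; split => x /=; by rewrite in_itv.
rewrite -gauss_translate// /radial_cdf fineK.
  by congr (gauss K 1 _); apply/seteqP; split => z /=; rewrite addrC.
apply: fin_num_measure; rewrite -[X in measurable X]setTI.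
by apply: (@measurable_fun_le _ _ _ setT (fun z => sqnorm (m + z)) (cst t)) => //; exact: measurable_sqnorm_shift.
Qed.

Section sandwich.
Context d d' (T : measurableType d) (S : measurableType d') (R : realType).
Variables (P : probability T R) (n K : nat) (Y : 'I_n -> T -> S) (x0 : S) (Q : probability S R).
Hypothesis mY : forall i, measurable_fun [set: T] (Y i).
Hypothesis indY : forall B : 'I_n -> set S, (forall i, measurable (B i)) ->
  P [set w | forall i, B i (Y i w)] = (\prod_(i < n) P (Y i @^-1` B i))%E.
Hypothesis lawY : forall i D, measurable D -> P (Y i @^-1` D) = Q D.
Variables (zeta : S -> 'cV[R]_K) (M : R).
Hypothesis mz : forall k, measurable_fun [set: S] (fun y => zeta y k ord0).
Hypothesis zM : forall y k, `|zeta y k ord0| <= M.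
Hypothesis z1 : forall k, \int[Q]_y zeta y k ord0 = 0.
Hypothesis z2 : forall k l, \int[Q]_y (zeta y k ord0 * zeta y l ord0) = (k == l)%:R.
Variable a : 'I_n -> R.
Hypothesis an0 : forall i, a i != 0.
Hypothesis a1 : \sum_i a i ^+ 2 = 1.
Hypothesis n0 : (0 < n)%N.

Local Notation W w := (\sum_i a i *: zeta (Y i w)).
Variable m : 'cV[R]_K.

Lemma lindeberg_radial C t e : 0 <= C -> smooth C (radial_cutoff m t e) ->
  `|\int[P]_w radial_cutoff m t e (W w) - \int[gauss K 1]_z radial_cutoff m t e z|
  <= C * (K%:R * ((M ^+ 3 + 2) * \sum_i `|a i| ^+ 3)).
Proof.
move=> C0 sp; have n1 : (n.-1.+1 = n)%N by rewrite prednK.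
have pn : (n.-1 < n)%N by rewrite n1.
have big (V : nmodType) (F : 'I_n -> V) : \sum_(i < n | (i < n.-1.+1)%N) F i = \sum_i F i.
  by apply: eq_bigl => i; rewrite n1 ltn_ord.
have avgE : gauss_avg 1 (radial_cutoff m t e) 0 = \int[gauss K 1]_z radial_cutoff m t e z.
  by apply: eq_Rintegral => z _; rewrite add0r.
have sumE : (fun w => radial_cutoff m t e (partial_sum Y zeta a n.-1.+1 w)) =
    (fun w => radial_cutoff m t e (W w)).
  by apply/funext => w; rewrite /partial_sum big.
have := lindeberg x0 mY indY lawY mz zM z1 z2 an0 C0 pn sp.
by rewrite !big a1 sqrtr1 avgE sumE.
Qed.

Lemma gauss_radial_cutoff t e : 0 < e ->
  radial_cdf m t <= \int[gauss K 1]_z radial_cutoff m t e z <= radial_cdf m (t + 3 * e).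
Proof.
move=> e0; have mp u : measurable_fun [set: 'cV[R]_K] (fun z => sqnorm (m + z) <= u).
  by apply: measurable_fun_ler => //; exact: measurable_sqnorm_shift.
have bc : bmf (radial_cutoff m t e).
  split; last by exists 1 => z; have /andP[h1 h2] := cutoff_itv t e0 (sqnorm (m + z)); rewrite ger0_norm.
  have [mc _ _] := measurable_cutoffs t e.
  exact: (measurableT_comp mc (measurable_sqnorm_shift m)).
rewrite /radial_cdf -!Rint_bool//; apply/andP; split; apply: Rint_le;
  [exact: bmf_integrable (bmf_bool R (mp t))|exact: bmf_integrable| |exact: bmf_integrable|exact: bmf_integrable (bmf_bool R (mp _))|] => z.
  rewrite /radial_cutoff; case: (leP (sqnorm (m + z)) t) => h; first by rewrite cutoff_left.
  by have /andP[] := cutoff_itv t e0 (sqnorm (m + z)).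
rewrite /radial_cutoff; case: (leP (sqnorm (m + z)) (t + 3 * e)) => h.
  by have /andP[] := cutoff_itv t e0 (sqnorm (m + z)).
by have [-> _ _] := cutoff_right e0 (ltW h).
Qed.

Local Notation error C g :=
  (C * (K%:R * ((M ^+ 3 + 2) * \sum_i `|a i| ^+ 3)) + \int[P]_w g w).

(** [g] dominates the indicator of the event that [Sn] is not within [e] of
    the squared norm, so its integral bounds the probability of that event. Off
    this event the indicator of [Sn <= x] lies between two cut-offs of the squared
    norm, whose expectations are nearly Gaussian. *)
Lemma cdf_sandwich (Sn : T -> R) (g : T -> R) C x e : 0 <= C -> 0 < e ->
  smooth C (radial_cutoff m (x + e) e) -> smooth C (radial_cutoff m (x - 4 * e) e) ->
  measurable_fun [set: T] Sn -> bmf g -> (forall w, 0 <= g w) ->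
  (forall w, e < `|Sn w - sqnorm (m + W w)| -> 1 <= g w) ->
  radial_cdf m (x - 4 * e) - error C g <= fine (P [set w | Sn w <= x])
    <= radial_cdf m (x + 4 * e) + error C g.
Proof.
move=> C0 e0 s1 s2 mS bg g0 gP.
have mp : measurable_fun [set: T] (fun w => Sn w <= x) by exact: measurable_fun_ler.
have bp := bmf_bool R mp.
have mW : measurable_fun [set: T] (fun w => W w).
  apply: measurable_fun_mxP => k l; rewrite (ord1 l); under eq_fun do rewrite summxE.
  apply: measurable_sum => i; under eq_fun do rewrite mxE.
  apply: measurable_funM => //; exact: (measurableT_comp (mz k) (mY i)).
have bc t : bmf (fun w => radial_cutoff m t e (W w)).
  split; last by exists 1 => w; have /andP[h1 h2] := cutoff_itv t e0 (sqnorm (m + W w)); rewrite ger0_norm.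
  have [mc _ _] := measurable_cutoffs t e.
  exact: (measurableT_comp mc (measurableT_comp (measurable_sqnorm_shift m) mW)).
rewrite -Rint_bool//.
have /andP[c1 c2] := gauss_radial_cutoff (x - 4 * e) e0.
have /andP[d1 d2] := gauss_radial_cutoff (x + e) e0.
have L1 := lindeberg_radial C0 s1; have L2 := lindeberg_radial C0 s2.
have U : \int[P]_w (Sn w <= x)%R%:R <= \int[P]_w radial_cutoff m (x + e) e (W w) + \int[P]_w g w.
  rewrite -RintD; [|exact: bmf_integrable..].
  apply: Rint_le; [exact: bmf_integrable|by apply: bmf_integrable; exact: bmfD|move=> w].
  have /andP[h1 h2] := cutoff_itv (x + e) e0 (sqnorm (m + W w)).
  case: (leP (Sn w) x) => h; rewrite ?mulr1n ?mulr0n; last by rewrite addr_ge0.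
  case: (ltP e `|Sn w - sqnorm (m + W w)|) => [/gP|]; first by rewrite /radial_cutoff; lra.
  rewrite ler_norml => /andP[h3 h4]; rewrite /radial_cutoff cutoff_left//; last by lra.
  by have := g0 w; lra.
(* The cut-off that starts at [x - 4 * e] already vanishes from [x - e] on. *)
have L : \int[P]_w radial_cutoff m (x - 4 * e) e (W w) <= \int[P]_w (Sn w <= x)%R%:R + \int[P]_w g w.
  rewrite -RintD; [|exact: bmf_integrable..].
  apply: Rint_le; [exact: bmf_integrable|by apply: bmf_integrable; exact: bmfD|move=> w].
  have /andP[h1 h2] := cutoff_itv (x - 4 * e) e0 (sqnorm (m + W w)).
  case: (leP (Sn w) x) => h; rewrite ?mulr1n ?mulr0n; first by have := g0 w; rewrite /radial_cutoff; lra.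
  case: (ltP e `|Sn w - sqnorm (m + W w)|) => [/gP|]; first by rewrite /radial_cutoff; lra.
  rewrite ler_norml => /andP[h3 h4].
  rewrite /radial_cutoff; have [-> _ _] := cutoff_right (a := x - 4 * e) e0 (t := sqnorm (m + W w)) ltac:(lra).
  by have := g0 w; lra.
have x3 : x + e + 3 * e = x + 4 * e by ring.
rewrite x3 in d2; move: L1 L2 U L c1 d2; rewrite !ler_norml.
move=> /andP[? ?] /andP[? ?] *; apply/andP; split; lra.
Qed.

End sandwich.

(** * Sums over independent samples *)

Lemma sum_before (R : comNzRingType) n m (c : R) : (m <= n)%N ->
  \sum_(i < n | (i < m)%N) c = m%:R * c.
Proof.
by move=> mn; rewrite -(big_ord_widen n (fun=> c) mn) sumr_const card_ord mulr_natl.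
Qed.

Lemma sum_after (R : comNzRingType) n m (c : R) : (m <= n)%N ->
  \sum_(i < n | (m <= i)%N) c = (n%:R - m%:R) * c.
Proof.
move=> mn; have := sum_before c (leqnn n).
under eq_bigl do rewrite ltn_ord.
rewrite (bigID (fun i : 'I_n => (i < m)%N))/= sum_before// mulrBl => <-.
by rewrite addrAC subrr add0r; apply: eq_bigl => i; rewrite -leqNgt.
Qed.

Section iid.
Context d d' (T : measurableType d) (S : measurableType d') (R : realType).
Variables (P : probability T R) (n : nat) (Y : 'I_n -> T -> S) (x0 : S) (Q : probability S R).
Hypothesis mY : forall i, measurable_fun [set: T] (Y i).
Hypothesis indY : forall B : 'I_n -> set S, (forall i, measurable (B i)) ->
  P [set w | forall i, B i (Y i w)] = (\prod_(i < n) P (Y i @^-1` B i))%E.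
Hypothesis lawY : forall i D, measurable D -> P (Y i @^-1` D) = Q D.

(** Every orthogonality relation below is an instance: in the product of two
    distinct terms some variable occurs in one factor only, which is centred
    in that variable. *)
Lemma expectation_centered j (g : 'cV[S]_n * S -> R) (f : T -> R) : bmf g ->
  (forall w, f w = g (others Y x0 j w, Y j w)) ->
  (forall o, \int[Q]_y g (o, y) = 0) -> \int[P]_w f w = 0.
Proof.
move=> bg fE g0; under eq_Rintegral do rewrite fE.
rewrite (decouple_others x0 mY indY (@lawY j) bg).1.
by under eq_Rintegral do rewrite g0; exact: Rint_cst.
Qed.

Let bof (u : S * S -> R) i j : bmf u ->
  bmf (fun w => u (Y i w, Y j w)).
Proof. by apply: bmf_comp; exact: measurable_fun_pair. Qed.

Let m_o i : measurable_fun [set: 'cV[S]_n * S] (fun p : 'cV[S]_n * S => p.1 i ord0).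
Proof. exact: (measurableT_comp (measurable_entry i ord0) measurable_fst). Qed.

Let m_oo i j : measurable_fun [set: 'cV[S]_n * S]
  (fun p : 'cV[S]_n * S => (p.1 i ord0, p.1 j ord0)).
Proof. by apply: measurable_fun_pair; exact: m_o. Qed.

Let m_oy i : measurable_fun [set: 'cV[S]_n * S] (fun p : 'cV[S]_n * S => (p.1 i ord0, p.2)).
Proof. by apply: measurable_fun_pair; [exact: m_o | exact: measurable_snd]. Qed.

Let m_yo j : measurable_fun [set: 'cV[S]_n * S] (fun p : 'cV[S]_n * S => (p.2, p.1 j ord0)).
Proof. by apply: measurable_fun_pair; [exact: measurable_snd | exact: m_o]. Qed.

Let othersE i j w : i != j -> others Y x0 j w i ord0 = Y i w.
Proof. by rewrite mxE => /negbTE ->. Qed.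

Lemma iid_sum_sqr (p : pred 'I_n) (a : 'I_n -> R) (r : S -> R) (c : R) : bmf r ->
  (forall y, `|r y| <= c) -> \int[Q]_y r y = 0 ->
  \int[P]_w ((\sum_(i | p i) a i * r (Y i w)) ^+ 2) <= \sum_(i | p i) (`|a i| * c) ^+ 2.
Proof.
move=> br rc r0; apply: orthogonal_sum_le.
- by move=> i _; apply: bmfM => //; exact: (bmf_comp (mY i) br).
- by move=> i w _; rewrite normrM ler_wpM2l.
move=> i j _ _ ij; apply: (@expectation_centered j
  (fun p => a i * r (p.1 i ord0) * (a j * r p.2))).
- apply: bmfM; apply: bmfM => //; first exact: (bmf_comp (m_o i) br).
  exact: (bmf_comp measurable_snd br).
- by move=> w /=; rewrite othersE.
move=> o /=; rewrite RintZ; last by apply: bmf_integrable; exact: bmfM.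
by rewrite RintZ ?r0 ?mulr0//; exact: bmf_integrable.
Qed.

(** The terms share the variable [Y i], but each is centred given [Y i], so they
    are still orthogonal. *)
Lemma iid_sum_sqr_given (i : 'I_n) (a : R) (u : 'I_n -> S * S -> R) (c : R) : (forall j, bmf (u j)) ->
  (forall j z, `|u j z| <= c) -> (forall j x, \int[Q]_y u j (x, y) = 0) ->
  \int[P]_w ((\sum_(j | j != i) a * u j (Y i w, Y j w)) ^+ 2) <= \sum_(j | j != i) (`|a| * c) ^+ 2.
Proof.
move=> bu uc u0; apply: orthogonal_sum_le.
- by move=> j _; apply: bmfM => //; exact: bof.
- by move=> j w _; rewrite normrM ler_wpM2l.
move=> j k ji ki jk; apply: (@expectation_centered k
  (fun p => a * u j (p.1 i ord0, p.1 j ord0) * (a * u k (p.1 i ord0, p.2)))).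
- apply: bmfM; apply: bmfM => //; first exact: (bmf_comp (m_oo i j) (bu j)).
  exact: (bmf_comp (m_oy i) (bu k)).
- by move=> w /=; rewrite !othersE// eq_sym.
have bk o : bmf (fun y => u k (o, y)) by exact: bmf_pair1.
move=> o /=; rewrite RintZ; last by apply: bmf_integrable; exact: bmfM.
by rewrite RintZ ?u0 ?mulr0//; exact: bmf_integrable.
Qed.

(** Two distinct pairs of indices differ in one index, and the kernel is centred in it. *)
Lemma degenerate_sum_sqr (m : nat) (a : R) (u : S * S -> R) (c : R) : bmf u ->
  (forall z, `|u z| <= c) -> (forall x, \int[Q]_y u (x, y) = 0) ->
  (forall y, \int[Q]_x u (x, y) = 0) ->
  \int[P]_w ((\sum_(i < n | (i < m)%N) \sum_(j < n | (m <= j)%N) a * u (Y i w, Y j w)) ^+ 2)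
  <= \sum_(i < n | (i < m)%N) \sum_(j < n | (m <= j)%N) (`|a| * c) ^+ 2.
Proof.
move=> bu uc ux uy; under eq_Rintegral do rewrite pair_big_dep/=.
rewrite pair_big_dep/=; apply: (@orthogonal_sum_le _ _ _ P _ (fun p : 'I_n * 'I_n => (p.1 < m)%N && (m <= p.2)%N)
  (fun p w => a * u (Y p.1 w, Y p.2 w)) (fun=> `|a| * c)).
- by move=> p _; apply: bmfM => //; exact: bof.
- by move=> j w _; rewrite normrM ler_wpM2l.
have b1 o : bmf (fun y => u (o, y)) by exact: bmf_pair1.
have b2 o : bmf (fun y => u (y, o)) by exact: bmf_pair2.
have neq (i j : 'I_n) : (i < m)%N -> (m <= j)%N -> i != j.
  by move=> im mj; apply: contraTneq mj => <-; rewrite -ltnNge.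
move=> [i j] [i' j'] /= /andP[im mj] /andP[im' mj'] ij.
case: (eqVneq j j') => [jj|jj].
  have ii : i != i' by apply: contraNneq ij => ->; rewrite jj.
  apply: (@expectation_centered i'
    (fun p => a * u (p.1 i ord0, p.1 j ord0) * (a * u (p.2, p.1 j' ord0)))).
  - apply: bmfM; apply: bmfM => //; first exact: (bmf_comp (m_oo i j) bu).
    exact: (bmf_comp (m_yo j') bu).
  - by move=> w /=; rewrite !othersE// eq_sym neq.
  move=> o /=; rewrite RintZ; last by apply: bmf_integrable; exact: bmfM.
  by rewrite RintZ ?uy ?mulr0//; exact: bmf_integrable.
apply: (@expectation_centered j'
  (fun p => a * u (p.1 i ord0, p.1 j ord0) * (a * u (p.1 i' ord0, p.2)))).
- apply: bmfM; apply: bmfM => //; first exact: (bmf_comp (m_oo i j) bu).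
  exact: (bmf_comp (m_oy i') bu).
- by move=> w /=; rewrite !othersE// neq.
move=> o /=; rewrite RintZ; last by apply: bmf_integrable; exact: bmfM.
by rewrite RintZ ?ux ?mulr0//; exact: bmf_integrable.
Qed.

End iid.

(** * The rank kernel *)

Section rank_kernel.
Context (R : realType) (K : nat) (Q : probability 'cV[R]_K R).
Variable M : R.
Hypothesis F_lip : forall k a b, a <= b ->
  0 <= marginal_cdf Q k b - marginal_cdf Q k a <= M * (b - a).
Local Notation F k := (marginal_cdf Q k).
Implicit Types (k l : 'I_K) (x y : 'cV[R]_K).

Let mc k : measurable_fun [set: 'cV[R]_K] (fun y => y k ord0 : R).
Proof. exact: measurable_entry. Qed.

Let mle k t : measurable_fun [set: 'cV[R]_K] (fun y => y k ord0 <= t).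
Proof. exact: measurable_fun_ler. Qed.

Let mge k t : measurable_fun [set: 'cV[R]_K] (fun y => t <= y k ord0).
Proof. exact: measurable_fun_ler. Qed.

Lemma marginal_cdfE k t : \int[Q]_y (y k ord0 <= t)%R%:R = F k t.
Proof. by rewrite Rint_bool. Qed.

Lemma marginal_cdf_itv k t : 0 <= F k t <= 1.
Proof.
rewrite -marginal_cdfE; apply/andP; split; first by apply: Rintegral_ge0 => y _; exact: ler0n.
apply: le_trans (ler_norm _) _; apply: Rint_bound; first exact: bmf_bool.
by move=> y; case: (y k ord0 <= t); rewrite ?normr1 ?normr0.
Qed.

Lemma marginal_cdf_dist k a b : `|F k a - F k b| <= M * `|a - b|.
Proof.
wlog ab : a b / b <= a => [H|].
  case: (leP b a) => [/H//|/ltW/H]; by rewrite distrC [X in _ -> _ <= _ * X]distrC.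
have /andP[h1 h2] := F_lip k ab; rewrite !ger0_norm//.
by rewrite subr_ge0.
Qed.

Lemma bmf_marginal_cdf k : bmf (F k : measurableTypeR R -> R).
Proof.
split; last by exists 1 => t; have /andP[h0 h1] := marginal_cdf_itv k t; rewrite ger0_norm.
by apply: nondecreasing_measurable => // a b ab; have /andP[+ _] := F_lip k ab; rewrite subr_ge0.
Qed.

(** A Lipschitz distribution function has no atom, so the point [t] has no mass. *)
Lemma marginal_tail k t : \int[Q]_y (t <= y k ord0)%R%:R = 1 - F k t.
Proof.
have mlt : measurable_fun [set: 'cV[R]_K] (fun y => y k ord0 < t) by exact: measurable_fun_ltr.
have bl := bmf_bool R mlt.
have i1 := bmf_integrable Q bl.
transitivity (\int[Q]_y (1 - (y k ord0 < t)%R%:R)).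
  by apply: eq_Rintegral => y _; case: leP => _; rewrite /= ?subr0 ?subrr.
rewrite RintB//; last exact: bmf_integrable.
rewrite Rint_cst; congr (_ - _); apply/eqP; rewrite eq_le; apply/andP; split.
  rewrite -marginal_cdfE; apply: Rint_le => //; first exact/bmf_integrable/bmf_bool.
  by move=> y; case: ltP => [/ltW ->//|_]; rewrite ler0n.
apply/ler_addgt0Pl => e e0.
have M0 : 0 <= M by have /andP[h1 h2] := F_lip k (ler01 : 0 <= 1 :> R); move: h2; rewrite subr0 mulr1; lra.
have M1 : 0 < M + 1 by lra.
pose h := e / (M + 1); have h0 : 0 < h by exact: divr_gt0.
have th : t - h <= t by lra.
have /andP[_ ] := F_lip k th; rewrite (_ : t - (t - h) = h) => [Fh|]; last by lra.
have Mh : M * h <= e by rewrite /h mulrCA ler_piMr ?(ltW e0)// ler_pdivrMr// mul1r lerDl.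
have : F k (t - h) <= \int[Q]_y (y k ord0 < t)%R%:R.
  rewrite -marginal_cdfE; apply: Rint_le => //; first exact/bmf_integrable/bmf_bool.
  move=> y; case: (leP _ (t - h)) => yt; last by rewrite ler0n.
  by rewrite (_ : y k ord0 < t)//; lra.
by lra.
Qed.

Definition centered_cdf k y : R := 2 * F k (y k ord0) - 1.

Lemma bmf_shifted_cdf k (c : R) : bmf (fun y => F k (y k ord0 + c)).
Proof.
apply: (bmf_comp (h := fun y => y k ord0 + c : measurableTypeR R)) (bmf_marginal_cdf k).
by apply: measurable_funD => //; exact: mc.
Qed.

Lemma bmf_centered_cdf k : bmf (centered_cdf k).
Proof.
apply: bmfB => //; apply: bmfM => //.
exact: (bmf_comp (h := fun y => y k ord0 : measurableTypeR R) (mc k) (bmf_marginal_cdf k)).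
Qed.

Lemma centered_cdf_le1 k y : `|centered_cdf k y| <= 1.
Proof.
by have /andP[h0 h1] := marginal_cdf_itv k (y k ord0); rewrite ler_norml /centered_cdf; apply/andP; split; lra.
Qed.

Definition rank_kernel k (c : R) (p : 'cV[R]_K * 'cV[R]_K) : R :=
  (p.1 k ord0 <= p.2 k ord0 + c)%R%:R - (p.2 k ord0 + c <= p.1 k ord0)%R%:R.

Lemma rank_kernel_le1 k c p : `|rank_kernel k c p| <= 1.
Proof.
by rewrite /rank_kernel; case: (p.1 k ord0 <= _); case: (_ <= p.1 k ord0);
  rewrite ?subrr ?subr0 ?sub0r ?normrN ?normr1 ?normr0.
Qed.

Lemma bmf_rank_kernel k c : bmf (rank_kernel k c).
Proof.
have m1 : measurable_fun [set: 'cV[R]_K * 'cV[R]_K] (fun p : 'cV[R]_K * 'cV[R]_K => p.1 k ord0).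
  exact: (measurableT_comp (mc k) measurable_fst).
have m2 : measurable_fun [set: 'cV[R]_K * 'cV[R]_K] (fun p : 'cV[R]_K * 'cV[R]_K => p.2 k ord0 + c).
  by apply: measurable_funD => //; exact: (measurableT_comp (mc k) measurable_snd).
by apply: bmfB; apply: bmf_bool; exact: measurable_fun_ler.
Qed.

Lemma rank_kernel_mean2 k c x : \int[Q]_y rank_kernel k c (x, y) = 1 - 2 * F k (x k ord0 - c).
Proof.
rewrite /rank_kernel /= (_ : (fun y => _) = fun y =>
  (x k ord0 - c <= y k ord0)%R%:R - (y k ord0 <= x k ord0 - c)%R%:R).
  rewrite RintB; [|exact/bmf_integrable/bmf_bool..].
  by rewrite marginal_tail marginal_cdfE; ring.
by apply/funext => y; rewrite lerBlDr lerBrDr.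
Qed.

Lemma rank_kernel_mean1 k c y : \int[Q]_x rank_kernel k c (x, y) = 2 * F k (y k ord0 + c) - 1.
Proof.
rewrite /rank_kernel /= RintB; [|exact/bmf_integrable/bmf_bool..].
by rewrite marginal_tail marginal_cdfE; ring.
Qed.

(** The mean of the kernel under the product law, as [rank_driftE] confirms. *)
Definition rank_drift k c : R := \int[Q]_y (2 * F k (y k ord0 + c) - 1).

Let bp k c : bmf (fun x => 1 - 2 * F k (x k ord0 - c)).
Proof. by apply: bmfB => //; apply: bmfM => //; exact: bmf_shifted_cdf. Qed.

Let bq k c : bmf (fun y => 2 * F k (y k ord0 + c) - 1).
Proof. by apply: bmfB => //; apply: bmfM => //; exact: bmf_shifted_cdf. Qed.

Lemma rank_driftE k c : \int[Q]_x (1 - 2 * F k (x k ord0 - c)) = rank_drift k c.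
Proof.
under eq_Rintegral do rewrite -rank_kernel_mean2.
rewrite -(Rfubini1 Q Q (bmf_rank_kernel k c)) Rfubini2; last exact: bmf_rank_kernel.
by apply: eq_Rintegral => y _; rewrite rank_kernel_mean1.
Qed.

(** Exchanging the two arguments of the unshifted kernel changes its sign. *)
Lemma centered_cdf_mean k : \int[Q]_y centered_cdf k y = 0.
Proof.
have E : \int[Q]_y centered_cdf k y = rank_drift k 0.
  by apply: eq_Rintegral => y _; rewrite addr0.
apply: eq_opp_eq0; rewrite {1}E -rank_driftE -mulN1r -RintZ.
  by apply: eq_Rintegral => y _; rewrite subr0 /centered_cdf; ring.
exact/bmf_integrable/bp.
Qed.

Lemma centered_cdf_shift k (y : 'cV[R]_K) c : `|2 * F k (y k ord0 + c) - 1 - centered_cdf k y| <= 2 * (M * `|c|).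
Proof.
have := marginal_cdf_dist k (y k ord0 + c) (y k ord0).
rewrite addrAC subrr add0r /centered_cdf !ler_norml => /andP[? ?]; apply/andP; split; lra.
Qed.

Lemma rank_drift_le k c : `|rank_drift k c| <= 2 * (M * `|c|).
Proof.
rewrite -[rank_drift k c]subr0 -(centered_cdf_mean k) -RintB; last 2 first.
- exact/bmf_integrable/bq.
- exact/bmf_integrable/bmf_centered_cdf.
apply: Rint_bound => [|y]; last exact: centered_cdf_shift.
by apply: bmfB; [exact: bq | exact: bmf_centered_cdf].
Qed.

(** The part of the kernel left by the Hoeffding projections on each argument. *)
Definition degenerate_kernel k c (p : 'cV[R]_K * 'cV[R]_K) : R :=
  rank_kernel k c p - (1 - 2 * F k (p.1 k ord0 - c)) - (2 * F k (p.2 k ord0 + c) - 1)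
  + rank_drift k c.

Lemma bmf_degenerate_kernel k c : bmf (degenerate_kernel k c).
Proof.
apply: bmfD => //; apply: bmfB; last exact: (bmf_comp measurable_snd (bq k c)).
by apply: bmfB; [exact: bmf_rank_kernel | exact: (bmf_comp measurable_fst (bp k c))].
Qed.

Lemma degenerate_kernel_le k c p : `|degenerate_kernel k c p| <= 4.
Proof.
have h := rank_kernel_le1 k c p.
have /andP[? ?] := marginal_cdf_itv k (p.1 k ord0 - c).
have /andP[? ?] := marginal_cdf_itv k (p.2 k ord0 + c).
have : `|rank_drift k c| <= 1.
  apply: Rint_bound => [|y]; first exact: bq.
  by have /andP[? ?] := marginal_cdf_itv k (y k ord0 + c); rewrite ler_norml; apply/andP; split; lra.
move: h; rewrite /degenerate_kernel !ler_norml => /andP[? ?] /andP[? ?]; apply/andP; split; lra.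
Qed.

Lemma degenerate_kernel_mean2 k c x : \int[Q]_y degenerate_kernel k c (x, y) = 0.
Proof.
have b1 : bmf (fun y => rank_kernel k c (x, y)) by exact: (bmf_pair1 (bmf_rank_kernel k c)).
have b2 := bq k c.
rewrite /degenerate_kernel /= RintD; [|apply: bmf_integrable; apply: bmfB => //; exact: bmfB|exact: bmf_integrable].
rewrite RintB; [|apply: bmf_integrable; exact: bmfB|exact: bmf_integrable].
rewrite RintB; [|exact: bmf_integrable..].
by rewrite rank_kernel_mean2 !Rint_cst -/(rank_drift k c); ring.
Qed.

Lemma degenerate_kernel_mean1 k c y : \int[Q]_x degenerate_kernel k c (x, y) = 0.
Proof.
have b1 : bmf (fun x => rank_kernel k c (x, y)) by exact: (bmf_pair2 (bmf_rank_kernel k c)).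
have b2 := bp k c.
rewrite /degenerate_kernel /= RintD; [|apply: bmf_integrable; apply: bmfB => //; exact: bmfB|exact: bmf_integrable].
rewrite RintB; [|apply: bmf_integrable; exact: bmfB|exact: bmf_integrable].
rewrite RintB; [|exact: bmf_integrable..].
by rewrite rank_kernel_mean1 rank_driftE !Rint_cst; ring.
Qed.

(** The centring at 1/2 in the covariance is [centered_cdf_mean]. *)
Lemma rank_covE k l : rank_cov Q k l = \int[Q]_y (centered_cdf k y * centered_cdf l y).
Proof.
have bF j : bmf (fun y : 'cV[R]_K => F j (y j ord0)).
  by have := bmf_shifted_cdf j 0; under eq_fun do rewrite addr0.
have mean j : \int[Q]_y F j (y j ord0) = 2^-1.
  have := centered_cdf_mean j; rewrite /centered_cdf RintB ?RintZ ?Rint_cst; last 3 first.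
  - exact: bmf_integrable.
  - by apply: bmf_integrable; exact: bmfM.
  - exact: bmf_integrable.
  by lra.
rewrite mxE unlock [in LHS]unlock.
transitivity (4 * \int[Q]_y ((F k (y k ord0) - 2^-1) * (F l (y l ord0) - 2^-1))).
  congr (4 * _); rewrite /Rintegral; congr fine; apply: eq_integral => y _.
  by congr (_ * _)%:E; [rewrite -(mean k)|rewrite -(mean l)].
rewrite -RintZ; last by apply: bmf_integrable; apply: bmfM; exact: bmfB.
by apply: eq_Rintegral => y _; rewrite /centered_cdf; field.
Qed.

End rank_kernel.

(** * The rank statistics of a shifted sample *)

Section shifted_sample.
Context d (T : measurableType d) (R : realType) (P : probability T R) (K n : nat).
Variables (Y : 'I_n -> T -> 'cV[R]_K) (Q : probability 'cV[R]_K R).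
Hypothesis mY : forall i, measurable_fun [set: T] (Y i).
Hypothesis indY : forall B : 'I_n -> set 'cV[R]_K, (forall i, measurable (B i)) ->
  P [set w | forall i, B i (Y i w)] = (\prod_(i < n) P (Y i @^-1` B i))%E.
Hypothesis lawY : forall i D, measurable D -> P (Y i @^-1` D) = Q D.
Variable M : R.
Hypothesis F_lip : forall k a b, a <= b ->
  0 <= marginal_cdf Q k b - marginal_cdf Q k a <= M * (b - a).
Variables (m : nat) (v : 'cV[R]_K).
Hypotheses (m_gt0 : (0 < m)%N) (m_lt : (m < n)%N).

Local Notation F k := (marginal_cdf Q k).
Local Notation xi k := (centered_cdf Q k).
Local Notation N := (n%:R : R).
Local Notation N1 := (m%:R : R).
Local Notation N2 := (n%:R - m%:R : R).
Local Notation s := ((Num.sqrt N)^-1).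

Definition shifted_sample (w : T) (i : 'I_n) : 'cV[R]_K := Y i w + (if (m <= i)%N then v else 0).
Local Notation XX w := (shifted_sample w).

Definition rank_scale : R := Num.sqrt (N * N1 * N2).
Local Notation D := rank_scale.

(** The coefficients of the Hoeffding projections of the rank vector, once it is
    divided by [rank_scale]. *)
Definition rank_weight (i : 'I_n) : R := if (i < m)%N then - (N2 / D) else N1 / D.

Let N_gt0 : 0 < N. Proof. by rewrite ltr0n; exact: leq_ltn_trans m_lt. Qed.
Let N1_gt0 : 0 < N1. Proof. by rewrite ltr0n. Qed.
Let N2_gt0 : 0 < N2. Proof. by rewrite subr_gt0 ltr_nat. Qed.
Let DD : D ^+ 2 = N * N1 * N2.
Proof. by rewrite sqr_sqrtr// !mulr_ge0// ltW. Qed.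
Let D_gt0 : 0 < D. Proof. by rewrite sqrtr_gt0 !mulr_gt0. Qed.
Let s_gt0 : 0 < s. Proof. by rewrite invr_gt0 sqrtr_gt0. Qed.
Let ss : s ^+ 2 = N^-1. Proof. by rewrite exprVn sqr_sqrtr// ltW. Qed.
Let mn : (m <= n)%N. Proof. exact: ltnW. Qed.

Lemma rank_weight_neq0 i : rank_weight i != 0.
Proof.
by rewrite /rank_weight; case: ifP => _; rewrite ?oppr_eq0 mulf_neq0 ?invr_eq0// gt_eqF.
Qed.

Lemma rank_weight_sqr : \sum_i rank_weight i ^+ 2 = 1.
Proof.
rewrite (bigID (fun i : 'I_n => (i < m)%N))/=.
rewrite (eq_bigr (fun=> N2 ^+ 2 / D ^+ 2)) => [|i im]; last by rewrite /rank_weight im sqrrN expr_div_n.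
rewrite [X in _ + X](eq_bigr (fun=> N1 ^+ 2 / D ^+ 2)) => [|i im]; last first.
  by rewrite /rank_weight (negbTE im) expr_div_n.
rewrite sum_before// (eq_bigl (fun i : 'I_n => (m <= i)%N)) => [|i]; last by rewrite -leqNgt.
rewrite sum_after// DD; field.
by rewrite !gt_eqF.
Qed.

Lemma rank_weight_le i : `|rank_weight i| <= N / D.
Proof.
rewrite /rank_weight; case: ifP => _; rewrite ?normrN normrM normfV (gtr0_norm D_gt0) ler_wpM2r ?invr_ge0 ?(ltW D_gt0)//.
  by rewrite gtr0_norm// gerBl ltW.
by rewrite gtr0_norm// ler_nat.
Qed.

(** The Lyapunov ratio, bounded by the largest weight since the squares add up to 1. *)
Lemma rank_weight_cube : \sum_i `|rank_weight i| ^+ 3 <= N / D.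
Proof.
rewrite -[leRHS]mulr1 -[X in _ <= _ * X]rank_weight_sqr mulr_sumr; apply: ler_sum => i _.
rewrite exprS real_normK ?num_real// ler_wpM2r ?sqr_ge0//; exact: rank_weight_le.
Qed.

Let bxi k i : bmf (fun w => xi k (Y i w)).
Proof. exact: (bmf_comp (mY i) (bmf_centered_cdf F_lip k)). Qed.

Lemma linear_part_mean k : \int[P]_w `|\sum_i rank_weight i * xi k (Y i w)| <= 1.
Proof.
apply: mean_abs_le => //; first by apply: bmf_sum => i _; exact: bmfM.
have := (iid_sum_sqr (0 : 'cV[R]_K) mY indY lawY xpredT rank_weight (c := 1)
  (bmf_centered_cdf F_lip k) (centered_cdf_le1 Q k) (centered_cdf_mean F_lip k)).
move=> /le_trans; apply.
rewrite expr1n -[leRHS]rank_weight_sqr; apply: ler_sum => i _.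
by rewrite mulr1 real_normK ?num_real.
Qed.

Section coordinate.
Variable k : 'I_K.
Local Notation c := (v k ord0).
Local Notation omega := (M * `|v k ord0|).

Let omega_ge0 : 0 <= omega.
Proof. by rewrite mulr_ge0//; have /andP[h1 h2] := F_lip k (ler01 : 0 <= 1 :> R); move: h2; rewrite subr0 mulr1; lra. Qed.

Let r1 (x : 'cV[R]_K) := 1 - 2 * F k (x k ord0 - c) + xi k x - rank_drift Q k c.
Let r2 (y : 'cV[R]_K) := 2 * F k (y k ord0 + c) - 1 - xi k y - rank_drift Q k c.

Let br1 : bmf r1.
Proof.
apply: bmfB => //; apply: bmfD; last exact: (bmf_centered_cdf F_lip).
by apply: bmfB => //; apply: bmfM => //; exact: (bmf_shifted_cdf F_lip k (- c)).
Qed.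

Let br2 : bmf r2.
Proof.
apply: bmfB => //; apply: bmfB; last exact: (bmf_centered_cdf F_lip).
by apply: bmfB => //; apply: bmfM => //; exact: (bmf_shifted_cdf F_lip k c).
Qed.

Let r1_le x : `|r1 x| <= 4 * omega.
Proof.
have := centered_cdf_shift F_lip k x (- c); rewrite normrN.
have := rank_drift_le F_lip k c; rewrite /r1 !ler_norml => /andP[? ?] /andP[? ?].
by apply/andP; split; lra.
Qed.

Let r2_le x : `|r2 x| <= 4 * omega.
Proof.
have := centered_cdf_shift F_lip k x c.
have := rank_drift_le F_lip k c; rewrite /r2 !ler_norml => /andP[? ?] /andP[? ?].
by apply/andP; split; lra.
Qed.

Let bp : bmf (fun x : 'cV[R]_K => 1 - 2 * F k (x k ord0 - c)).
Proof. by apply: bmfB => //; apply: bmfM => //; exact: (bmf_shifted_cdf F_lip k (- c)). Qed.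

Let bq : bmf (fun x : 'cV[R]_K => 2 * F k (x k ord0 + c) - 1).
Proof. by apply: bmfB => //; apply: bmfM => //; exact: (bmf_shifted_cdf F_lip k c). Qed.

Let r1_mean : \int[Q]_x r1 x = 0.
Proof.
have bx := bmf_centered_cdf F_lip k.
rewrite /r1 RintB; [|apply: bmf_integrable; exact: bmfD|exact: bmf_integrable].
rewrite RintD; [|exact: bmf_integrable..].
by rewrite (rank_driftE F_lip) (centered_cdf_mean F_lip) Rint_cst; ring.
Qed.

Let r2_mean : \int[Q]_x r2 x = 0.
Proof.
have bx := bmf_centered_cdf F_lip k.
rewrite /r2 RintB; [|apply: bmf_integrable; exact: bmfB|exact: bmf_integrable].
rewrite RintB; [|exact: bmf_integrable..].
by rewrite -/(rank_drift Q k c) (centered_cdf_mean F_lip) Rint_cst; ring.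
Qed.

Let rest w := rank_vector (XX w) m k ord0 - \sum_i rank_weight i * xi k (Y i w)
  - N1 * N2 / D * rank_drift Q k c.

(** The Hoeffding decomposition; [r1] and [r2] collect what the shift changes in the two projections. *)
Let restE w : rest w =
  \sum_(i < n | (i < m)%N) \sum_(j < n | (m <= j)%N)
    D^-1 * degenerate_kernel Q k c (Y i w, Y j w) +
  \sum_(i < n | (i < m)%N) N2 / D * r1 (Y i w) +
  \sum_(j < n | (m <= j)%N) N1 / D * r2 (Y j w).
Proof.
pose alpha i := r1 (Y i w) - xi k (Y i w).
pose beta j := r2 (Y j w) + xi k (Y j w).
have E : rank_vector (XX w) m k ord0 =
    D^-1 * \sum_(i < n | (i < m)%N) \sum_(j < n | (m <= j)%N)
      (degenerate_kernel Q k c (Y i w, Y j w) + (alpha i + (beta j + rank_drift Q k c))).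
  rewrite mxE -/D; congr (_ * _); apply: eq_bigr => i im; apply: eq_bigr => j mj.
  rewrite /shifted_sample mj leqNgt im /= !mxE addr0.
  by rewrite /degenerate_kernel /rank_kernel /alpha /beta /r1 /r2 /=; ring.
have S1 : \sum_(i < n | (i < m)%N) \sum_(j < n | (m <= j)%N)
      (degenerate_kernel Q k c (Y i w, Y j w) + (alpha i + (beta j + rank_drift Q k c))) =
   \sum_(i < n | (i < m)%N) \sum_(j < n | (m <= j)%N) degenerate_kernel Q k c (Y i w, Y j w) +
   (N2 * \sum_(i < n | (i < m)%N) alpha i + (N1 * \sum_(j < n | (m <= j)%N) beta j +
     N1 * (N2 * rank_drift Q k c))).
  under eq_bigr do rewrite big_split/=.
  rewrite big_split/=; congr (_ + _).
  under eq_bigr do rewrite big_split/= sum_after//.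
  rewrite big_split/= -mulr_sumr; congr (_ + _).
  under eq_bigr do rewrite big_split/= sum_after//.
  by rewrite sum_before// mulrDr.
have S2 : \sum_i rank_weight i * xi k (Y i w) =
   - (N2 / D) * (\sum_(i < n | (i < m)%N) xi k (Y i w)) +
   N1 / D * (\sum_(j < n | (m <= j)%N) xi k (Y j w)).
  rewrite (bigID (fun i : 'I_n => (i < m)%N))/= !mulr_sumr; congr (_ + _).
    by apply: eq_bigr => i im; rewrite /rank_weight im.
  apply: eq_big => [i|i im]; first by rewrite -leqNgt.
  by rewrite /rank_weight (negbTE im).
rewrite /rest E S1 S2 -!mulr_sumr.
under [in RHS]eq_bigr do rewrite -mulr_sumr.
rewrite -mulr_sumr /alpha /beta big_split/= sumrN [\sum_(j < n | (m <= j)%N) (_ + _)]big_split/=.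
by field; rewrite gt_eqF.
Qed.

Let bdeg i j : bmf (fun w => degenerate_kernel Q k c (Y i w, Y j w)).
Proof.
apply: (bmf_comp (h := fun w => (Y i w, Y j w))) (bmf_degenerate_kernel F_lip k c).
exact: measurable_fun_pair.
Qed.

(** Each of the three sums in the remainder has pairwise orthogonal terms; those
    of the two single sums are of size [omega], the effect of the shift on the
    distribution function. *)
Lemma rank_vector_linear : bmf rest /\ \int[P]_w `|rest w| <= 4 * s + 8 * omega.
Proof.
pose A w := \sum_(i < n | (i < m)%N) \sum_(j < n | (m <= j)%N)
    D^-1 * degenerate_kernel Q k c (Y i w, Y j w).
pose B w := \sum_(i < n | (i < m)%N) N2 / D * r1 (Y i w).
pose C w := \sum_(j < n | (m <= j)%N) N1 / D * r2 (Y j w).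
have bA : bmf A by apply: bmf_sum => i _; apply: bmf_sum => j _; exact: bmfM.
have bB : bmf B by apply: bmf_sum => i _; apply: bmfM => //; exact: (bmf_comp (mY i) br1).
have bC : bmf C by apply: bmf_sum => i _; apply: bmfM => //; exact: (bmf_comp (mY i) br2).
have rE : rest = fun w => A w + B w + C w by apply/funext => w; rewrite restE.
have br : bmf rest by rewrite rE; apply: bmfD => //; exact: bmfD.
split => //.
have D20 : D ^+ 2 != 0 by rewrite expf_neq0// gt_eqF.
have iA : \int[P]_w `|A w| <= 4 * s.
  apply: mean_abs_le bA _; first by rewrite mulr_ge0// ltW.
  apply: le_trans (degenerate_sum_sqr (0 : 'cV[R]_K) mY indY lawY m D^-1 (c := 4) (bmf_degenerate_kernel F_lip k c)
    (degenerate_kernel_le F_lip k c) (degenerate_kernel_mean2 F_lip k c)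
    (degenerate_kernel_mean1 F_lip k c)) _.
  under eq_bigr do rewrite sum_after//.
  rewrite sum_before// !exprMn real_normK ?num_real// exprVn ss DD le_eqVlt; apply/orP; left; apply/eqP.
  by field; rewrite !gt_eqF.
have iB : \int[P]_w `|B w| <= 4 * omega.
  apply: mean_abs_le bB _; first by rewrite mulr_ge0.
  apply: le_trans (iid_sum_sqr (0 : 'cV[R]_K) mY indY lawY (fun i : 'I_n => (i < m)%N) (fun=> N2 / D) (c := 4 * omega)
    br1 r1_le r1_mean) _.
  rewrite sum_before// exprMn [leLHS]mulrA ler_piMl ?sqr_ge0// real_normK ?num_real// exprMn exprVn DD.
  rewrite [leLHS](_ : _ = N2 / N); last by field; rewrite !gt_eqF.
  by rewrite ler_pdivrMr// mul1r gerBl ltW.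
have iC : \int[P]_w `|C w| <= 4 * omega.
  apply: mean_abs_le bC _; first by rewrite mulr_ge0.
  apply: le_trans (iid_sum_sqr (0 : 'cV[R]_K) mY indY lawY (fun i : 'I_n => (m <= i)%N) (fun=> N1 / D) (c := 4 * omega)
    br2 r2_le r2_mean) _.
  rewrite sum_after// exprMn [leLHS]mulrA ler_piMl ?sqr_ge0// real_normK ?num_real// exprMn exprVn DD.
  rewrite [leLHS](_ : _ = N1 / N); last by field; rewrite !gt_eqF.
  by rewrite ler_pdivrMr// mul1r ler_nat.
have [nA nB nC] := And3 (bmf_norm bA) (bmf_norm bB) (bmf_norm bC).
apply: (@le_trans _ _ (\int[P]_w (`|A w| + `|B w| + `|C w|))).
  apply: Rint_le; [exact/bmf_integrable/bmf_norm|apply: bmf_integrable; apply: bmfD => //; exact: bmfD|].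
  move=> w; rewrite rE; apply: le_trans (ler_normD _ _) _; rewrite lerD2r; exact: ler_normD.
rewrite RintD; [|apply: bmf_integrable; exact: bmfD|exact: bmf_integrable].
by rewrite RintD; [lra|exact: bmf_integrable..].
Qed.

Let bcoord i : measurable_fun [set: T] (fun w => XX w i k ord0).
Proof.
rewrite (_ : (fun _ => _) = fun w => Y i w k ord0 + (if (m <= i)%N then v else 0) k ord0).
  apply: measurable_funD => //; exact: (measurableT_comp (measurable_entry k ord0) (mY i)).
by apply/funext => w; rewrite mxE.
Qed.

Lemma bmf_ecdf i : bmf (fun w => ecdf (XX w) k (XX w i k ord0)).
Proof.
apply: bmfM => //; apply: bmf_sum => j _; apply: bmf_bool; exact: measurable_fun_ler.
Qed.

Lemma ecdf_itv i w : 0 <= ecdf (XX w) k (XX w i k ord0) <= 1.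
Proof.
rewrite /ecdf mulr_ge0 ?invr_ge0 ?(ltW N_gt0) ?sumr_ge0//=.
rewrite ler_pdivrMl// mulr1 -[X in X%:R](card_ord n) -sum1_card natr_sum; apply: ler_sum => j _.
by case: (XX w j k ord0 <= XX w i k ord0).
Qed.

Let sh (i : 'I_n) : R := if (m <= i)%N then c else 0.

(** Given [Y i], the terms with [j != i] are independent and become centred once the
    distribution function at the relative shift is subtracted. The term [j = i]
    costs 1/n and removing the relative shifts costs [omega]. *)
Lemma ecdf_consistent i : \int[P]_w `|ecdf (XX w) k (XX w i k ord0) - F k (Y i w k ord0)|
  <= 2 * s + omega.
Proof.
pose g j := sh i - sh j.
have g_le j : `|g j| <= `|c|.
  by rewrite /g /sh; do 2!case: ifP => _; rewrite ?subrr ?subr0 ?sub0r ?normrN ?normr0.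
pose u j (p : 'cV[R]_K * 'cV[R]_K) : R :=
  (p.2 k ord0 <= p.1 k ord0 + g j)%R%:R - F k (p.1 k ord0 + g j).
have mc1 : measurable_fun [set: 'cV[R]_K * 'cV[R]_K] (fun p : 'cV[R]_K * 'cV[R]_K => p.1 k ord0).
  exact: (measurableT_comp (measurable_entry k ord0) measurable_fst).
have mc2 : measurable_fun [set: 'cV[R]_K * 'cV[R]_K] (fun p : 'cV[R]_K * 'cV[R]_K => p.2 k ord0).
  exact: (measurableT_comp (measurable_entry k ord0) measurable_snd).
have bu j : bmf (u j).
  apply: bmfB; first by apply: bmf_bool; apply: measurable_fun_ler => //; exact: measurable_funD.
  exact: (bmf_comp measurable_fst (bmf_shifted_cdf F_lip k (g j))).
have u_le j p : `|u j p| <= 1.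
  have /andP[? ?] := marginal_cdf_itv Q k (p.1 k ord0 + g j).
  by rewrite /u ler_norml; case: (p.2 k ord0 <= _); rewrite ?mulr1n ?mulr0n; apply/andP; split; lra.
have u_mean j x : \int[Q]_y u j (x, y) = 0.
  have b1 : bmf (fun y : 'cV[R]_K => (y k ord0 <= x k ord0 + g j)%R%:R : R).
    by apply: bmf_bool; apply: measurable_fun_ler => //; exact: measurable_entry.
  rewrite /u /= RintB; [|exact: bmf_integrable..].
  by rewrite marginal_cdfE Rint_cst subrr.
have byu j : bmf (fun w => u j (Y i w, Y j w)).
  by apply: (bmf_comp (h := fun w => (Y i w, Y j w))) (bu j); exact: measurable_fun_pair.
pose A w := \sum_(j | j != i) N^-1 * u j (Y i w, Y j w).
have bA : bmf A by apply: bmf_sum => j _; exact: bmfM.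
have E w : ecdf (XX w) k (XX w i k ord0) - F k (Y i w k ord0) =
    A w + (N^-1 * u i (Y i w, Y i w) + N^-1 * \sum_j (F k (Y i w k ord0 + g j) - F k (Y i w k ord0))).
  rewrite (_ : \sum_j (_ - _) = \sum_j F k (Y i w k ord0 + g j) - N * F k (Y i w k ord0)); last first.
    by rewrite sumrB sumr_const card_ord mulr_natl.
  rewrite [N^-1 * (\sum_j _ - _)]mulrBr mulKf ?gt_eqF// !addrA; congr (_ - _).
  rewrite /A -mulr_sumr -!mulrDr; congr (_ * _).
  rewrite [X in X + _](_ : _ = \sum_j u j (Y i w, Y j w)); last by rewrite [RHS](bigD1 i)//= addrC.
  rewrite -big_split; apply: eq_bigr => j _ /=.
  rewrite /u /= subrK; congr (_%:R); rewrite /shifted_sample !mxE addrA lerBrDr.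
  by rewrite /sh; do 2!case: ifP => _; rewrite ?mxE.
have iA : \int[P]_w `|A w| <= s.
  apply: mean_abs_le bA _; first exact: ltW.
  apply: le_trans (iid_sum_sqr_given (0 : 'cV[R]_K) mY indY lawY i N^-1 (c := 1) bu u_le u_mean) _.
  apply: (@le_trans _ _ (\sum_(j < n) (`|N^-1| * 1) ^+ 2)).
    by rewrite [leRHS](bigD1 i)//= lerDr sqr_ge0.
  rewrite [leLHS](_ : _ = N * (`|N^-1| * 1) ^+ 2); last by rewrite sumr_const card_ord mulr_natl.
  rewrite mulr1 real_normK ?num_real// ss expr2 mulrA mulfV ?mul1r//.
  by rewrite gt_eqF.
have Ns : N^-1 <= s.
  rewrite -ss expr2 ler_piMl ?(ltW s_gt0)// invf_le1 ?sqrtr_gt0// -[leLHS]sqrtr1 ler_wsqrtr//.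
  by rewrite ler1n; exact: leq_ltn_trans m_lt.
have rest_le w : `|N^-1 * u i (Y i w, Y i w) + N^-1 * \sum_j (F k (Y i w k ord0 + g j) - F k (Y i w k ord0))|
    <= s + omega.
  apply: le_trans (ler_normD _ _) _; rewrite !normrM gtr0_norm ?invr_gt0//; apply: lerD.
    by rewrite -[leRHS]mulr1; apply: ler_pM => //; rewrite invr_ge0 ltW.
  rewrite ler_pdivrMl//; apply: le_trans (ler_norm_sum _ _ _) _.
  rewrite -[leRHS](_ : \sum_(j < n) omega = _); last by rewrite sumr_const card_ord mulr_natl.
  apply: ler_sum => j _; apply: le_trans (marginal_cdf_dist F_lip _ _ _) _.
  rewrite addrAC subrr add0r ler_wpM2l ?g_le//.
  by have /andP[h1 h2] := F_lip k (ler01 : 0 <= 1 :> R); move: h2; rewrite subr0 mulr1; lra.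
have nA := bmf_norm bA.
apply: (@le_trans _ _ (\int[P]_w (`|A w| + (s + omega)))).
  apply: Rint_le; [|apply: bmf_integrable; exact: bmfD|].
    apply/bmf_integrable/bmf_norm; apply: bmfB; first exact: bmf_ecdf.
    have := bmf_comp (mY i) (bmf_shifted_cdf F_lip k 0); by under eq_fun do rewrite addr0.
  by move=> w; rewrite E; apply: le_trans (ler_normD _ _) _; rewrite lerD2l.
rewrite RintD; [|exact: bmf_integrable..].
by rewrite Rint_cst; lra.
Qed.

End coordinate.

(** Replacing the empirical distribution functions by the true ones costs
    [ecdf_consistent] for each factor; what remains is an average of
    independent bounded variables with mean [rank_cov Q k l]. *)
Lemma rank_cov_hat_consistent k l :
  bmf (fun w => rank_cov_hat (XX w) k l - rank_cov Q k l) /\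
  \int[P]_w `|rank_cov_hat (XX w) k l - rank_cov Q k l| <=
    10 * s + 2 * (M * `|v k ord0|) + 2 * (M * `|v l ord0|).
Proof.
pose G j i w := ecdf (XX w) j (XX w i j ord0).
have bG j i : bmf (G j i) by exact: bmf_ecdf.
pose e j i w := G j i w - F j (Y i w j ord0).
have be j i : bmf (e j i).
  apply: bmfB => //; have := bmf_comp (mY i) (bmf_shifted_cdf F_lip j 0).
  by under eq_fun do rewrite addr0.
pose r y := xi k y * xi l y - rank_cov Q k l.
have bxx : bmf (fun y => xi k y * xi l y) by apply: bmfM; exact: (bmf_centered_cdf F_lip).
have br : bmf r by exact: bmfB.
have r_mean : \int[Q]_y r y = 0.
  by rewrite RintB; [|exact: bmf_integrable..]; rewrite -(rank_covE F_lip) Rint_cst subrr.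
have xx_le y : `|xi k y * xi l y| <= 1.
  by rewrite normrM -[leRHS]mulr1; apply: ler_pM => //; exact: centered_cdf_le1.
have S_le : `|rank_cov Q k l| <= 1.
  by rewrite (rank_covE F_lip); apply: Rint_bound.
have r_le y : `|r y| <= 2.
  by rewrite /r; apply: le_trans (ler_normB _ _) _; have := xx_le y; lra.
have E w : rank_cov_hat (XX w) k l - rank_cov Q k l =
    N^-1 * \sum_i (4 * ((G k i w - 2^-1) * (G l i w - 2^-1)) - xi k (Y i w) * xi l (Y i w)) +
    \sum_i N^-1 * r (Y i w).
  rewrite mxE -mulr_sumr -mulrDr -big_split/=.
  rewrite [X in _ = _ * X](eq_bigr (fun i => 4 * ((G k i w - 2^-1) * (G l i w - 2^-1)) - rank_cov Q k l)); last first.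
    by move=> i _; rewrite /r; ring.
  rewrite sumrB [X in _ = _ * (_ - X)](_ : _ = N * rank_cov Q k l); last by rewrite sumr_const card_ord mulr_natl.
  rewrite mulrBr mulKf ?gt_eqF//; congr (_ - _).
  by rewrite -mulr_sumr mulrA; congr (_ * _); rewrite mulrC.
have b4 i : bmf (fun w => 4 * ((G k i w - 2^-1) * (G l i w - 2^-1)) - xi k (Y i w) * xi l (Y i w)).
  apply: bmfB; last exact: (bmf_comp (mY i) bxx).
  by apply: bmfM => //; apply: bmfM; exact: bmfB.
have bB : bmf (fun w => \sum_i N^-1 * r (Y i w)).
  by apply: bmf_sum => i _; apply: bmfM => //; exact: (bmf_comp (mY i) br).
have bAll : bmf (fun w => rank_cov_hat (XX w) k l - rank_cov Q k l).
  rewrite (funext E).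
  by apply: bmfD => //; apply: bmfM => //; apply: bmf_sum.
split => //.
have iB : \int[P]_w `|\sum_i N^-1 * r (Y i w)| <= 2 * s.
  apply: mean_abs_le bB _; first by rewrite mulr_ge0// ltW.
  apply: le_trans (iid_sum_sqr (0 : 'cV[R]_K) mY indY lawY xpredT (fun=> N^-1) (c := 2) br r_le r_mean) _.
  rewrite [leLHS](_ : _ = N * (`|N^-1| * 2) ^+ 2); last first.
    by rewrite sumr_const mulr_natl; congr (_ *+ _); exact: card_ord.
  rewrite !exprMn real_normK ?num_real// ss exprVn le_eqVlt.
  by apply/orP; left; apply/eqP; field; rewrite gt_eqF.
have p_le i w : `|4 * ((G k i w - 2^-1) * (G l i w - 2^-1)) - xi k (Y i w) * xi l (Y i w)| <=
    2 * `|e k i w| + 2 * `|e l i w|.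
  rewrite (_ : _ - _ = 2 * (e k i w * (2 * (G l i w) - 1)) + 2 * (xi k (Y i w) * e l i w)); last first.
    by rewrite /e /centered_cdf; field.
  have := centered_cdf_le1 Q k (Y i w).
  have /andP[? ?] := ecdf_itv l i w.
  have h : `|2 * G l i w - 1| <= 1 by rewrite ler_norml; apply/andP; split; rewrite /G; lra.
  move=> h'; apply: le_trans (ler_normD _ _) _; rewrite !normrM (ger0_norm (_ : 0 <= 2))//.
  apply: lerD; rewrite ler_wpM2l//; first by rewrite ler_piMr.
  by rewrite ler_piMl.
have ne j i : bmf (fun w => `|e j i w|) by exact: bmf_norm.
have b2 i : bmf (fun w => 2 * `|e k i w| + 2 * `|e l i w|).
  by apply: bmfD; exact: bmfM.
apply: (@le_trans _ _ (\int[P]_w (N^-1 * \sum_i (2 * `|e k i w| + 2 * `|e l i w|) +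
   `|\sum_i N^-1 * r (Y i w)|))).
  have nB := bmf_norm bB.
  apply: Rint_le; [exact/bmf_integrable/bmf_norm| |move=> w].
    by apply: bmf_integrable; apply: bmfD => //; apply: bmfM => //; apply: bmf_sum.
  rewrite E; apply: le_trans (ler_normD _ _) _; rewrite lerD2r normrM gtr0_norm ?invr_gt0//.
  rewrite ler_wpM2l ?invr_ge0 ?(ltW N_gt0)//; apply: le_trans (ler_norm_sum _ _ _) _.
  by apply: ler_sum.
have bS : bmf (fun w => \sum_i (2 * `|e k i w| + 2 * `|e l i w|)) by exact: bmf_sum.
rewrite RintD; last 2 first.
- by apply: bmf_integrable; exact: bmfM.
- exact/bmf_integrable/bmf_norm.
rewrite RintZ; last exact: bmf_integrable.
rewrite Rint_sum; last by move=> i _; exact: bmf_integrable.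
have iS : \sum_(i < n) \int[P]_w (2 * `|e k i w| + 2 * `|e l i w|) <=
    N * (8 * s + 2 * (M * `|v k ord0|) + 2 * (M * `|v l ord0|)).
  rewrite -[leRHS](_ : \sum_(i < n) (8 * s + 2 * (M * `|v k ord0|) + 2 * (M * `|v l ord0|)) = _); last first.
    by rewrite sumr_const card_ord (mulr_natl _ n).
  apply: ler_sum => i _; rewrite RintD; [|apply: bmf_integrable; exact: bmfM..].
  rewrite !RintZ; [|exact: bmf_integrable..].
  by have := ecdf_consistent k i; have := ecdf_consistent l i; rewrite /e /G; lra.
have : N^-1 * \sum_(i < n) \int[P]_w (2 * `|e k i w| + 2 * `|e l i w|) <=
    8 * s + 2 * (M * `|v k ord0|) + 2 * (M * `|v l ord0|).
  by rewrite ler_pdivrMl.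
by lra.
Qed.

End shifted_sample.

(** * The drift of the rank statistic under a local shift *)

Section local_shift.
Context (R : realType) (K : nat) (f : 'cV[R]_K -> R) (Pf : probability 'cV[R]_K R).
Hypothesis Pf_density : has_density Pf f.
Hypothesis f_pos : forall x, 0 < f x.
Hypothesis f_C1 : continuously_differentiable f.
Hypothesis fisher_finite : forall k l : 'I_K, Pf.-integrable [set: 'cV[R]_K]
  (fun x => (score f x k ord0 * score f x l ord0)%:E).
Hypothesis fk_bounded : forall k : 'I_K, exists M : R,
  forall t : R, (marginal_density f k t <= M%:E)%E.

Let f_ge0 x : 0 <= f x. Proof. exact: ltW. Qed.

Let cf : continuous f.
Proof. by move=> x; apply: differentiable_continuous; exact: f_C1.1. Qed.

Lemma measurable_density : measurable_fun [set: 'cV[R]_K] f.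
Proof. exact: continuous_measurable_cV. Qed.

Let mf := measurable_density.

Lemma marginal_cdf_lipschitz_unif : exists M, forall k a b, a <= b ->
  0 <= marginal_cdf Pf k b - marginal_cdf Pf k a <= M * (b - a).
Proof.
have [Mf MfP] := choice fk_bounded.
exists (\sum_k `|Mf k|) => k a b ab.
apply: (marginal_cdf_lipschitz Pf_density mf f_ge0) => // t.
apply: le_trans (MfP k t) _; rewrite lee_fin; apply: le_trans (ler_norm _) _.
by rewrite (bigD1 k)//= lerDl sumr_ge0.
Qed.

Let cgrad l : continuous (fun x => gradient f x l ord0).
Proof.
move=> x; apply: (@continuous_comp _ _ _ (gradient f) (fun y : 'cV[R]_K => y l ord0)).
  exact: f_C1.2.
exact: coord_continuous.
Qed.

Let scoreE x l : gradient f x l ord0 = score f x l ord0 * f x.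
Proof.
rewrite (score_gradient l (f_C1.1 x) (f_pos x)) mulfVK// gt_eqF//.
Qed.

Let mscore l : measurable_fun [set: 'cV[R]_K] (fun x => score f x l ord0).
Proof.
apply: continuous_measurable_cV.
rewrite (_ : (fun _ => _) = fun x => gradient f x l ord0 * (f x)^-1).
  move=> x; have c1 := @cgrad l x; have c2 := @cf x.
  exact: (cvgM c1 (cvgV (lt0r_neq0 (f_pos x)) c2)).
by apply/funext => x; rewrite scoreE mulfK// gt_eqF.
Qed.

Let iscore l : Pf.-integrable [set: 'cV[R]_K] (fun x => (score f x l ord0)%:E).
Proof.
have := integrableD measurableT (bmf_integrable Pf (bmf_cst _ 1)) (fisher_finite l l).
apply: le_integrable => //; first by apply/measurable_EFinP; exact: mscore.
move=> x _; rewrite /= lee_fin [leRHS]ger0_norm; last by rewrite -expr2 addr_ge0 ?sqr_ge0.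
by rewrite ler_norml -expr2; apply/andP; split; nra.
Qed.

(** [shift_expectation] with [w = centered_cdf Pf k] and [v = - delta]. The
    directional derivative of f is f times a combination of the coordinates of
    the score, which turns the Lebesgue integral into the expectation that
    defines the matrix A. *)
Lemma rank_drift_expansion (delta : 'cV[R]_K) (k : 'I_K) : exists2 B, 0 <= B & forall s, 0 < s ->
  `|rank_drift Pf k (s * delta k ord0) + 2 * s * (rank_score_cross Pf f *m delta) k ord0| <= B * s ^+ 2.
Proof.
have [M F_lip] := marginal_cdf_lipschitz_unif.
pose w := centered_cdf Pf k.
have bw : bmf w by exact: (bmf_centered_cdf F_lip).
have dirE x : 'D_(- delta) f x = \sum_l - delta l ord0 * gradient f x l ord0.
  by rewrite (gradient_dir _ (f_C1.1 x)); apply: eq_bigr => l _; rewrite mxE.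
have cg : continuous (fun x => 'D_(- delta) f x).
  rewrite (funext dirE); apply: continuous_bigsum => l x.
  have c1 := @cgrad l x; exact: (cvgM (cvg_cst _) c1).
pose G x := \sum_l - delta l ord0 * score f x l ord0.
have GfE x : 'D_(- delta) f x = G x * f x.
  by rewrite dirE mulr_suml; apply: eq_bigr => l _; rewrite scoreE mulrA.
have iZ (h : 'cV[R]_K -> R) (a : R) : Pf.-integrable [set: 'cV[R]_K] (EFin \o h) ->
    Pf.-integrable [set: 'cV[R]_K] (EFin \o (fun x => a * h x)).
  by move=> ih; have := integrableZl measurableT a ih; apply: eq_integrable.
have iG : Pf.-integrable [set: 'cV[R]_K] (EFin \o G).
  by apply: int_sum => l _; apply: iZ; exact: iscore.
have mG : measurable_fun [set: 'cV[R]_K] G.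
  by apply: measurable_sum => l; apply: measurable_funM => //.
have ig : (lebesgue_cV K).-integrable [set: 'cV[R]_K] (EFin \o (fun x => 'D_(- delta) f x)).
  rewrite (funext GfE).
  exact: ((integral_density mf f_ge0 Pf_density mG).1).1.
have iws l : Pf.-integrable [set: 'cV[R]_K] (EFin \o (fun x => w x * score f x l ord0)).
  rewrite (_ : EFin \o _ = (EFin \o w) \* (fun x => (score f x l ord0)%:E))%E.
    apply: integrableMr => //; first exact: bmf_meas.
    have [_ [C wC]] := bw; exists C; split; first exact: num_real.
    by move=> N CN x _; exact: le_trans (wC x) (ltW CN).
  by apply/funext => x /=; rewrite EFinM.
pose L := 2 * (M * `|delta k ord0|).
have M0 : 0 <= M by have /andP[h1 h2] := F_lip k _ _ (ler01 : 0 <= 1 :> R); move: h2; rewrite subr0 mulr1; lra.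
have L0 : 0 <= L by rewrite !mulr_ge0.
exists (L * \int[@lebC R K]_x `|'D_(- delta) f x|).
  by rewrite mulr_ge0//; apply: Rintegral_ge0.
move=> s s0.
have wL (x : 'cV[R]_K) (u : R) : 0 <= u <= s -> `|w (x - u *: - delta) - w x| <= L * u.
  move=> /andP[u0 _]; have := centered_cdf_shift F_lip k x (u * delta k ord0).
  rewrite normrM (ger0_norm u0) /w /centered_cdf !mxE mulrN opprK /L.
  by rewrite (_ : 2 * (M * (u * `|delta k ord0|)) = 2 * (M * `|delta k ord0|) * u)//; ring.
have := shift_expectation Pf_density mf f_ge0 f_C1.1 cg ig (bmf_meas bw) (centered_cdf_le1 Pf k) s0 wL.
rewrite (centered_cdf_mean F_lip) subr0.
have -> : \int[Pf]_x w (x - s *: - delta) = rank_drift Pf k (s * delta k ord0).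
  by apply: eq_Rintegral => x _; rewrite /w /centered_cdf !mxE mulrN opprK.
have -> : \int[@lebC R K]_x (w x * 'D_(- delta) f x) = - (2 * (rank_score_cross Pf f *m delta) k ord0).
  transitivity (\int[@lebC R K]_x ((w x * G x) * f x)).
    by apply: eq_Rintegral => x _; rewrite GfE mulrA.
  have mwG : measurable_fun [set: 'cV[R]_K] (fun x => w x * G x) by apply: measurable_funM => //; exact: bmf_meas.
  rewrite -[LHS](integral_density mf f_ge0 Pf_density mwG).2.
  transitivity (\int[Pf]_x (\sum_l - delta l ord0 * (w x * score f x l ord0))).
    by apply: eq_Rintegral => x _; rewrite mulr_sumr; apply: eq_bigr => l _; rewrite mulrCA.
  rewrite Rint_sum; last by move=> l _; exact: iZ.
  rewrite mxE mulr_sumr -sumrN; apply: eq_bigr => l _.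
  rewrite RintZ; last exact: iws.
  have -> : rank_score_cross Pf f k l = 2^-1 * \int[Pf]_x (w x * score f x l ord0).
    rewrite mxE unlock -RintZ; last exact: iws.
    by apply: eq_Rintegral => x _; rewrite /w /centered_cdf; field.
  by field.
rewrite (_ : _ - _ = rank_drift Pf k (s * delta k ord0) + 2 * s * (rank_score_cross Pf f *m delta) k ord0); last by ring.
by rewrite [L * _ * s ^+ 2]mulrAC.
Qed.

End local_shift.

(** * The statistic of a finite sample *)

Lemma ler_term_sum (R : realType) (I : finType) (F : I -> R) i :
  (forall j, 0 <= F j) -> F i <= \sum_j F j.
Proof. by move=> F0; rewrite (bigD1 i)//= lerDl sumr_ge0. Qed.

Section finite_sample.
Context d (T : measurableType d) (R : realType) (P : probability T R) (K n : nat).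
Variables (Y : 'I_n -> T -> 'cV[R]_K) (Q : probability 'cV[R]_K R).
Hypothesis mY : forall i, measurable_fun [set: T] (Y i).
Hypothesis indY : forall B : 'I_n -> set 'cV[R]_K, (forall i, measurable (B i)) ->
  P [set w | forall i, B i (Y i w)] = (\prod_(i < n) P (Y i @^-1` B i))%E.
Hypothesis lawY : forall i D, measurable D -> P (Y i @^-1` D) = Q D.
Variable M : R.
Hypothesis F_lip : forall k a b, a <= b ->
  0 <= marginal_cdf Q k b - marginal_cdf Q k a <= M * (b - a).
Variables (m : nat) (v : 'cV[R]_K).
Hypotheses (m_gt0 : (0 < m)%N) (m_lt : (m < n)%N).
Variables (B : 'M[R]_K) (mu : 'cV[R]_K).
Hypothesis whiteB : B *m rank_cov Q *m B^T = 1%:M.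

Local Notation N := (n%:R : R).
Local Notation s := ((Num.sqrt N)^-1).
Local Notation D := (rank_scale R n m).
Local Notation XX w := (shifted_sample Y m v w).
Local Notation a i := (rank_weight R m i).

Definition centered_cdfs (y : 'cV[R]_K) : 'cV[R]_K := \col_k centered_cdf Q k y.
Local Notation xi := centered_cdfs.

Definition linear_part w : 'cV[R]_K := mu + \sum_i a i *: xi (Y i w).
Local Notation V := linear_part.

Definition entry_sum : R := \sum_k \sum_l `|B k l|.

Let bcc k := bmf_centered_cdf F_lip k.

Let zetaE y k : (B *m xi y) k ord0 = \sum_l B k l * centered_cdf Q l y.
Proof. by rewrite mxE; apply: eq_bigr => l _; rewrite mxE. Qed.

Let bz k : bmf (fun y => (B *m xi y) k ord0).
Proof. by under eq_fun do rewrite zetaE; apply: bmf_sum => l _; exact: bmfM. Qed.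

Let z_le y k : `|(B *m xi y) k ord0| <= entry_sum.
Proof.
rewrite zetaE; apply: le_trans (ler_norm_sum _ _ _) _.
apply: le_trans (ler_term_sum (F := fun k => \sum_l `|B k l|) k _); last by move=> j; exact: sumr_ge0.
by apply: ler_sum => l _; rewrite normrM ler_piMr ?centered_cdf_le1.
Qed.

Let z_mean k : \int[Q]_y (B *m xi y) k ord0 = 0.
Proof.
under eq_Rintegral do rewrite zetaE.
rewrite Rint_sum; last by move=> l _; apply: bmf_integrable; exact: bmfM.
rewrite big1// => l _; rewrite RintZ; last exact: bmf_integrable.
by rewrite (centered_cdf_mean F_lip) mulr0.
Qed.

Let z_cov k l : \int[Q]_y ((B *m xi y) k ord0 * (B *m xi y) l ord0) = (k == l)%:R.
Proof.
have b2 i j : bmf (fun y => centered_cdf Q i y * centered_cdf Q j y) by exact: bmfM.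
transitivity (\int[Q]_y (\sum_j \sum_i B k i * B l j * (centered_cdf Q i y * centered_cdf Q j y))).
  apply: eq_Rintegral => y _; rewrite !zetaE mulr_sumr; apply: eq_bigr => j _.
  by rewrite mulr_suml; apply: eq_bigr => i _; rewrite mulrACA.
rewrite Rint_sum; last by move=> j _; apply: bmf_integrable; apply: bmf_sum => i _; exact: bmfM.
transitivity ((B *m rank_cov Q *m B^T) k l); last by rewrite whiteB mxE.
rewrite mxE; apply: eq_bigr => j _; rewrite Rint_sum; last by move=> i _; apply: bmf_integrable; exact: bmfM.
rewrite !mxE mulr_suml; apply: eq_bigr => i _.
rewrite RintZ; last exact: bmf_integrable.
by rewrite -(rank_covE F_lip) mulrAC.
Qed.

Let VE w k : V w k ord0 = mu k ord0 + \sum_i a i * centered_cdf Q k (Y i w).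
Proof. by rewrite mxE summxE; congr (_ + _); apply: eq_bigr => i _; rewrite !mxE. Qed.

Let bV k : bmf (fun w => V w k ord0).
Proof.
under eq_fun do rewrite VE; apply: bmfD => //; apply: bmf_sum => i _; apply: bmfM => //.
exact: (bmf_comp (mY i) (bcc k)).
Qed.

Let qV w : qform (invmx (rank_cov Q)) (V w) = sqnorm (B *m mu + \sum_i a i *: (B *m xi (Y i w))).
Proof.
rewrite (whiten_invmx whiteB).2 (_ : B *m mu + _ = B *m V w).
  by rewrite -sqnormE trmx_mul /qform !mulmxA.
by rewrite mulmxDr mulmx_sumr; congr (_ + _); apply: eq_bigr => i _; rewrite scalemxAr.
Qed.

Variables (Sn : T -> R) (C Cb eta e x : R).
Hypothesis mSn : measurable_fun [set: T] Sn.
Hypothesis SnE : forall w, rank_cov_hat (XX w) \in unitmx -> Sn w = change_statistic (XX w) m.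
Hypotheses (C0 : 0 <= C) (Cb0 : 0 < Cb) (eta0 : 0 < eta) (e0 : 0 < e).
Hypothesis near : forall (H : 'M[R]_K) (u z : 'cV[R]_K),
  (forall i j, `|H i j - rank_cov Q i j| <= eta) -> (forall i, `|z i ord0| <= Cb) ->
  (forall i, `|u i ord0 - z i ord0| <= eta) ->
  H \in unitmx /\ `|qform (invmx H) u - qform (invmx (rank_cov Q)) z| <= e.
Hypothesis s1 : smooth C (radial_cutoff (B *m mu) (x + e) e).
Hypothesis s2 : smooth C (radial_cutoff (B *m mu) (x - 4 * e) e).

(** The Lindeberg error, the mean distances to the limits of the matrix and of
    the vector measured in units of the tolerance [eta], and Markov's bound for
    the event that the linear part leaves the ball of radius [Cb]. *)
Definition sample_bound : R :=
  C * (K%:R * ((entry_sum ^+ 3 + 2) * (N / D))) +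
  (eta^-1 * (\sum_k \sum_l (10 * s + 2 * (M * `|v k ord0|) + 2 * (M * `|v l ord0|)) +
     \sum_k (4 * s + 8 * (M * `|v k ord0|) +
       `|m%:R * (n%:R - m%:R) / D * rank_drift Q k (v k ord0) - mu k ord0|)) +
   Cb^-1 * \sum_k (`|mu k ord0| + 1)).

(** If the matrix and the vector are within [eta] of their approximations and the
    linear part is bounded by [Cb], the statistic is within [e] of the whitened
    squared norm; the failure of each condition is dominated by a multiple of
    the corresponding absolute value, whose mean is known. *)
Lemma statistic_cdf_sandwich :
  radial_cdf (B *m mu) (x - 4 * e) - sample_bound <= fine (P [set w | Sn w <= x])
    <= radial_cdf (B *m mu) (x + 4 * e) + sample_bound.
Proof.
pose h k l w := rank_cov_hat (XX w) k l - rank_cov Q k l.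
pose r k w := rank_vector (XX w) m k ord0 - V w k ord0.
have bh k l : bmf (h k l) := (rank_cov_hat_consistent mY indY lawY F_lip v m_lt k l).1.
have ih k l := (rank_cov_hat_consistent mY indY lawY F_lip v m_lt k l).2.
pose rest k w := rank_vector (XX w) m k ord0 - \sum_i a i * centered_cdf Q k (Y i w) -
  m%:R * (n%:R - m%:R) / D * rank_drift Q k (v k ord0).
have brest k : bmf (rest k) := (rank_vector_linear mY indY lawY F_lip v m_gt0 m_lt k).1.
have irest k : \int[P]_w `|rest k w| <= _ := (rank_vector_linear mY indY lawY F_lip v m_gt0 m_lt k).2.
pose b k := m%:R * (n%:R - m%:R) / D * rank_drift Q k (v k ord0) - mu k ord0.
have rE k w : r k w = rest k w + b k by rewrite /r VE /rest /b; ring.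
have br k : bmf (r k) by rewrite (funext (rE k)); exact: bmfD.
have nr k := bmf_norm (br k); have nh k l := bmf_norm (bh k l); have nV k := bmf_norm (bV k).
pose g w := eta^-1 * (\sum_k \sum_l `|h k l w| + \sum_k `|r k w|) + Cb^-1 * \sum_k `|V w k ord0|.
have bhs : bmf (fun w => \sum_k \sum_l `|h k l w|).
  by apply: bmf_sum => k _; apply: bmf_sum => l _.
have brs : bmf (fun w => \sum_k `|r k w|) by apply: bmf_sum.
have bVs : bmf (fun w => \sum_k `|V w k ord0|) by apply: bmf_sum.
have bg : bmf g by apply: bmfD; apply: bmfM => //; exact: bmfD.
have [etai Cbi] : 0 < eta^-1 /\ 0 < Cb^-1 by rewrite !invr_gt0.
have hs0 w : 0 <= \sum_k \sum_l `|h k l w| by apply: sumr_ge0 => k _; exact: sumr_ge0.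
have rs0 w : 0 <= \sum_k `|r k w| by exact: sumr_ge0.
have Vs0 w : 0 <= \sum_k `|V w k ord0| by exact: sumr_ge0.
have g0 w : 0 <= g w by rewrite /g addr_ge0// mulr_ge0 ?(ltW etai) ?(ltW Cbi)// addr_ge0.
have gP w : e < `|Sn w - sqnorm (B *m mu + \sum_i a i *: (B *m xi (Y i w)))| -> 1 <= g w.
  rewrite -qV; apply: contraTT; rewrite -ltNge -leNgt => g1.
  have hb : \sum_k \sum_l `|h k l w| <= eta.
    rewrite -[leRHS]mulr1 -ler_pdivrMl//; apply: le_trans (ltW g1).
    have := mulr_ge0 (ltW Cbi) (Vs0 w); have := mulr_ge0 (ltW etai) (rs0 w).
    by rewrite /g mulrDr; lra.
  have rb : \sum_k `|r k w| <= eta.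
    rewrite -[leRHS]mulr1 -ler_pdivrMl//; apply: le_trans (ltW g1).
    have := mulr_ge0 (ltW Cbi) (Vs0 w); have := mulr_ge0 (ltW etai) (hs0 w).
    by rewrite /g mulrDr; lra.
  have Vb : \sum_k `|V w k ord0| <= Cb.
    rewrite -[leRHS]mulr1 -ler_pdivrMl//; apply: le_trans (ltW g1).
    by rewrite /g lerDr mulr_ge0 ?(ltW etai)// addr_ge0.
  have [Hu Hq] := near (H := rank_cov_hat (XX w)) (u := rank_vector (XX w) m) (z := V w)
    (fun i j => le_trans (le_trans (ler_term_sum (F := fun j => `|h i j w|) j (fun=> normr_ge0 _))
       (ler_term_sum (F := fun i => \sum_j `|h i j w|) i (fun=> sumr_ge0 _ (fun _ _ => normr_ge0 _)))) hb)
    (fun i => le_trans (ler_term_sum (F := fun i => `|V w i ord0|) i (fun=> normr_ge0 _)) Vb)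
    (fun i => le_trans (ler_term_sum (F := fun i => `|r i w|) i (fun=> normr_ge0 _)) rb).
  by rewrite (SnE Hu).
have n0 : (0 < n)%N by exact: leq_ltn_trans m_lt.
have /andP[lo hi] := cdf_sandwich (0 : 'cV[R]_K) mY indY lawY (fun k => bmf_meas (bz k)) z_le z_mean z_cov
  (rank_weight_neq0 R m_gt0 m_lt) (rank_weight_sqr R m_gt0 m_lt) n0 C0 e0 s1 s2 mSn bg g0 gP.
have cube := rank_weight_cube R m_gt0 m_lt.
have es0 : 0 <= entry_sum by apply: sumr_ge0 => k _; exact: sumr_ge0.
have iV k : \int[P]_w `|V w k ord0| <= `|mu k ord0| + 1.
  have bl : bmf (fun w => \sum_i a i * centered_cdf Q k (Y i w)).
    by apply: bmf_sum => i _; apply: bmfM => //; exact: (bmf_comp (mY i) (bcc k)).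
  have nl := bmf_norm bl.
  apply: (@le_trans _ _ (\int[P]_w (`|mu k ord0| + `|\sum_i a i * centered_cdf Q k (Y i w)|))).
    apply: Rint_le; [exact: bmf_integrable|by apply: bmf_integrable; exact: bmfD|].
    by move=> w; rewrite VE; exact: ler_normD.
  rewrite RintD; [|exact: bmf_integrable..]; rewrite Rint_cst lerD2l.
  exact: (linear_part_mean mY indY lawY F_lip m_gt0 m_lt).
have ir k : \int[P]_w `|r k w| <= 4 * s + 8 * (M * `|v k ord0|) + `|b k|.
  have nrest := bmf_norm (brest k).
  apply: (@le_trans _ _ (\int[P]_w (`|rest k w| + `|b k|))).
    apply: Rint_le; [exact: bmf_integrable|by apply: bmf_integrable; exact: bmfD|].
    by move=> w; rewrite rE; exact: ler_normD.
  by rewrite RintD; [|exact: bmf_integrable..]; rewrite Rint_cst lerD2r.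
have ig : \int[P]_w g w <=
    eta^-1 * (\sum_k \sum_l (10 * s + 2 * (M * `|v k ord0|) + 2 * (M * `|v l ord0|)) +
     \sum_k (4 * s + 8 * (M * `|v k ord0|) + `|b k|)) + Cb^-1 * \sum_k (`|mu k ord0| + 1).
  rewrite RintD; [|apply: bmf_integrable; apply: bmfM => //; exact: bmfD|apply: bmf_integrable; exact: bmfM].
  rewrite !RintZ; [|exact: bmf_integrable|apply: bmf_integrable; exact: bmfD].
  rewrite RintD; [|exact: bmf_integrable..].
  apply: lerD; rewrite ler_wpM2l ?(ltW etai) ?(ltW Cbi)//.
    apply: lerD; rewrite Rint_sum; [|by move=> k _; apply: bmf_integrable => //; apply: bmf_sum|
       |by move=> k _; exact: bmf_integrable].
    - apply: ler_sum => k _; rewrite Rint_sum; last by move=> l _; exact: bmf_integrable.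
      by apply: ler_sum => l _; exact: ih.
    - by apply: ler_sum => k _; exact: ir.
  rewrite Rint_sum; last by move=> k _; exact: bmf_integrable.
  by apply: ler_sum => k _; exact: iV.
have ierr : C * (K%:R * ((entry_sum ^+ 3 + 2) * \sum_(i < n) `|a i| ^+ 3)) + \int[P]_w g w <= sample_bound.
  rewrite /sample_bound; apply: lerD; last exact: ig.
  by rewrite ler_wpM2l// ler_wpM2l// ler_wpM2l// addr_ge0// exprn_ge0.
by apply/andP; split; [apply: le_trans lo; rewrite lerD2l lerN2 | apply: le_trans hi _; rewrite lerD2l].
Qed.

End finite_sample.

(** * Passage to the limit *)

Lemma density_unshift (R : realType) K (Q P' : probability 'cV[R]_K R) (f : 'cV[R]_K -> R) (c : 'cV[R]_K) :
  measurable_fun [set: 'cV[R]_K] f -> (forall x, 0 <= f x) -> has_density Q f ->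
  has_density P' (fun x => f (x - c)) ->
  forall D, measurable D -> P' ((fun x => x - c) @^-1` D) = Q D.
Proof.
move=> mf f0 Qf P'f D mD.
have mD' : measurable ((fun x => x - c) @^-1` D).
  by rewrite -[X in measurable X]setTI; exact: (measurable_translate_cV (- c)).
rewrite P'f// Qf// !(integral_mkcond _ (fun _ => _%:E)).
rewrite -[RHS](ge0_integral_lebesgue_cV_translate (- c)).
- by apply: eq_integral => x _; rewrite /patch.
- by apply/measurable_restrict => //; rewrite ?setTI; apply/measurable_EFinP; exact: measurable_funS mf.
- by move=> x; rewrite /patch; case: ifP => // _; rewrite lee_fin.
Qed.

Lemma smooth_mono (R : realType) K (C C' : R) (phi : 'cV[R]_K -> R) : C <= C' ->
  smooth C phi -> smooth C' phi.
Proof.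
move=> CC' [D [H [bp bD bH tp]]]; exists D, H; split => // x y.
by apply: le_trans (tp x y) _; rewrite ler_wpM2r ?cube_norm_ge0.
Qed.

Lemma inv_sqrt_cvg0 (R : realType) : (Num.sqrt n%:R)^-1 @[n --> \oo] --> (0 : R).
Proof.
apply/cvgrPdist_le => e e0; have := nbhs_infty_ger ((e ^- 1) ^+ 2 + 1).
apply: filterS => n ne; have i0 : 0 < e ^- 1 by rewrite invr_gt0.
have n0 : 0 < n%:R :> R by apply: lt_le_trans ne; rewrite ltr_wpDl ?sqr_ge0.
rewrite sub0r normrN gtr0_norm ?invr_gt0 ?sqrtr_gt0// -[leRHS]invrK.
rewrite lef_pV2 ?posrE ?sqrtr_gt0// -[leLHS](ger0_norm (ltW i0)) -sqrtr_sqr ler_wsqrtr//.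
by apply: le_trans ne; rewrite lerDl.
Qed.

Lemma sandwich_dist (R : realType) (l p q u E eps : R) : p - E <= u -> u <= q + E -> E <= eps / 2 ->
  `|l - p| <= eps / 2 -> `|l - q| <= eps / 2 -> `|l - u| <= eps.
Proof. by rewrite !ler_norml => ? ? ? /andP[? ?] /andP[? ?]; apply/andP; split; lra. Qed.

Section theorem.
Context (R : realType) (K : nat) (K_gt0 : (0 < K)%N).
Context (f : 'cV[R]_K -> R) (Pf : probability 'cV[R]_K R).
Hypothesis Pf_density : has_density Pf f.
Hypothesis f_pos : forall x, 0 < f x.
Hypothesis f_C1 : continuously_differentiable f.
Variable delta : 'cV[R]_K.
Hypothesis Sigma_pd : posdef (rank_cov Pf).
Hypothesis fisher_finite : forall k l : 'I_K, Pf.-integrable [set: 'cV[R]_K]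
  (fun x => (score f x k ord0 * score f x l ord0)%:E).
Hypothesis fk_bounded : forall k : 'I_K, exists M : R,
  forall t : R, (marginal_density f k t <= M%:E)%E.

Variables (d : nat -> measure_display) (T : forall n, measurableType (d n)).
Variables (P : forall n, probability (T n) R).
Variables (X : forall n, 'I_n -> {RV (P n) >-> 'cV[R]_K}) (n1 : nat -> nat).
Arguments X : clear implicits.
Hypothesis X_indep : forall n,
  independent_family (P n) (fun i : 'I_n => X n i : T n -> 'cV[R]_K).
Hypothesis X_before : forall n (i : 'I_n), (i < n1 n)%N ->
  has_density (distribution (P n) (X n i)) f.
Hypothesis X_after : forall n (i : 'I_n), (n1 n <= i)%N ->
  has_density (distribution (P n) (X n i))
    (fun x => f (x - (Num.sqrt n%:R)^-1 *: delta)).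

Local Notation sn n := ((Num.sqrt n%:R)^-1 : R).
Local Notation shift n i := (if (n1 n <= i)%N then sn n *: delta else 0).

Let mf := measurable_density f_C1.
Let f_ge0 x : 0 <= f x. Proof. exact: ltW. Qed.

(** The observations with the deterministic shift removed: all have density f. *)
Definition centered_sample n (i : 'I_n) (w : T n) : 'cV[R]_K := X n i w - shift n i.
Local Notation Y n := (@centered_sample n).

Lemma measurable_centered_sample n i : measurable_fun [set: T n] (Y n i).
Proof. exact: (measurableT_comp (measurable_translate_cV (- shift n i))). Qed.

Lemma centered_sample_law n i D : measurable D -> P n (Y n i @^-1` D) = Pf D.
Proof.
move=> mD; have hd : has_density (distribution (P n) (X n i)) (fun x => f (x - shift n i)).
  case: leqP => h; first exact: X_after.
  by rewrite (_ : (fun x => _) = f); [exact: X_before | apply/funext => x; rewrite subr0].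
exact: (density_unshift mf f_ge0 Pf_density hd mD).
Qed.

Lemma centered_sample_indep n (B : 'I_n -> set 'cV[R]_K) : (forall i, measurable (B i)) ->
  P n [set w | forall i, B i (Y n i w)] = (\prod_(i < n) P n (Y n i @^-1` B i))%E.
Proof.
move=> mB; pose B' (i : 'I_n) := (fun x : 'cV[R]_K => x - shift n i) @^-1` B i.
have mB' i : measurable (B' i).
  by rewrite -[X in measurable X]setTI; exact: (measurable_translate_cV (- shift n i)).
have := X_indep (J := [set: 'I_n]%SET) (B := B') (fun i _ => mB' i).
rewrite (_ : \bigcap_(i in _) _ = [set w | forall i, B i (Y n i w)]).
  move=> ->; apply: eq_bigl => i; by rewrite inE.
by apply/seteqP; split => w /= H i; [apply: H; rewrite /= inE | move=> _; exact: H].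
Qed.

Lemma shifted_centered_sample n w :
  shifted_sample (Y n) (n1 n) (sn n *: delta) w = (fun i => X n i w).
Proof. by apply/funext => i; rewrite /shifted_sample /centered_sample subrK. Qed.

Variables (S : forall n, {RV (P n) >-> R}).
Arguments S : clear implicits.
Hypothesis S_def : forall n w, rank_cov_hat (fun i => X n i w) \in unitmx ->
  S n w = change_statistic (fun i => X n i w) (n1 n).
Variables (t1 : R) (t1_gt0 : 0 < t1) (t1_lt1 : t1 < 1).
Hypothesis n1_cvg : (n1 n)%:R / n%:R @[n --> \oo] --> t1.

Local Notation rn n := (Num.sqrt ((n1 n)%:R / n%:R * (1 - (n1 n)%:R / n%:R)) : R).
Local Notation r0 := (Num.sqrt (t1 * (1 - t1))).

Lemma rn_cvg : rn n @[n --> \oo] --> r0.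
Proof.
apply: continuous_cvg; first exact: sqrt_continuous.
by apply: cvgM; [exact: n1_cvg | apply: cvgB; [exact: cvg_cst | exact: n1_cvg]].
Qed.

Let r0_gt0 : 0 < r0. Proof. by rewrite sqrtr_gt0 mulr_gt0// subr_gt0. Qed.

Lemma split_interior : \forall n \near \oo, (0 < n1 n < n)%N.
Proof.
have h1 := cvgr_gt _ n1_cvg _ t1_gt0.
have h2 := cvgr_lt _ n1_cvg _ t1_lt1.
near=> n; have n_gt0 : (0 < n)%N by near: n; exact: nbhs_infty_gt.
have a1 : 0 < (n1 n)%:R / n%:R :> R by near: n; exact: h1.
have a2 : (n1 n)%:R / n%:R < 1 :> R by near: n; exact: h2.
have n0 : 0 < n%:R :> R by rewrite ltr0n.
by move: a1 a2; rewrite pmulr_lgt0 ?invr_gt0// ltr0n ltr_pdivrMr// mul1r ltr_nat => -> ->.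
Unshelve. all: by end_near.
Qed.

Lemma rank_scaleE n : (0 < n1 n < n)%N ->
  n%:R / rank_scale R n (n1 n) = sn n / rn n /\
  (n1 n)%:R * (n%:R - (n1 n)%:R) / rank_scale R n (n1 n) = rn n / sn n.
Proof.
move=> /andP[m0 mn]; have n0 : (0 < n)%N by exact: leq_ltn_trans mn.
rewrite /rank_scale; set N := n%:R : R; set m := (n1 n)%:R : R.
have N0 : 0 < N by rewrite ltr0n.
have N10 : 0 < m by rewrite ltr0n.
have N20 : 0 < N - m by rewrite subr_gt0 ltr_nat.
have rE : m / N * (1 - m / N) = (m * (N - m)) / N ^+ 2 by field; rewrite gt_eqF.
have r20 : 0 < m / N * (1 - m / N) by rewrite rE divr_gt0 ?mulr_gt0// exprn_gt0.
set q := Num.sqrt N; set r := Num.sqrt (m / N * _).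
have q0 : 0 < q by rewrite sqrtr_gt0.
have rr0 : 0 < r by rewrite sqrtr_gt0.
have qq : q ^+ 2 = N by rewrite sqr_sqrtr// ltW.
have rr : r ^+ 2 = (m * (N - m)) / N ^+ 2 by rewrite sqr_sqrtr ?rE// -rE ltW.
have NN : m * (N - m) = r ^+ 2 * N ^+ 2 by rewrite rr divfK// expf_neq0// gt_eqF.
have DE : Num.sqrt (N * m * (N - m)) = q ^+ 3 * r.
  rewrite -mulrA NN -qq (_ : q ^+ 2 * (r ^+ 2 * (q ^+ 2) ^+ 2) = (q ^+ 3 * r) ^+ 2); last by ring.
  by rewrite sqrtr_sqr ger0_norm// mulr_ge0 ?exprn_ge0// ltW.
rewrite DE NN -qq; split; field; by rewrite !gt_eqF.
Qed.

Let A := rank_score_cross Pf f.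
Let mu : 'cV[R]_K := (- (2 * r0)) *: (A *m delta).
Let dpar := 4 * t1 * (1 - t1) *
  (delta^T *m A^T *m invmx (rank_cov Pf) *m A *m delta) ord0 ord0.

Lemma noncentralityE : qform (invmx (rank_cov Pf)) mu = dpar.
Proof.
have r02 : r0 ^+ 2 = t1 * (1 - t1) by rewrite sqr_sqrtr// mulr_ge0 ?subr_ge0//; exact: ltW.
have muT : mu^T = (- (2 * r0)) *: (A *m delta)^T by rewrite /mu linearZ.
rewrite /qform muT /mu -!scalemxAl -scalemxAr scalerA mxE trmx_mul !mulmxA.
by congr (_ * _); transitivity (4 * r0 ^+ 2); [ring | rewrite r02; ring].
Qed.

(** Each contribution is a constant times s / r, s, r s or |r - r0|, where
    s = 1 / sqrt n and r is the empirical counterpart of r0 = sqrt (t1 (1 - t1)). *)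
Lemma sample_bound_vanish M B C Cb eta e : 0 <= M -> 0 < eta -> 0 < e ->
  (forall s k, 0 < s -> `|rank_drift Pf k (s * delta k ord0) + 2 * s * (A *m delta) k ord0|
     <= B k * s ^+ 2) ->
  Cb^-1 * \sum_k (`|mu k ord0| + 1) <= e / 2 ->
  forall (L : 'M[R]_K),
  \forall n \near \oo, sample_bound n Pf M (n1 n) (sn n *: delta) L mu C Cb eta <= e.
Proof.
move=> M0 eta0 e0 BP Cbe L.
pose a1 := C * (K%:R * (entry_sum L ^+ 3 + 2)).
pose a2 := eta^-1 * (\sum_k \sum_l (10 + 2 * (M * `|delta k ord0|) + 2 * (M * `|delta l ord0|)) +
  \sum_k (4 + 8 * (M * `|delta k ord0|))).
pose a3 := eta^-1 * \sum_k B k.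
pose a4 := eta^-1 * \sum_k (2 * `|(A *m delta) k ord0|).
have lim : a1 * (sn n / rn n) + a2 * sn n + a3 * (rn n * sn n) + a4 * `|rn n - r0| @[n --> \oo] -->
    a1 * (0 / r0) + a2 * 0 + a3 * (r0 * 0) + a4 * `|r0 - r0|.
  have sc := @inv_sqrt_cvg0 R; have rc := rn_cvg.
  apply: cvgD; [apply: cvgD; [apply: cvgD|]|].
  - apply: cvgM; first exact: cvg_cst.
    by apply: cvgM => //; apply: cvgV => //; exact: lt0r_neq0.
  - by apply: cvgM => //; exact: cvg_cst.
  - by apply: cvgM; [exact: cvg_cst | exact: cvgM].
  - by apply: cvgM; [exact: cvg_cst | apply: cvg_norm; apply: cvgB => //; exact: cvg_cst].
rewrite mul0r !mulr0 subrr normr0 mulr0 !addr0 in lim.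
have e2 : 0 < e / 2 by rewrite divr_gt0.
have small := cvgr_lt _ lim _ e2.
near=> n; have mn : (0 < n1 n < n)%N by near: n; exact: split_interior.
have [m0 mlt] := andP mn; have n0 : (0 < n)%N by exact: leq_ltn_trans mlt.
have sl : a1 * (sn n / rn n) + a2 * sn n + a3 * (rn n * sn n) + a4 * `|rn n - r0| < e / 2.
  by near: n; exact: small.
have [D1 D2] := rank_scaleE mn.
have s0 : 0 < sn n by rewrite invr_gt0 sqrtr_gt0 ltr0n.
have q_neq0 : Num.sqrt n%:R != 0 :> R by rewrite gt_eqF// sqrtr_gt0 ltr0n.
have r_ge0 : 0 <= rn n by exact: sqrtr_ge0.
rewrite /sample_bound D1 D2.
have etai : 0 < eta^-1 by rewrite invr_gt0.
have vE k : `|(sn n *: delta) k ord0| = sn n * `|delta k ord0| by rewrite mxE normrM gtr0_norm.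
have muE k : mu k ord0 = - (2 * r0) * (A *m delta) k ord0 by rewrite /mu mxE.
have b_le k : `|rn n / sn n * rank_drift Pf k ((sn n *: delta) k ord0) - mu k ord0| <=
    B k * (rn n * sn n) + 2 * `|(A *m delta) k ord0| * `|rn n - r0|.
  rewrite (_ : _ - _ = rn n / sn n * (rank_drift Pf k (sn n * delta k ord0) + 2 * sn n * (A *m delta) k ord0)
     - 2 * (A *m delta) k ord0 * (rn n - r0)); last first.
    rewrite muE [(_ *: delta) k ord0]mxE; by field.
  apply: le_trans (ler_normB _ _) _; apply: lerD.
    rewrite normrM ger0_norm; last by rewrite divr_ge0// ltW.
    apply: le_trans (ler_wpM2l _ (BP _ k s0)) _; first by rewrite divr_ge0// ltW.
    rewrite le_eqVlt; apply/orP; left; apply/eqP; by field.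
  by rewrite !normrM (ger0_norm (_ : 0 <= 2)).
have S1 : \sum_k \sum_l (10 * sn n + 2 * (M * `|(sn n *: delta) k ord0|) + 2 * (M * `|(sn n *: delta) l ord0|))
  = (\sum_k \sum_l (10 + 2 * (M * `|delta k ord0|) + 2 * (M * `|delta l ord0|))) * sn n.
  rewrite mulr_suml; apply: eq_bigr => k _; rewrite mulr_suml; apply: eq_bigr => l _.
  by rewrite !vE; ring.
have S2 : \sum_k (4 * sn n + 8 * (M * `|(sn n *: delta) k ord0|) +
    `|rn n / sn n * rank_drift Pf k ((sn n *: delta) k ord0) - mu k ord0|) <=
   (\sum_k (4 + 8 * (M * `|delta k ord0|))) * sn n + (\sum_k B k) * (rn n * sn n) +
   (\sum_k (2 * `|(A *m delta) k ord0|)) * `|rn n - r0|.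
  rewrite !mulr_suml -!big_split; apply: ler_sum => k _ /=.
  by have := b_le k; rewrite vE; lra.
have := ler_wpM2l (ltW etai) S2.
rewrite S1; move: sl Cbe; rewrite /a1 /a2 /a3 /a4 !mulrDr !mulrDl.
rewrite -!mulrA; lra.
Unshelve. all: by end_near.
Qed.

(** The parameters are chosen in the order imposed by their dependence: the width
    [e] of the cut-offs from the continuity of the limit at [x], then the
    constant [C] and the radius [Cb], then the tolerance [eta], and [n] last. *)
Theorem chi2_limit : cvg_in_distribution S (noncentral_chi2 K dpar).
Proof.
move=> x; set m := chi2_mean K dpar.
have nuE y : noncentral_chi2 K dpar `]-oo, y]%classic = (radial_cdf m y)%:E by exact: noncentral_chi2E.
rewrite nuE => cx.
have cr : radial_cdf m y @[y --> x] --> radial_cdf m x.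
  move: cx; rewrite (_ : (fun y => _) = (fun y => (radial_cdf m y)%:E)); last exact/funext.
  by move=> /fine_cvg.
have cdfE n : cdf (S n) x = (fine (P n [set w | S n w <= x]))%:E.
  rewrite fineK; last first.
    apply: fin_num_measure; rewrite -[X in measurable X]setTI.
    exact: (measurable_fun_ler (measurable_funP (S n)) (measurable_cst x)).
  by congr (P n _); apply/seteqP; split => w /=; rewrite in_itv.
rewrite (funext cdfE); apply: cvg_EFin; first by apply: nearW.
apply/cvgrPdist_le => eps eps0 /=.
have eps2 : 0 < eps / 2 by rewrite divr_gt0.
have [e0 /= e00 e0P] : \forall y \near x, `|radial_cdf m x - radial_cdf m y| <= eps / 2.
  by move/cvgrPdist_le : cr => /(_ _ eps2).
pose e := e0 / 8; have e_gt0 : 0 < e by rewrite divr_gt0.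
have near_x y : `|x - y| <= 4 * e -> `|radial_cdf m x - radial_cdf m y| <= eps / 2.
  by move=> xy; apply: e0P; rewrite /ball_ /=; apply: le_lt_trans xy _; rewrite /e; lra.
have [M F_lip] := marginal_cdf_lipschitz_unif Pf_density f_pos f_C1 fk_bounded.
have M0 : 0 <= M.
  have /andP[h1 h2] := F_lip (Ordinal K_gt0) _ _ (ler01 : 0 <= 1 :> R).
  by move: h2; rewrite subr0 mulr1; lra.
have [L [LSL Lmu]] := whiten_to_axis mu K_gt0 Sigma_pd.
rewrite noncentralityE -/m in Lmu.
have [C1 C10 sm1] := radial_cutoff_smooth m (x + e) e_gt0 K_gt0.
have [C2 C20 sm2] := radial_cutoff_smooth m (x - 4 * e) e_gt0 K_gt0.
pose C := C1 + C2.
have C0 : 0 <= C by exact: addr_ge0.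
have {}sm1 : smooth C (radial_cutoff (L *m mu) (x + e) e).
  by rewrite Lmu; apply: smooth_mono sm1; rewrite lerDl.
have {}sm2 : smooth C (radial_cutoff (L *m mu) (x - 4 * e) e).
  by rewrite Lmu; apply: smooth_mono sm2; rewrite lerDr.
pose b0 := \sum_k (`|mu k ord0| + 1).
have b00 : 0 <= b0 by apply: sumr_ge0 => k _; rewrite addr_ge0.
(* The Markov term is at most [eps / 4]; adding 1 keeps [Cb] positive. *)
pose Cb := b0 * (4 / eps) + 1.
have Cb0 : 0 < Cb by rewrite ltr_wpDl// mulr_ge0// divr_ge0// ltW.
have Cbe : Cb^-1 * b0 <= eps / 2 / 2.
  rewrite ler_pdivrMl// /Cb mulrDl mul1r.
  rewrite (_ : b0 * (4 / eps) * _ = b0); last by field; exact: lt0r_neq0.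
  by rewrite lerDl !divr_ge0// ltW.
have [Su _] := whiten_invmx LSL.
have [eta eta0 near_form] := qform_inv_near Su (ltW Cb0) e_gt0.
have [Bf BP] : exists Bf : 'I_K -> R, forall s k, 0 < s ->
   `|rank_drift Pf k (s * delta k ord0) + 2 * s * (A *m delta) k ord0| <= Bf k * s ^+ 2.
  have ex k : exists B, forall s, 0 < s ->
     `|rank_drift Pf k (s * delta k ord0) + 2 * s * (A *m delta) k ord0| <= B * s ^+ 2.
    by have [B _ BP] := rank_drift_expansion Pf_density f_pos f_C1 fisher_finite fk_bounded delta k; exists B.
  by have [Bf BfP] := choice ex; exists Bf => s k; exact: BfP.
have vanish := sample_bound_vanish C M0 eta0 eps2 BP Cbe L.
near=> n.
have /andP[m0 mlt] : (0 < n1 n < n)%N by near: n; exact: split_interior.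
have sb : sample_bound n Pf M (n1 n) (sn n *: delta) L mu C Cb eta <= eps / 2.
  by near: n; exact: vanish.
have SnE w : rank_cov_hat (shifted_sample (Y n) (n1 n) (sn n *: delta) w) \in unitmx ->
    S n w = change_statistic (shifted_sample (Y n) (n1 n) (sn n *: delta) w) (n1 n).
  by rewrite shifted_centered_sample; exact: S_def.
have mS : measurable_fun [set: T n] (S n) by exact: measurable_funP.
have /andP[lo hi] := statistic_cdf_sandwich (@measurable_centered_sample n) (@centered_sample_indep n)
  (@centered_sample_law n) F_lip m0 mlt LSL mS SnE C0 Cb0 eta0 e_gt0 near_form sm1 sm2.
rewrite Lmu in lo hi.
have n1x : `|x - (x - 4 * e)| <= 4 * e by rewrite opprB addrC subrK ger0_norm ?mulr_ge0// ltW.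
have n2x : `|x - (x + 4 * e)| <= 4 * e by rewrite opprD addrA subrr sub0r normrN ger0_norm ?mulr_ge0// ltW.
exact: (sandwich_dist lo hi sb (near_x _ n1x) (near_x _ n2x)).
Unshelve. all: by end_near.
Qed.

End theorem.

Theorem theorem3 (R : realType) (K : nat) (K_gt0 : (0 < K)%N)
    (f : 'cV[R]_K -> R) (Pf : probability 'cV[R]_K R)
    (Pf_density : has_density Pf f)
    (f_sym : forall x, f (- x) = f x)
    (f_pos : forall x, 0 < f x)
    (f_C1 : continuously_differentiable f)
    (delta : 'cV[R]_K)
    (d : nat -> measure_display) (T : forall n, measurableType (d n))
    (P : forall n, probability (T n) R)
    (X : forall n, 'I_n -> {RV (P n) >-> 'cV[R]_K})
    (n1 : nat -> nat)
    (X_indep : forall n,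
      independent_family (P n) (fun i : 'I_n => X n i : T n -> 'cV[R]_K))
    (X_before : forall n (i : 'I_n), (i < n1 n)%N ->
      has_density (distribution (P n) (X n i)) f)
    (X_after : forall n (i : 'I_n), (n1 n <= i)%N ->
      has_density (distribution (P n) (X n i))
        (fun x => f (x - (Num.sqrt n%:R)^-1 *: delta)))
    (Sigma_pd : posdef (rank_cov Pf))
    (fisher_finite : forall k l : 'I_K, Pf.-integrable [set: 'cV[R]_K]
      (fun x => (score f x k ord0 * score f x l ord0)%:E))
    (fk_bounded : forall k : 'I_K, exists M : R,
      forall t : R, (marginal_density f k t <= M%:E)%E)
    (S : forall n, {RV (P n) >-> R})
    (S_def : forall n w, rank_cov_hat (fun i => X n i w) \in unitmx ->
      S n w = change_statistic (fun i => X n i w) (n1 n))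
    (t1 : R) (t1_gt0 : 0 < t1) (t1_lt1 : t1 < 1)
    (n1_cvg : (n1 n)%:R / n%:R @[n --> \oo] --> t1) :
  cvg_in_distribution S
    (noncentral_chi2 K (4 * t1 * (1 - t1) *
      (delta^T *m (rank_score_cross Pf f)^T *m invmx (rank_cov Pf)
        *m rank_score_cross Pf f *m delta) ord0 ord0)).
Proof. exact: (chi2_limit K_gt0 Pf_density f_pos f_C1 Sigma_pd fisher_finite fk_bounded
  X_indep X_before X_after S_def t1_gt0 t1_lt1 n1_cvg).
Qed.
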